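(* Let $v$ be a weight in $\mathbb{R}^n$ and $1\le p<\infty$. Given $0<R<\infty$, consider the operator $$\mathcal{O}_R^* f(x)=\sup_{0<t<R}|W_t^{\mathcal{O}}f(x)|.$$ The following statements are equivalent: (1) There exist $0<R<\infty$ and a weight $w$ such that the operator $f\mapsto\mathcal{O}^*_R f$ is bounded from $L^p(\mathbb{R}^n,v(x)d\gamma(x))$ into $L^p(\mathbb{R}^n,w(x)d\gamma(x))$ if $p>1$; in the case $p=1$, from $L^1(\mathbb{R}^n,v(x)d\gamma(x))$ into weak-$L^1(\mathbb{R}^n,w(x)d\gamma(x))$. (2) There exist $0<R<\infty$ and a weight $w$ such that the operator $f\mapsto\mathcal{O}^*_R f$ is bounded from $L^p(\mathbb{R}^n,v(x)d\gamma(x))$ into weak-$L^p(\mathbb{R}^n,w(x)d\gamma(x))$. (3) There exists $0<R<\infty$ such that, for all $f\in L^p(\mathbb{R}^n,v(x)d\gamma(x))$, $W^{\mathcal{O}}_Rf(x)<\infty$ for almost every $x\in\mathbb{R}^n$ and the limit $\lim_{t\to0^+}W^{\mathcal{O}}_tf(x)$ exists for almost every $x\in\mathbb{R}^n$. (4) There exists $0<R<\infty$ such that, for all $f\in L^p(\mathbb{R}^n,v(x)d\gamma(x))$, $\mathcal{O}^*_R f(x)<\infty$ for almost every $x\in\mathbb{R}^n$. (5) The weight $v$ belongs to $D^W_p$.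
   Context: A weight on $\mathbb{R}^n$ is a strictly positive, locally integrable function on $\mathbb{R}^n$ (with respect to Lebesgue measure). For $t>0$ let $W_t(x)=(4\pi t)^{-n/2}e^{-|x|^2/(4t)}$, $x\in\mathbb{R}^n$. For $1\le p<\infty$ with conjugate exponent $p'$ ($1/p+1/p'=1$, $p'=\infty$ if $p=1$), a weight $v$ belongs to the class $D_p^W$ if there exists $t_0>0$ such that the pointwise product $x\mapsto W_{t_0}(x)\,v(x)^{-1/p}$ satisfies $\|W_{t_0}v^{-1/p}\|_{L^{p'}(\mathbb{R}^n,dx)}<\infty$ (Lebesgue measure, no Gaussian measure). $d\gamma(x)=\pi^{-n/2}e^{-|x|^2}dx$ is the Gaussian measure on $\mathbb{R}^n$. Let $\mathcal{O}=-\Delta+2x\cdot\nabla$ be the Ornstein–Uhlenbeck operator in $\mathbb{R}^n$. The solution $W^{\mathcal{O}}_tf=e^{-t\mathcal{O}}f$ of $u_t=-\mathcal{O}u$ in $\mathbb{R}^n\times(0,\infty)$, $u(x,0)=f(x)$, is given for $t>0$ by Mehler's formula $$W_t^{\mathcal{O}}f(x)=\frac{1}{(\pi(1-e^{-4t}))^{n/2}}\int_{\mathbb{R}^n}e^{-\frac{|y-e^{-2t}x|^2}{1-e^{-4t}}}f(y)\,dy.$$ Conventions: $W^{\mathcal{O}}_tf(x)<\infty$ means that the defining integral converges absolutely; if it does not, $|W^{\mathcal{O}}_tf(x)|$ is taken to be $+\infty$. Existence of a limit means existence of a finite limit. For a measure $\mu$, an operator $S$ is bounded from $L^p(\nu)$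 into weak-$L^p(\mu)$ if there is $C$ with $\mu(\{x:|Sf(x)|>\lambda\})\le C\lambda^{-p}\|f\|_{L^p(\nu)}^p$ for all $\lambda>0$ and all $f\in L^p(\nu)$; it is bounded from $L^p(\nu)$ into $L^p(\mu)$ if $\|Sf\|_{L^p(\mu)}\le C\|f\|_{L^p(\nu)}$ for all $f\in L^p(\nu)$. *)

(* Defs.v *)
From HB Require Import structures.
From mathcomp Require Import all_boot all_order all_algebra.
From mathcomp Require Import all_classical all_reals all_analysis.
From mathcomp Require Import measurable_realfun.

Set Implicit Arguments.
Unset Strict Implicit.
Unset Printing Implicit Defensive.

Import Order.TTheory GRing.Theory Num.Theory.
Import numFieldNormedType.Exports.

Local Open Scope classical_set_scope.
Local Open Scope ring_scope.

(* n-dimensional Lebesgue measure on the Borel sets of R^n is the iterated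
   product of [lebesgue_measure], transported along
   (x_0, (x_1, ..., x_n)) |-> (x_0, x_1, ..., x_n). *)
Section lebesgue_cons.
Context (R : realType) (n : nat).
Local Notation RT := (measurableTypeR R).
Variable m : {sigma_finite_measure set (n.-tuple RT) -> \bar R}.

Definition tcons (x : RT * n.-tuple RT) : n.+1.-tuple RT :=
  [the n.+1.-tuple RT of x.1 :: x.2].

Definition tuncons (x : n.+1.-tuple RT) : RT * n.-tuple RT :=
  (thead x, [tuple of behead x]).

Lemma measurable_tcons : measurable_fun setT tcons.
Proof. exact: measurable_cons. Qed.

Lemma measurable_tuncons : measurable_fun setT tuncons.
Proof.
apply: measurable_fun_pair; first exact: measurable_tnth.
exact: measurable_behead.
Qed.

Lemma tconsK : cancel tcons tuncons.
Proof. by case=> a t; congr pair; exact/val_inj. Qed.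

Definition lebesgue_cons : set (n.+1.-tuple RT) -> \bar R :=
  pushforward (@lebesgue_measure R \x m)%E tcons.

Let pm : {measure set (n.+1.-tuple RT) -> \bar R} :=
  measure_function_pushforward__canonical__measure_function_Measure
    (@lebesgue_measure R \x m)%E measurable_tcons.

Let lebesgue_cons0 : lebesgue_cons set0 = 0%E.
Proof. exact: (measure0 pm). Qed.

Let lebesgue_cons_ge0 A : (0 <= lebesgue_cons A)%E.
Proof. exact: (measure_ge0 pm). Qed.

Let lebesgue_cons_sigma_additive : semi_sigma_additive lebesgue_cons.
Proof. exact: (@measure_semi_sigma_additive _ _ _ pm). Qed.

HB.instance Definition _ := isMeasure.Build _ _ _ lebesgue_cons
  lebesgue_cons0 lebesgue_cons_ge0 lebesgue_cons_sigma_additive.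

(* The library's sigma-finite instance for \x is shadowed by the one for
   products of subprobabilities, hence the direct proof. *)
Let lebesgue_cons_sigma_finite : sigma_finite setT lebesgue_cons.
Proof.
have /sigma_finiteP[F [FT ndF mF]] := sigma_finiteT (@lebesgue_measure R).
have /sigma_finiteP[G [GT ndG mG]] := sigma_finiteT m.
exists (fun k => tuncons @^-1` (F k `*` G k)).
  rewrite -preimage_bigcup (_ : \bigcup_k (F k `*` G k) = setT) //.
  rewrite -setXTT FT GT predeqE => -[x y]; split => [[k _ []/= ? ?]|].
    by split; exists k.
  move=> [/= [i _ Fix] [j _ Gjy]]; exists (maxn i j) => //; split.
    by move: x Fix; exact/subsetPset/ndF/leq_maxl.
  by move: y Gjy; exact/subsetPset/ndG/leq_maxr.
move=> k; have [mFk Fkoo] := mF k; have [mGk Gkoo] := mG k; split.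
  rewrite -[X in measurable X]setTI.
  by apply: measurable_tuncons => //; exact: measurableX.
rewrite /lebesgue_cons /pushforward -comp_preimage.
rewrite (_ : tuncons \o tcons = id); last by apply/funext => x; exact: tconsK.
by rewrite preimage_id product_measure1E// lte_mul_pinfty// ge0_fin_numE.
Qed.

HB.instance Definition _ := @Measure_isSigmaFinite.Build _ _ _
  lebesgue_cons lebesgue_cons_sigma_finite.

End lebesgue_cons.

Fixpoint borel_lebesgue (R : realType) (n : nat) :
    {sigma_finite_measure set (n.-tuple (measurableTypeR R)) -> \bar R} :=
  match n with
  | 0 => @dirac _ _ [tuple] R
  | n'.+1 => lebesgue_cons (borel_lebesgue R n')
  end.

(* R^n with the sigma-algebra of all Lebesgue-measurable sets: the
   Caratheodory-measurable sets of the outer measure induced by the Borel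
   Lebesgue measure. *)
Definition euclid (R : realType) (n : nat) :=
  caratheodory_type (borel_lebesgue R n)^*%mu.

HB.instance Definition _ (R : realType) (n : nat) :=
  Measurable.on (euclid R n).

Definition lebesgue (R : realType) (n : nat) : set (euclid R n) -> \bar R :=
  @completed_measure_extension _ _ _ (borel_lebesgue R n).

HB.instance Definition _ (R : realType) (n : nat) :=
  Measure.on (@lebesgue R n).

Arguments lebesgue : clear implicits.

(* The measure h(x) dmu(x); the proof arguments serve only to let the measure
   structure be inferred. *)
Definition density_measure d (T : measurableType d) (R : realType)
    (mu : {measure set T -> \bar R}) (h : T -> R)
    (mh : measurable_fun setT h) (h_ge0 : forall x, 0 <= h x) :
    set T -> \bar R :=
  fun A => (\int[mu]_(x in A) (h x)%:E)%E.

Section density_measure.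
Context d (T : measurableType d) (R : realType).
Variables (mu : {measure set T -> \bar R}) (h : T -> R).
Hypotheses (mh : measurable_fun setT h) (h_ge0 : forall x, 0 <= h x).
Local Notation nu := (density_measure mu mh h_ge0).

Let density_measure0 : nu set0 = 0%E.
Proof. exact: integral_set0. Qed.

Let density_measure_ge0 A : (0 <= nu A)%E.
Proof. by apply: integral_ge0 => x _; rewrite lee_fin. Qed.

Let density_measure_sigma_additive : semi_sigma_additive nu.
Proof.
apply: (@semi_sigma_additive_nng_induced _ _ _ mu (EFin \o h)).
  exact/measurable_EFinP.
by move=> x; rewrite lee_fin.
Qed.

HB.instance Definition _ := isMeasure.Build _ _ _ nu
  density_measure0 density_measure_ge0 density_measure_sigma_additive.

End density_measure.

Section euclidean_space.
Context (R : realType) (n : nat).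
Local Notation E := (euclid R n).

Definition coord (x : E) (i : 'I_n) : R := tnth x i.

Definition sqnorm (x : E) : R := \sum_(i < n) coord x i ^+ 2.

Definition enorm (x : E) : R := Num.sqrt (sqnorm x).

Lemma measurable_coord i : measurable_fun setT (coord ^~ i).
Proof.
move=> _ B mB; rewrite setTI; apply: sub_caratheodory; apply: sub_sigma_algebra.
by rewrite -[X in measurable X]setTI; exact: measurable_tnth.
Qed.

Lemma measurable_sqnorm : measurable_fun setT sqnorm.
Proof.
apply: measurable_sum => i; apply: measurable_funX; exact: measurable_coord.
Qed.

Definition gauss_density (x : E) : R :=
  pi `^ (- (n%:R / 2)) * expR (- sqnorm x).

Lemma measurable_gauss_density : measurable_fun setT gauss_density.
Proof.
apply: measurable_funM; first exact: measurable_cst.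
apply: (measurableT_comp (@measurable_expR R)).
exact: measurable_funN measurable_sqnorm.
Qed.

Lemma gauss_density_ge0 x : 0 <= gauss_density x.
Proof. by rewrite mulr_ge0 ?powR_ge0 ?expR_ge0. Qed.

Definition gauss_measure : set E -> \bar R :=
  density_measure (lebesgue R n) measurable_gauss_density gauss_density_ge0.

HB.instance Definition _ := Measure.on gauss_measure.

Record weight := Weight {
  weight_fun :> E -> R ;
  weight_measurable : measurable_fun setT weight_fun ;
  weight_gt0 : forall x, 0 < weight_fun x ;
  weight_locally_integrable : forall r : R,
    (lebesgue R n).-integrable [set x | enorm x <= r] (EFin \o weight_fun)
}.

Lemma weight_ge0 (v : weight) x : 0 <= v x.
Proof. exact/ltW/weight_gt0. Qed.

Definition weighted_gauss (v : weight) : set E -> \bar R :=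
  density_measure gauss_measure (weight_measurable v) (weight_ge0 v).

HB.instance Definition _ (v : weight) := Measure.on (weighted_gauss v).

Definition heat_kernel (t : R) (x : E) : R :=
  (4 * pi * t) `^ (- (n%:R / 2)) * expR (- (sqnorm x / (4 * t))).

Definition DW (p : R) (v : weight) : Prop :=
  exists2 t0 : R, 0 < t0 &
    ('N[lebesgue R n]_(hoelder_conjugate p%:E)
      [(fun x => (heat_kernel t0 x * v x `^ (- p^-1))%:E)] < +oo)%E.

Definition mehler_exp (t : R) (x y : E) : R :=
  expR (- ((\sum_(i < n) (coord y i - expR (- (2 * t)) * coord x i) ^+ 2) /
           (1 - expR (- (4 * t))))).

Definition mehler_cvg (t : R) (f : E -> R) (x : E) : Prop :=
  (lebesgue R n).-integrable setT (fun y => (mehler_exp t x y * f y)%:E).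

(* W_t^O f(x), with the value +oo when the integral does not converge
   absolutely. *)
Definition mehler (t : R) (f : E -> R) (x : E) : \bar R :=
  if `[< mehler_cvg t f x >] then
    (((pi * (1 - expR (- (4 * t)))) `^ (n%:R / 2))^-1%:E *
     \int[lebesgue R n]_y (mehler_exp t x y * f y)%:E)%E
  else +oo%E.

Definition mehler_max (r : R) (f : E -> R) (x : E) : \bar R :=
  ereal_sup [set `|mehler t f x|%E | t in `]0, r[].

End euclidean_space.

Section boundedness.
Context d (T : measurableType d) (R : realType).
Implicit Types (p : R) (nu mu : {measure set T -> \bar R}).
Implicit Types S : (T -> R) -> T -> \bar R.

Definition strong_type p nu mu S : Prop := exists C : R,
  forall f : T -> R, f \in Lfun nu p%:E ->
    ('N[mu]_p%:E[S f] <= C%:E * 'N[nu]_p%:E[EFin \o f])%E.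

Definition weak_type p nu mu S : Prop := exists C : R,
  forall f : T -> R, f \in Lfun nu p%:E -> forall l : R, 0 < l ->
    (mu [set x | l%:E < `|S f x|] <=
     C%:E * (l `^ (- p))%:E * 'N[nu]_p%:E[EFin \o f] `^ p)%E.

End boundedness.

(* Main.v *)
Require Import Defs.
From HB Require Import structures.
From mathcomp Require Import all_boot all_order all_algebra.
From mathcomp Require Import all_classical all_reals all_analysis.
From mathcomp Require Import measurable_realfun ess_sup_inf ring lra zify.
(* restores [coord] as the coordinate of a point of R^n *)
Require Import Defs.

(** Write [W_t] for the Mehler means, [g_b(y) = exp(-b|y|^2)], and [vt] for the
    Lebesgue density of [v dgamma]. The five statements are all governed by the
    Gaussian-weighted spaces [L^1(g_b dx)]: by Hoelder, condition (5) embeds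
    [L^p(v dgamma)] in one of them ([DW_L1]), and such an embedding is what it
    takes for [W_t f] to make sense at all.

    Necessity. Each of (1)-(4) yields a time [r] at which every datum [f] has
    an absolutely convergent integral [W_r f(x)] at some point [x] (otherwise
    the maximal function would be infinite everywhere). In [y] the kernel at
    that point is at least a multiple of [g_a], [a = 2 / (1 - exp(-4r)) > 1], so
    [\int |f| g_a] is finite on [L^p(v dgamma)]. A gliding-hump argument makes
    this functional bounded ([finite_functional_bounded]), and the converse of
    Hoelder's inequality turns boundedness into the dual integrability (5)
    ([mehler_cvg_DW]); [a > 1 >= 1/p] leaves room for some [t0 > 0].

    Sufficiency. For small [t] the Mehler kernel, times [1 / g_b(y)], is at most
    a function [D] of [x] times a heat kernel centred at [x]; the latter is a
    geometrically weighted sum of normalised indicators of dyadic cubes plus a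
    constant. By the one-third trick each cube sits in a cell of one of [2^n]
    shifted dyadic grids, so [sup_t |W_t f|] is at most [D] times a sum of dyadic
    maximal functions of [u = |f| g_b] plus [\int u] ([mehler_max_le]). Stopping
    gives the weak type (1,1) for the grids, and a weight comparable with [D^-2]
    absorbs [D] ([mehler_max_weak_type]). This settles (4), and (1), (2) for
    [p = 1].

    For [p > 1] put [s = (g_b vt^(-1/p))^p'], integrable by (5), and [u = h s]:
    then [\int h^p s = \int |f|^p vt], and each average of [u] is an average of
    [s] times an average of [h] with respect to [s dx]. The maximal operator
    adapted to the measure [s dx] is bounded on [L^p(s dx)] whatever [s] is, so
    [w = D^-p s / (M s)^p], up to truncation, is a target weight
    ([heat_major_strong_type]).

    For (3) the weak type inequality makes the data with [W_t f -> f] almost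
    everywhere a closed subspace of [L^1(g_b dx)] ([ae_limit_closed]). It
    contains indicators of boxes, the kernel having mass one and being [O(t)]
    away from the diagonal, hence everything ([weighted_L1_ae_limit]). *)

Set Implicit Arguments.
Unset Strict Implicit.
Unset Printing Implicit Defensive.

Import Order.TTheory GRing.Theory Num.Theory.
Import numFieldNormedType.Exports.

Local Open Scope classical_set_scope.
Local Open Scope ring_scope.

(** * Integration against densities *)

Section measure_preliminaries.
Context d (T : measurableType d) (R : realType).
Variable mu : {measure set T -> \bar R}.
Local Open Scope ereal_scope.

(** The maximal function, a supremum over uncountably many times, is only ever
    compared with measurable majorants. The comparison is legitimate because the
    integral of any nonnegative function is a supremum over its simple
    minorants. *)
Lemma ge0_le_integral_any (D : set T) (f g : T -> \bar R) :
  (forall x, D x -> 0 <= f x) -> (forall x, D x -> f x <= g x) ->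
  \int[mu]_(x in D) f x <= \int[mu]_(x in D) g x.
Proof.
move=> f0 fg; have g0 x : D x -> 0 <= g x by move=> Dx; exact: le_trans (f0 x Dx) (fg x Dx).
rewrite !ge0_integralE//; apply: ereal_sup_le => _ [h hf <-]; exists h => // x.
apply: (le_trans (hf x)); rewrite /patch; case: ifPn => // /[!inE] Dx.
exact: fg.
Qed.

Lemma ge0_subset_integral_any (A B : set T) (f : T -> \bar R) :
  (forall x, 0 <= f x) -> A `<=` B ->
  \int[mu]_(x in A) f x <= \int[mu]_(x in B) f x.
Proof.
move=> f0 AB; rewrite integral_mkcond [leRHS]integral_mkcond.
apply: ge0_le_integral_any => x _; rewrite /patch.
  by case: ifP.
case: ifPn => [/[!inE] /AB Bx|_]; first by rewrite mem_set.
by case: ifP.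
Qed.

Lemma measurable_superlevel (g : T -> \bar R) (l : R) :
  measurable_fun setT g -> measurable [set x | l%:E < g x].
Proof.
by move=> mg; rewrite -[X in measurable X]setTI; exact: emeasurable_fun_o_infty.
Qed.

Import HBNNSimple.

Section density.
Variables (h : T -> R) (mh : measurable_fun setT h) (h0 : forall x, (0 <= h x)%R).
Local Notation nu := (density_measure mu mh h0).

Let integral_density_nnsfun (f : {nnsfun T >-> R}) :
  \int[nu]_x (f x)%:E = \int[mu]_x ((f x)%:E * (h x)%:E).
Proof.
have mEh : measurable_fun setT (EFin \o h) by exact/measurable_EFinP.
rewrite integralT_nnsfun sintegralE.
under [RHS]eq_integral.
  move=> x _; rewrite fimfunE -fsumEFin// ge0_mule_fsuml; last first.
    by move=> r; rewrite EFinM; exact: nnfun_muleindic_ge0.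
  over.
rewrite ge0_integral_fsum//; last 2 first.
- move=> r; apply: emeasurable_funM => //; apply/measurable_EFinP.
  exact: measurable_funM.
- move=> r x _; apply: mule_ge0; last by rewrite lee_fin.
  by rewrite EFinM; exact: nnfun_muleindic_ge0.
apply: eq_fsbigr => r; rewrite inE => -[t _ <-].
under [RHS]eq_integral do rewrite EFinM -muleA.
rewrite ge0_integralZl_EFin//.
- congr (_ * _).
  transitivity (\int[mu]_(x in f @^-1` [set f t]) (h x)%:E) => //.
  rewrite integral_mkcond; apply: eq_integral => x _.
  by rewrite epatch_indic muleC.
- by move=> x _; rewrite mule_ge0// lee_fin.
- apply: emeasurable_funM => //; exact/measurable_EFinP/measurable_indic.
Qed.

Lemma ge0_integral_density (f : T -> \bar R) :
  measurable_fun setT f -> (forall x, 0 <= f x) ->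
  \int[nu]_x f x = \int[mu]_x (f x * (h x)%:E).
Proof.
move=> mf f0; pose f_ := nnsfun_approx measurableT mf.
have mEh : measurable_fun setT (EFin \o h) by exact/measurable_EFinP.
transitivity (limn (fun n => \int[nu]_x (f_ n x)%:E)).
  rewrite -monotone_convergence//=.
  - apply: eq_integral => x _; apply: esym; apply: cvg_lim => //.
    exact: cvg_nnsfun_approx.
  - by move=> n; exact/measurable_EFinP.
  - by move=> n x _; rewrite lee_fin.
  - by move=> x _ a b ab; rewrite lee_fin; exact/lefP/nd_nnsfun_approx.
transitivity (limn (fun n => \int[mu]_x ((f_ n x)%:E * (h x)%:E))).
  by congr (limn _); apply/funext => n; exact: integral_density_nnsfun.
rewrite -monotone_convergence//=.
- apply: eq_integral => x _; apply: cvg_lim => //.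
  by apply: cvgeZr => //; exact: cvg_nnsfun_approx.
- by move=> n; apply: emeasurable_funM => //; exact/measurable_EFinP.
- by move=> n x _; rewrite mule_ge0// lee_fin.
- move=> x _ a b ab; rewrite lee_wpmul2r ?lee_fin//.
  exact/lefP/nd_nnsfun_approx.
Qed.
End density.
End measure_preliminaries.


(** * Lebesgue measure in coordinates *)

Section lebesgue_euclid.
Context (R : realType).
Local Notation RT := (measurableTypeR R).
Local Open Scope ereal_scope.

Lemma measurable_euclid n (A : set (n.-tuple RT)) :
  measurable A -> measurable (A : set (euclid R n)).
Proof. by move=> mA; exact: caratheodory_measurable_mu_ext. Qed.

Lemma lebesgueE n (A : set (n.-tuple RT)) :
  measurable A -> lebesgue R n A = borel_lebesgue R n A.
Proof. by move=> mA; exact: measurable_mu_extE. Qed.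

Lemma le_lebesgue n (A B : set (euclid R n)) :
  A `<=` B -> lebesgue R n A <= lebesgue R n B.
Proof. exact: (@le_mu_ext _ _ _ (borel_lebesgue R n)). Qed.

Lemma ge0_integral_lebesgue n (f : n.-tuple RT -> \bar R) :
  measurable_fun setT f -> (forall x, 0 <= f x) ->
  \int[lebesgue R n]_x f x = \int[borel_lebesgue R n]_x f x.
Proof.
move=> mf f0.
pose phi (x : euclid R n) : n.-tuple RT := x.
have mphi : measurable_fun setT phi.
  move=> _ B mB; rewrite setTI; exact: measurable_euclid.
have -> : \int[borel_lebesgue R n]_x f x =
    \int[pushforward (lebesgue R n) phi]_x f x.
  by apply: eq_measure_integral => A mA _; rewrite /= -lebesgueE.
by rewrite ge0_integral_pushforward.
Qed.

(** Tonelli, one coordinate at a time along the iterated product. *)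
Lemma integral_prod_coord n (phi : 'I_n -> R -> R) :
  (forall i, measurable_fun setT (phi i)) -> (forall i t, 0 <= phi i t)%R ->
  \int[lebesgue R n]_x (\prod_(i < n) phi i (coord x i))%:E =
  \prod_(i < n) \int[@lebesgue_measure R]_t (phi i t)%:E.
Proof.
move=> mphi phi0.
have mprod m (psi : 'I_m -> R -> R) : (forall i, measurable_fun setT (psi i)) ->
    measurable_fun setT (fun x : m.-tuple RT => (\prod_(i < m) psi i (tnth x i))%R).
  move=> mpsi; apply: (@measurable_prod _ _ _ _ _ _ (fun i x => psi i (tnth x i))) => i _.
  by apply: (measurableT_comp (mpsi i)); exact: measurable_tnth.
rewrite (@ge0_integral_lebesgue _ (fun x => (\prod_(i < n) phi i (tnth x i))%:E)); last 2 first.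
- by apply/measurable_EFinP; exact: mprod.
- by move=> x; rewrite lee_fin prodr_ge0.
elim: n phi mphi phi0 => [|n ih] phi mphi phi0.
  under eq_integral do rewrite big_ord0.
  by rewrite /= integral_dirac// diracT mul1e big_ord0.
rewrite big_ord_recl -ih//.
have mF : measurable_fun setT (fun x : n.+1.-tuple RT => (\prod_(i < n.+1) phi i (tnth x i))%:E).
  by apply/measurable_EFinP; exact: mprod.
rewrite [LHS](_ : _ = \int[pushforward (@lebesgue_measure R \x borel_lebesgue R n)%E (@tcons R n)]_x
   (\prod_(i < n.+1) phi i (tnth x i))%:E)//.
rewrite ge0_integral_pushforward//; last first.
- by move=> x _; rewrite lee_fin prodr_ge0.
- exact: measurable_tcons.
rewrite preimage_setT.
rewrite fubini_tonelli1; last 2 first.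
- by apply: measurableT_comp => //; exact: measurable_tcons.
- by move=> x; rewrite lee_fin prodr_ge0.
rewrite /fubini_F.
under eq_integral.
  move=> t _.
  rewrite [X in integral _ _ X](_ : _ = (fun y => (phi ord0 t)%:E * (\prod_(i < n) phi (lift ord0 i) (tnth y i))%:E)); last first.
    apply/funext => y /=; rewrite big_ord_recl EFinM; congr (_ * _).
    congr (_%:E); apply: eq_bigr => i _; congr (phi _ _).
    by rewrite (tnth_nth 0%R) (tnth_nth 0%R).
  rewrite ge0_integralZl_EFin//; last 2 first.
  - by move=> y _; rewrite lee_fin prodr_ge0.
  - by apply/measurable_EFinP; exact: (mprod n (fun i => phi (lift ord0 i))).
  over.
rewrite ge0_integralZr//.
- by apply/measurable_EFinP; exact: mphi.
- by move=> t _; rewrite lee_fin.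
- by apply: integral_ge0 => y _; rewrite lee_fin prodr_ge0.
Qed.

Lemma measurable_box n (B : 'I_n -> set R) : (forall i, measurable (B i)) ->
  measurable ([set x | forall i, B i (coord x i)] : set (euclid R n)).
Proof.
move=> mB; rewrite (_ : mkset _ = \bigcap_(i in [set: 'I_n]) ((fun x => coord x i) @^-1` B i)).
  apply: fin_bigcap_measurable => // i _; rewrite -[X in measurable X]setTI.
  exact: measurable_coord.
by apply/seteqP; split=> [x h i _|x h i]; [exact: h|exact: (h i I)].
Qed.

Lemma lebesgue_box n (B : 'I_n -> set R) : (forall i, measurable (B i)) ->
  lebesgue R n [set x | forall i, B i (coord x i)] =
  \prod_(i < n) @lebesgue_measure R (B i).
Proof.
move=> mB.
have mA := measurable_box mB.
rewrite -[X in lebesgue R n X]setIT -integral_indic//.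
transitivity (\int[lebesgue R n]_x (\prod_(i < n) \1_(B i) (coord x i))%:E).
  apply: eq_integral => x _; congr (_%:E).
  have [h|h] := pselect (forall i, B i (coord x i)); rewrite indicE.
    by rewrite mem_set// big1// => i _; rewrite indicE mem_set.
  rewrite memNset//; move/existsNP: h => [i hi].
  by rewrite (bigD1 i)//= indicE memNset// mul0r.
rewrite (@integral_prod_coord n (fun i => \1_(B i)))//.
by apply: eq_bigr => i _; (rewrite integral_indic ?setIT; last exact: mB); [|exact: measurableT].
Qed.

End lebesgue_euclid.

(** * Maximal functions over nested partitions *)

Lemma indic_boolE (T : Type) (R : pzRingType) (b : pred T) :
  (fun x => (b x)%:R : R) = \1_[set x | b x].
Proof.
apply/funext => x; rewrite indicE; have [bx|bx] := boolP (b x).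
  by rewrite mem_set.
by rewrite memNset//; exact/negP.
Qed.

Lemma ltr_nat_expr2 (R : realType) n : n%:R < 2 ^+ n :> R.
Proof. by rewrite -natrX ltr_nat ltn_expl. Qed.

Section nested_partitions.
Context d (T : measurableType d) (R : realType) (L : countType).
Variable c : nat -> T -> L.
Hypothesis mc : forall k l, measurable (c k @^-1` [set l]).
Hypothesis nested : forall k x y, c k.+1 x = c k.+1 y -> c k x = c k y.
Local Open Scope ereal_scope.

(** The cells of generation [k] are the fibres of a label with countably many
    values. *)
Definition cell k x := c k @^-1` [set c k x].

Lemma measurable_cell k x : measurable (cell k x).
Proof. exact: mc. Qed.

Lemma measurable_preimage_label k (P : set L) : measurable (c k @^-1` P).
Proof.
rewrite (_ : _ @^-1` P = \bigcup_i
    (if unpickle i is Some l then if l \in P then c k @^-1` [set l] else set0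
     else set0)).
  apply: bigcupT_measurable => i; case: unpickle => // l; case: ifP => // _.
apply/seteqP; split=> [x Px|x [i _]].
  by exists (pickle (c k x)) => //; rewrite pickleK mem_set.
by case: unpickle => // l; case: ifPn => // /[!inE] Pl /= ->.
Qed.

Lemma measurable_fun_label d' (U : measurableType d') k (G : L -> U) :
  measurable_fun setT (fun x => G (c k x)).
Proof.
move=> _ B _; rewrite setTI.
exact: (@measurable_preimage_label k (G @^-1` B)).
Qed.

Lemma le_measure_bigcup (mu nu : {measure set T -> \bar R}) (l : R)
    (F : (set T)^nat) : (0 <= l)%R ->
  (forall i, measurable (F i)) -> trivIset setT F ->
  (forall i, l%:E * mu (F i) <= nu (F i)) ->
  l%:E * mu (\bigcup_i F i) <= nu (\bigcup_i F i).
Proof.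
move=> l0 mF tF h; rewrite !measure_bigcup//.
rewrite -nneseriesZl//.
by apply: lee_nneseries => // i _; rewrite mule_ge0.
Qed.

(** Calderon-Zygmund stopping: the first level at which a cell is charged
    enough by [nu] is constant on cells, so the exceptional set splits into
    countably many disjoint charged cells. *)
Lemma maximal_weak_type (mu nu : {measure set T -> \bar R}) (l : R) :
  (0 <= l)%R ->
  let B := \bigcup_k [set x | l%:E * mu (cell k x) <= nu (cell k x)] in
  measurable B /\ l%:E * mu B <= nu B.
Proof.
move=> l0 /=; set S := fun k => [set x | l%:E * mu (cell k x) <= nu (cell k x)].
have mS k : measurable (S k).
  rewrite (_ : S k = c k @^-1` [set a | l%:E * mu (c k @^-1` [set a]) <=
                                        nu (c k @^-1` [set a])])//.
  exact: measurable_preimage_label.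
split; first exact: bigcupT_measurable.
rewrite (seqDU_bigcup_eq S).
have nested_le k j x y : (j <= k)%N -> c k x = c k y -> c j x = c j y.
  elim: k j => [j|k ih j]; first by rewrite leqn0 => /eqP ->.
  by rewrite leq_eqVlt => /predU1P[->//|]; rewrite ltnS => jk /nested; exact: ih.
have mD k : measurable (seqDU S k).
  by apply: measurableD => //; exact: bigsetU_measurable.
apply: le_measure_bigcup => // k.
have DE x y : c k x = c k y -> seqDU S k x -> seqDU S k y.
  move=> xy; have SS j : (j <= k)%N -> S j x -> S j y.
    by move=> jk; rewrite /S /cell /= (nested_le _ _ _ _ jk xy).
  rewrite /seqDU => -[Skx nx]; split; first exact: SS.
  rewrite -bigcup_mkord => -[j /= jk Sjy]; apply: nx; rewrite -bigcup_mkord.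
  exists j => //; move: Sjy.
  by rewrite /S /cell /= (nested_le _ _ _ _ (ltnW jk) xy).
have -> : seqDU S k = \bigcup_i (seqDU S k `&` c k @^-1` [set a | pickle a = i]).
  apply/seteqP; split=> [x Dx|x [i _ []]//].
  by exists (pickle (c k x)).
apply: le_measure_bigcup => //.
- move=> i; apply: measurableI => //; exact: measurable_preimage_label.
- by move=> i j _ _ [x [[_ /= <-] [_ /= <-]]].
- move=> i; have [->|/set0P[x [Dx /= xi]]] := eqVneq (seqDU S k `&` c k @^-1` [set a | pickle a = i]) set0.
    by rewrite !measure0 mule0.
  rewrite (_ : _ `&` _ = cell k x); first by case: Dx.
  apply/seteqP; split=> [y [_ /=]|y /= yx].
    by rewrite -xi => /(pcan_inj (@pickleK _)).
  split; first exact: DE Dx.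
  by rewrite /= yx.
Qed.

End nested_partitions.

Section marcinkiewicz.
Context d (T : measurableType d) (R : realType).
Variable mu : {measure set T -> \bar R}.
Variable p : R.
Hypothesis p1 : 1 < p.
Local Open Scope ereal_scope.

Let q := (p - 1)%R.
Let q0 : (0 < q)%R. Proof. by rewrite subr_gt0. Qed.
Let K := (1 - 2 `^ (- q))^-1%R.

Let two_q : (0 < (2 : R) `^ (- q) < 1)%R.
Proof.
rewrite powR_gt0//= /powR pnatr_eq0/= expR_lt1.
by rewrite nmulr_rlt0 ?oppr_lt0// ln_gt0// ltr1n.
Qed.

Let K0 : (0 < K)%R.
Proof. by rewrite invr_gt0 subr_gt0; case/andP: two_q. Qed.

Definition marcinkiewicz_const : R := (4 `^ p * K)%R.

(** Summation over the dyadic levels above [2 ^- m0]; these exhaust the positive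
    levels as [m0] grows. *)
Section scale.
Variable m0 : nat.
Let a (m : nat) : R := (2 ^+ m / 2 ^+ m0)%R.

Let a_gt0 m : (0 < a m)%R. Proof. by rewrite divr_gt0// exprn_gt0. Qed.

Let aS m : a m.+1 = (2 * a m)%R.
Proof. by rewrite /a exprS mulrA. Qed.

Let a_homo m n : (m <= n)%N -> (a m <= a n)%R.
Proof.
move=> mn; rewrite ler_pM2r ?invr_gt0 ?exprn_gt0//.
by rewrite ler_weXn2l// ler1n.
Qed.

Let a_unbounded (y : R) : exists m, (y < a m)%R.
Proof.
exists (Num.truncn (`|y| * 2 ^+ m0)).+1.
rewrite ltr_pdivlMr ?exprn_gt0//.
apply: (@le_lt_trans _ _ (`|y| * 2 ^+ m0)%R); first by rewrite ler_pM2r ?exprn_gt0// ler_norm.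
apply: (lt_le_trans (truncnS_gt _)).
exact/ltW/ltr_nat_expr2.
Qed.

Let geom_sum n y : (0 <= y)%R ->
  (\sum_(m < n) (a m `^ q * (a m < y)%R%:R) <= K * y `^ q)%R.
Proof.
move=> y0.
have all_sum k : (\sum_(m < k.+1) a m `^ q <= K * a k `^ q)%R.
  elim: k => [|k ih].
    rewrite big_ord1 ler_peMl ?powR_ge0// invf_ge1 ?subr_gt0; last by case/andP: two_q.
    by rewrite gerBl; case/andP: two_q => /ltW.
  rewrite big_ord_recr/=; apply: (le_trans (lerD ih (lexx _))).
  have -> : (a k = 2^-1 * a k.+1)%R by rewrite aS mulrA mulVf ?mul1r.
  rewrite powRM ?invr_ge0 ?(ltW (a_gt0 _))// -powR_inv1// -powRrM mulN1r mulrA.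
  rewrite -[X in (_ + X)%R]mul1r -mulrDl ler_pM2r ?powR_gt0//.
  rewrite -(@ler_pM2l _ (1 - 2 `^ (- q))) ?subr_gt0; last by case/andP: two_q.
  have u : (1 - 2 `^ (- q) != 0 :> R)%R by rewrite subr_eq0 gt_eqF//; case/andP: two_q.
  by rewrite /K mulrDr [X in (X + _)%R]mulrA mulfV// mulr1 mul1r addrC subrK.
elim: n => [|n ih]; first by rewrite big_ord0 mulr_ge0 ?powR_ge0// ltW.
rewrite big_ord_recr/=; case: (ltP (a n) y) => [any|_]; last by rewrite mulr0 addr0.
rewrite mulr1; apply: (@le_trans _ _ (K * a n `^ q)%R); last first.
  by rewrite ler_pM2l// ge0_ler_powR// ?nnegrE ?ltW.
apply: le_trans (all_sum n); rewrite big_ord_recr/= lerD2r.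
apply: ler_sum => m _; rewrite ler_piMr ?powR_ge0//.
by rewrite lern1 leq_b1.
Qed.

Let layer_bound (y : \bar R) : (a 0)%:E < y ->
  y `^ p <= \sum_(m <oo) ((2 * a m) `^ p * ((a m)%:E < y)%E%:R)%:E.
Proof.
move=> ay.
have S_ge m : (a m)%:E < y -> ((2 * a m) `^ p)%:E <=
    \sum_(m <oo) ((2 * a m) `^ p * ((a m)%:E < y)%E%:R)%:E.
  move=> amy; apply: le_trans (nneseries_lim_ge m.+1 _); last first.
    by move=> i _ _; rewrite lee_fin mulr_ge0// powR_ge0.
  rewrite big_nat_recr//= amy mulr1 leeDr//.
  by apply: sume_ge0 => i _; rewrite lee_fin mulr_ge0// powR_ge0.
have p0 : (0 < p)%R by exact: lt_trans p1.
case: y ay S_ge => [y| |] ay S_ge.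
- have ex : exists m, (y <= a m.+1)%R.
    by have [m ym] := a_unbounded y; exists m; rewrite ltW// (lt_le_trans ym)// a_homo.
  case: (ex_minnP ex) => m ym mmin.
  apply: le_trans (S_ge m _); last first.
    case: m ym mmin => [//|m] _ mmin.
    by rewrite lte_fin ltNge; apply/negP => /mmin; rewrite ltnn.
  rewrite lte_fin in ay; have y0 := lt_trans (a_gt0 0) ay.
  rewrite poweR_EFin lee_fin -aS; apply: ge0_ler_powR => //.
  - exact: ltW.
  - by rewrite nnegrE ltW.
  - by rewrite nnegrE ltW.
- rewrite poweRyr ?gt_eqF// leye_eq; apply/eqP/eqyP => M M0.
  have [m Mm] := a_unbounded (M + 1).
  apply: le_trans (S_ge m (ltry _)); rewrite lee_fin.
  have h1 : (1 <= 2 * a m)%R.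
    by move: Mm M0 (a_gt0 m); lra.
  apply: le_trans (le1r_powR h1 (ltW p1)).
  by move: Mm M0 (a_gt0 m); lra.
- by move: ay; rewrite ltNge leNye.
Qed.

Let half_level m (y : R) : (a m < 2 * y)%R = (a m / 2 < y)%R.
Proof. by move: (a m) => b; apply/idP/idP; lra. Qed.

Lemma strong_type_above_scale (g : T -> \bar R) (h : T -> R) :
  measurable_fun setT g -> measurable_fun setT h ->
  (forall x, 0 <= g x) -> (forall x, 0 <= h x)%R ->
  (forall l : R, (0 < l)%R -> l%:E * mu [set x | l%:E < g x] <=
     2%:E * \int[mu]_(x in [set x | (l / 2 < h x)%R]) (h x)%:E) ->
  \int[mu]_(x in [set x | (a 0)%:E < g x]) g x `^ p <=
  marcinkiewicz_const%:E * \int[mu]_x (h x `^ p)%:E.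
Proof.
move=> mg mh g0 h0 weak.
have mgl (l : R) : measurable [set x | l%:E < g x].
  exact: measurable_superlevel.
have mhl (l : R) : measurable [set x | (l < h x)%R].
  rewrite -[X in measurable X]setTI.
  by have := measurable_fun_ltr (measurable_cst l) mh; move=> /(_ measurableT [set true] I).
have mind (l : R) : measurable_fun setT (fun x => (((l%:E < g x)%E%:R : R))).
  by rewrite indic_boolE; exact: measurable_indic.
have mhind (l : R) : measurable_fun setT (fun x => (((l < h x)%R%:R : R))).
  by rewrite indic_boolE; exact: measurable_indic.
have mhp : measurable_fun setT (fun x => (h x `^ p)%R).
  exact: (@measurableT_comp _ _ _ _ _ _ (@powR R ^~ p)).
apply: (@le_trans _ _ (\int[mu]_x \sum_(m <oo) ((2 * a m) `^ p * ((a m)%:E < g x)%E%:R)%:E)).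
  rewrite integral_mkcond; apply: ge0_le_integral_any => x _.
    by rewrite /patch; case: ifP => // _; exact: poweR_ge0.
  rewrite /patch; case: ifPn => [/[!inE] /= ax|_]; first exact: layer_bound.
  by apply: nneseries_ge0 => i _ _; rewrite lee_fin mulr_ge0// powR_ge0.
rewrite integral_nneseries//; last 2 first.
- move=> m; apply/measurable_EFinP; apply: measurable_funM => //; exact: mind.
- by move=> m x _; rewrite lee_fin mulr_ge0// powR_ge0.
apply: (@le_trans _ _ (\sum_(m <oo) \int[mu]_x
    (2 * 2 `^ p * a m `^ q * (h x * (a m < 2 * h x)%R%:R))%:E)).
  apply: lee_nneseries => m _ //.
    by move=> _; apply: integral_ge0 => x _; rewrite lee_fin mulr_ge0// powR_ge0.
  under eq_integral do rewrite EFinM.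
  rewrite ge0_integralZl_EFin ?powR_ge0//; last first.
    by apply/measurable_EFinP; exact: mind.
  under [leRHS]eq_integral do rewrite EFinM.
  rewrite ge0_integralZl_EFin; last 4 first.
  - by [].
  - by move=> x _; rewrite lee_fin mulr_ge0.
  - apply/measurable_EFinP; apply: measurable_funM => //.
    rewrite (_ : (fun _ => _) = (fun x => (a m / 2 < h x)%R%:R)); first exact: mhind.
    by apply/funext => x; rewrite half_level.
  - by rewrite !mulr_ge0// powR_ge0.
  rewrite (_ : \int[mu]_x _ = mu [set x | (a m)%:E < g x]); last first.
    rewrite -[X in mu X]setIT -integral_indic//; apply: eq_integral => x _.
    by rewrite -(indic_boolE R (fun x => (a m)%:E < g x)).
  rewrite (_ : ((2 * a m) `^ p = 2 `^ p * a m `^ q * a m)%R); last first.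
    rewrite powRM// ?ltW// -mulrA; congr (_ * _)%R.
    rewrite -[X in (_ * X)%R]powRr1 ?ltW// -powRD; first by rewrite /q subrK.
    by rewrite (gt_eqF (a_gt0 m)) implybT.
  rewrite EFinM -muleA.
  have -> : (2 * 2 `^ p * a m `^ q = 2 `^ p * a m `^ q * 2)%R by ring.
  rewrite [in leRHS]EFinM -[leRHS]muleA lee_wpmul2l ?lee_fin ?mulr_ge0 ?powR_ge0//.
  apply: (le_trans (weak _ (a_gt0 m))); rewrite lee_wpmul2l ?lee_fin//.
  rewrite integral_mkcond; apply: ge0_le_integral_any => x _; rewrite /patch.
    by case: ifP => // _; rewrite lee_fin.
  case: ifPn => [/[!inE] /= ax|_]; last by rewrite lee_fin mulr_ge0.
  by rewrite half_level ax mulr1.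
rewrite -integral_nneseries//; last 2 first.
- move=> m; apply/measurable_EFinP; apply: measurable_funM => //.
  apply: measurable_funM => //.
  rewrite (_ : (fun _ => _) = (fun x => (a m / 2 < h x)%R%:R)); first exact: mhind.
  by apply/funext => x; rewrite half_level.
- by move=> m x _; rewrite lee_fin !mulr_ge0// powR_ge0.
rewrite -ge0_integralZl_EFin; last 4 first.
- by [].
- by move=> x _; rewrite lee_fin powR_ge0.
- exact/measurable_EFinP.
- by rewrite mulr_ge0 ?powR_ge0// ltW.
apply: ge0_le_integral_any => x _.
  by apply: nneseries_ge0 => m _ _; rewrite lee_fin !mulr_ge0// powR_ge0.
apply: lime_le.
  by apply: is_cvg_nneseries => m _ _; rewrite lee_fin !mulr_ge0// powR_ge0.
apply: nearW => n; rewrite big_mkord sumEFin -EFinM lee_fin.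
rewrite (eq_bigr (fun m : 'I_n => 2 * 2 `^ p * h x * (a m `^ q * (a m < 2 * h x)%R%:R))%R); last first.
  by move=> m _; ring.
rewrite -mulr_sumr.
apply: (le_trans (ler_wpM2l _ (geom_sum n (mulr_ge0 _ (h0 x))))) => //.
  by rewrite !mulr_ge0 ?powR_ge0.
rewrite le_eqVlt; apply/orP; left; apply/eqP.
rewrite /marcinkiewicz_const powRM//.
have -> : (4 = 2 * 2 :> R)%R by ring.
rewrite powRM//.
have [->|hx] := eqVneq (h x) 0%R.
  by rewrite !mulr0 !mul0r powR0 ?mulr0// gt_eqF// (lt_trans _ p1).
have e (y : R) : (0 < y)%R -> (y `^ p = y `^ q * y)%R.
  move=> y0; rewrite -[X in (_ * X)%R]powRr1 ?ltW// -powRD; first by rewrite /q subrK.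
  by rewrite (gt_eqF y0) implybT.
rewrite (e (h x)); last by rewrite lt_def hx h0.
rewrite (e 2%R)//; ring.
Qed.

End scale.

(** Marcinkiewicz interpolation between the weak (1,1) bound, in its
    self-improved form where only the part of [h] above half the level counts,
    and the trivial bound at infinity, by summing over the dyadic level sets. *)
Lemma strong_type_of_weak (g : T -> \bar R) (h : T -> R) :
  measurable_fun setT g -> measurable_fun setT h ->
  (forall x, 0 <= g x) -> (forall x, 0 <= h x)%R ->
  (forall l : R, (0 < l)%R -> l%:E * mu [set x | l%:E < g x] <=
     2%:E * \int[mu]_(x in [set x | (l / 2 < h x)%R]) (h x)%:E) ->
  \int[mu]_x g x `^ p <=
  marcinkiewicz_const%:E * \int[mu]_x (h x `^ p)%:E.
Proof.
move=> mg mh g0 h0 weak.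
have mgl (l : R) : measurable [set x | l%:E < g x].
  exact: measurable_superlevel.
pose F (k : nat) := [set x | (2 ^+ 0 / 2 ^+ k)%:E < g x].
have mgp : measurable_fun setT (fun x => g x `^ p).
  exact: (measurableT_comp (measurable_poweR p)).
have -> : \int[mu]_x g x `^ p = \int[mu]_(x in \bigcup_k F k) g x `^ p.
  rewrite [RHS]integral_mkcond; apply: eq_integral => x _; rewrite /patch.
  case: ifPn => //; rewrite notin_setE => nx.
  suff -> : g x = 0 by rewrite poweR0r// gt_eqF// (lt_trans _ p1).
  apply/eqP; rewrite eq_le g0 andbT; apply/lee_addgt0Pr => e e0; rewrite add0e.
  rewrite leNgt; apply/negP => ex; apply: nx.
  exists (Num.truncn e^-1).+1 => //; apply: lt_trans ex; rewrite lte_fin expr0 div1r.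
  rewrite -[ltRHS]invrK ltf_pV2 ?posrE ?invr_gt0 ?exprn_gt0//.
  apply: (lt_le_trans (truncnS_gt _)).
  exact/ltW/ltr_nat_expr2.
have nd : nondecreasing_seq F.
  move=> i j ij; rewrite subsetEset => x /=; apply: le_lt_trans.
  by rewrite lee_fin expr0 !div1r lef_pV2 ?posrE ?exprn_gt0// ler_weXn2l// ler1n.
have cvF := @ge0_nondecreasing_set_cvg_integral _ _ _ F (fun x => g x `^ p) mu nd (fun i => mgl _).
have := cvF _ _ => {}cvF.
rewrite -(cvg_lim _ (cvF _ _))//; last 2 first.
- by move=> i; exact: measurable_funTS.
- by move=> i x _; exact: poweR_ge0.
apply: lime_le.
  apply/cvg_ex; eexists; apply: cvF.
  - by move=> i; exact: measurable_funTS.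
  - by move=> i x _; exact: poweR_ge0.
by apply: nearW => k; exact: strong_type_above_scale.
Qed.

End marcinkiewicz.

Section weighted_maximal.
Context d (T : measurableType d) (R : realType).
Local Open Scope ereal_scope.

Lemma measurable_fun_ereal_sup (f : nat -> T -> \bar R) :
  (forall k, measurable_fun setT (f k)) ->
  measurable_fun setT (fun x => ereal_sup (range (f ^~ x))).
Proof.
move=> mf; apply: (measurability _ (ErealGenOInfty.measurableE R)) => //.
move=> /= _ [_ [a ->]] <-; rewrite setTI.
rewrite (_ : _ @^-1` _ = \bigcup_k [set x | a%:E < f k x]).
  by apply: bigcupT_measurable => k; exact: measurable_superlevel.
apply/seteqP; split=> [x /=|x [k _ /=]]; rewrite in_itv/= andbT.
  by move=> /ereal_sup_gt[_ [k _ <-]] ak; exists k.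
by move=> ak; apply: (lt_le_trans ak); apply: ereal_sup_ubound; exists k.
Qed.

Variables (L : countType) (c : nat -> T -> L).
Hypothesis mc : forall k l, measurable (c k @^-1` [set l]).
Hypothesis nested : forall k x y, c k.+1 x = c k.+1 y -> c k x = c k y.
Variable mu : {measure set T -> \bar R}.

(** A cell of zero or infinite measure contributes [0]. *)
Definition cell_max (h : T -> R) (x : T) : \bar R :=
  ereal_sup (range (fun k =>
    \int[mu]_(y in cell c k x) (h y)%:E * ((fine (mu (cell c k x)))^-1)%:E)).

Lemma cell_max_ge0 h x : (forall y, 0 <= h y)%R -> 0 <= cell_max h x.
Proof.
move=> h0; apply: le_ereal_sup_tmp; eexists; first by exists 0%N.
rewrite mule_ge0// ?lee_fin ?invr_ge0 ?fine_ge0//.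
by apply: integral_ge0 => y _; rewrite lee_fin.
Qed.

Lemma measurable_cell_max h : measurable_fun setT (cell_max h).
Proof.
apply: measurable_fun_ereal_sup => k.
exact: (measurable_fun_label mc k (fun l =>
  \int[mu]_(y in c k @^-1` [set l]) (h y)%:E * ((fine (mu (c k @^-1` [set l])))^-1)%:E)).
Qed.

(** Where the maximal function exceeds [l], the part of [h] above [l / 2] still
    has average at least [l / 2] on some cell; stopping applied to that part
    gives the self-improved weak bound, for the very measure [mu] that the
    averages are taken with. *)
Lemma cell_max_strong_type (p : R) (h : T -> R) : (1 < p)%R ->
  (forall k x, mu (cell c k x) < +oo) ->
  measurable_fun setT h -> (forall x, 0 <= h x)%R ->
  \int[mu]_x cell_max h x `^ p <=
  (marcinkiewicz_const p)%:E * \int[mu]_x (h x `^ p)%:E.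
Proof.
move=> p1 mufin mh h0; apply: strong_type_of_weak => //.
- exact: measurable_cell_max.
- by move=> x; exact: cell_max_ge0.
move=> l l0.
pose h' x := (h x * (l / 2 < h x)%R%:R)%R.
have mhl : measurable [set x | (l / 2 < h x)%R].
  rewrite -[X in measurable X]setTI.
  by have := measurable_fun_ltr (measurable_cst (l / 2)%R) mh; move=> /(_ measurableT [set true] I).
have mh' : measurable_fun setT h'.
  by apply: measurable_funM => //; rewrite indic_boolE; exact: measurable_indic.
have h'0 x : (0 <= h' x)%R by rewrite mulr_ge0.
pose nu : {measure set T -> \bar R} := density_measure mu mh' h'0.
have l20 : (0 <= l / 2)%R by rewrite divr_ge0// ltW.
have [mB] := maximal_weak_type mc nested mu nu l20; set B := \bigcup_k _.
rewrite EFinM => lB.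
have sub : [set x | l%:E < cell_max h x] `<=` B.
  move=> x /= /ereal_sup_gt[_ [k _ <-]] lk; exists k => //=.
  set Q := cell c k x in lk *.
  have mQ : measurable Q by exact: measurable_cell.
  have finQ : mu Q \is a fin_num by rewrite ge0_fin_numE//; exact: mufin.
  have lQ : l%:E * mu Q <= \int[mu]_(y in Q) (h y)%:E.
    have [Q0|Q0] := eqVneq (fine (mu Q)) 0%R.
      rewrite -(fineK finQ) Q0 mule0; apply: integral_ge0 => y _.
      by rewrite lee_fin.
    have Qp : (0 < fine (mu Q))%R by rewrite lt_def Q0 fine_ge0.
    by move: lk; rewrite lte_pdivlMr// fineK// => /ltW.
  have hQ : \int[mu]_(y in Q) (h y)%:E <= nu Q + (l / 2)%:E * mu Q.
    rewrite -integral_cst// -ge0_integralD//; last 2 first.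
    - by move=> y _; rewrite lee_fin.
    - by apply/measurable_EFinP; exact: measurable_funTS.
    apply: ge0_le_integral_any => y _; first by rewrite lee_fin.
    rewrite -EFinD lee_fin /h'; case: ltP => lh; first by rewrite mulr1 lerDl.
    by rewrite mulr0 add0r.
  have := le_trans lQ hQ; rewrite -leeBlDr ?fin_numM//.
  apply: le_trans; rewrite -(fineK finQ) -!EFinM -EFinB lee_fin.
  rewrite -mulrBl; apply: ler_wpM2r; first by rewrite fine_ge0.
  lra.
have lB2 : l%:E * mu B <= 2%:E * nu B.
  have -> : l = (2 * (l / 2))%R by field.
  by rewrite EFinM -muleA lee_wpmul2l// EFinM.
apply: le_trans (le_trans lB2 _).
  apply: lee_wpmul2l; first by rewrite lee_fin ltW.
  apply: le_measure; rewrite ?inE//.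
  exact/measurable_superlevel/measurable_cell_max.
rewrite lee_wpmul2l ?lee_fin//.
apply: (@le_trans _ _ (\int[mu]_x (h' x)%:E)).
  by apply: ge0_subset_integral_any => // x; rewrite lee_fin.
rewrite [leRHS]integral_mkcond; apply: ge0_le_integral_any => x _.
  by rewrite lee_fin.
rewrite /patch /h'; case: ifPn => [/[!inE]/= ->|/negP]; first by rewrite mulr1.
rewrite inE/= => /negP/negbTE ->.
by rewrite mulr0.
Qed.

End weighted_maximal.

(** * Shifted dyadic grids *)

Section dyadic_grids.
Context (R : realType) (n : nat).
Local Notation E := (euclid R n).
Implicit Types (tau : {ffun 'I_n -> bool}) (x y : E) (k : nat) (u : E -> R).

(** The [tau]-th dyadic grid, translated by 1/3 along the coordinates selected
    by [tau]. *)
Definition grid_label tau k x : {ffun 'I_n -> int} :=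
  [ffun i => Num.floor (2 ^+ k * (coord x i + (tau i)%:R / 3))].

Lemma floor_double (s t : R) :
  Num.floor (2 * s) = Num.floor (2 * t) -> Num.floor s = Num.floor t.
Proof.
suff half (r : R) : (2 * Num.floor r <= Num.floor (2 * r) <= 2 * Num.floor r + 1).
  by move=> e; move: (half s) (half t); rewrite e; lia.
have /andP[r1 r2] := floor_itv r.
apply/andP; split; first by rewrite floor_ge_int intrM ler_pM2l.
rewrite -ltzD1 -addrA floor_lt_int (_ : 2 * Num.floor r + (1 + 1) = 2 * (Num.floor r + 1)); last by lia.
by rewrite intrM ltr_pM2l.
Qed.

Lemma grid_nested tau k x y :
  grid_label tau k.+1 x = grid_label tau k.+1 y ->
  grid_label tau k x = grid_label tau k y.
Proof.
move=> e; apply/ffunP => i; move/ffunP/(_ i): e; rewrite !ffunE.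
by rewrite !exprS -!mulrA; exact: floor_double.
Qed.

Definition grid_side tau k (z : {ffun 'I_n -> int}) (i : 'I_n) : set R :=
  `[(z i)%:~R / 2 ^+ k - (tau i)%:R / 3, ((z i)%:~R + 1) / 2 ^+ k - (tau i)%:R / 3[%classic.

Lemma grid_preimageE tau k z :
  grid_label tau k @^-1` [set z] = [set x | forall i, grid_side tau k z i (coord x i)].
Proof.
have p2 : 0 < 2 ^+ k :> R by rewrite exprn_gt0.
have h x i : (grid_side tau k z i (coord x i)) <-> (grid_label tau k x i = z i).
  rewrite /grid_side /= in_itv/= ffunE.
  rewrite lerBlDr ltrBrDr ler_pdivrMr// ltr_pdivlMr// ![_ * 2 ^+ k]mulrC.
  split=> [h|<-]; first by apply/floor_def; rewrite intrD.
  by have := floor_itv (2 ^+ k * (coord x i + (tau i)%:R / 3)); rewrite intrD.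
apply/seteqP; split=> x /=; first by move=> xz i; apply/h; rewrite xz.
by move=> xz; apply/ffunP => i; apply/h.
Qed.

Lemma measurable_grid tau k z : measurable (grid_label tau k @^-1` [set z]).
Proof. by rewrite grid_preimageE; apply: measurable_box => i; exact: measurable_itv. Qed.

Lemma lebesgue_cell tau k x :
  lebesgue R n (cell (grid_label tau) k x) = ((2 ^+ (n * k))^-1)%:E.
Proof.
have p2 : 0 < 2 ^+ k :> R by rewrite exprn_gt0.
rewrite /cell grid_preimageE lebesgue_box; last by move=> i; exact: measurable_itv.
rewrite (eq_bigr (fun=> ((2 ^+ k)^-1)%:E)); last first.
  move=> i _; rewrite /grid_side lebesgue_measure_itv/= lte_fin ltrD2r ltr_pM2r ?invr_gt0//.
  by rewrite ltrDl ltr01 -EFinB; congr (_%:E); field; rewrite gt_eqF.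
by rewrite prodEFin prodr_const card_ord mulnC exprM exprVn.
Qed.

Lemma two_pow_mod3 k : exists q : nat, exists2 r : nat, (2 ^ k = 3 * q + r)%N & (r == 1%N) || (r == 2%N).
Proof.
elim: k => [|k [q [r e /orP[]/eqP er]]].
- by exists 0%N, 1%N.
- by exists (2 * q)%N, 2%N => //; rewrite expnS e er; lia.
- by exists (2 * q + 1)%N, 1%N => //; rewrite expnS e er; lia.
Qed.

(** One-third trick: [2 ^+ k] is not divisible by 3, so the endpoints of the grids
    of step 1 shifted by nothing and by [2 ^+ k / 3] stay 1/3 apart, and an
    interval of radius 1/6 misses the endpoints of one of them. *)
Lemma third_shift k (s : R) : exists b : bool, forall t, `|t - s| < 6^-1 ->
  Num.floor (t + b%:R * (2 ^+ k / 3)) = Num.floor (s + b%:R * (2 ^+ k / 3)).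
Proof.
have [q [r e r12]] := two_pow_mod3 k.
have -> : 2 ^+ k = 3 * q%:R + r%:R :> R by rewrite -natrX e natrD natrM.
have -> : (3 * q%:R + r%:R) / 3 = q%:R + r%:R / 3 :> R by field.
have /andP[] := floor_itv s; rewrite intrD; set a := Num.floor s => s1 s2.
have fl (z : int) (w : R) : z%:~R <= w -> w < z%:~R + 1 -> Num.floor w = z.
  by move=> w1 w2; apply: floor_def; rewrite w1 intrD.
have [h1|h1] := leP (a%:~R + 6^-1) s; last first.
  exists true => t; rewrite ltr_norml => /andP[t1 t2]; rewrite !mul1r.
  transitivity (a + q%:Z); last symmetry; apply: fl;
    case/orP: r12 => /eqP ->; rewrite intrD -pmulrn; move: s1 s2 h1 t1 t2; lra.
have [h2|h2] := leP s (a%:~R + 5 / 6).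
  exists false => t; rewrite ltr_norml => /andP[t1 t2]; rewrite !mul0r !addr0.
  by transitivity a; last symmetry; apply: fl; move: s1 s2 h1 h2 t1 t2; lra.
exists true => t; rewrite ltr_norml => /andP[t1 t2]; rewrite !mul1r.
transitivity (a + q%:Z + 1); last symmetry; apply: fl;
  case/orP: r12 => /eqP ->; rewrite !intrD -pmulrn; move: s1 s2 h2 t1 t2; lra.
Qed.

Lemma cube_sub_cell k x : exists tau, forall y,
  (forall i, `|coord y i - coord x i| < (6 * 2 ^+ k)^-1) ->
  cell (grid_label tau) k x y.
Proof.
have p2 : 0 < 2 ^+ k :> R by rewrite exprn_gt0.
have /choice[b hb] : forall i : 'I_n, exists b : bool, forall t : R,
    `|t - 2 ^+ k * coord x i| < 6^-1 ->
    Num.floor (t + b%:R * (2 ^+ k / 3)) =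
    Num.floor (2 ^+ k * coord x i + b%:R * (2 ^+ k / 3)).
  by move=> i; exact: third_shift.
exists (finfun b) => y yx; apply/ffunP => i; rewrite !ffunE.
rewrite !mulrDr (_ : 2 ^+ k * ((b i)%:R / 3) = (b i)%:R * (2 ^+ k / 3)); last by field.
apply: hb; rewrite -mulrBr normrM gtr0_norm//.
by rewrite -ltr_pdivlMl// mulrC -invfM; exact: yx.
Qed.

Local Open Scope ereal_scope.

Definition grid_max tau u x : \bar R :=
  ereal_sup (range (fun k => (2 ^+ (n * k))%:E *
    \int[lebesgue R n]_(y in cell (grid_label tau) k x) (u y)%:E)).

Lemma grid_max_ge0 tau u x : (forall y, 0 <= u y)%R -> 0 <= grid_max tau u x.
Proof.
move=> u0; apply: le_ereal_sup_tmp; eexists; first by exists 0%N.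
by rewrite mule_ge0 ?lee_fin ?exprn_ge0//; apply: integral_ge0 => y _; rewrite lee_fin.
Qed.

Lemma measurable_grid_max tau u : measurable_fun setT (grid_max tau u).
Proof.
apply: measurable_fun_ereal_sup => k.
exact: (measurable_fun_label (measurable_grid tau) k (fun l => (2 ^+ (n * k))%:E *
  \int[lebesgue R n]_(y in grid_label tau k @^-1` [set l]) (u y)%:E)).
Qed.

(** Cells of generation [k] have Lebesgue measure [2 ^- (n * k)], so [grid_max]
    is a maximal average and stopping applies. *)
Lemma grid_max_weak_type tau u (l : R) : (0 < l)%R ->
  measurable_fun setT u -> (forall x, 0 <= u x)%R ->
  l%:E * lebesgue R n [set x | l%:E < grid_max tau u x] <=
  \int[lebesgue R n]_x (u x)%:E.
Proof.
move=> l0 mu u0.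
pose nu : {measure set E -> \bar R} := density_measure (lebesgue R n) mu u0.
have [mB] := maximal_weak_type (measurable_grid tau) (@grid_nested tau) (lebesgue R n) nu (ltW l0).
set B := \bigcup_k _ => lB.
have sub : [set x | l%:E < grid_max tau u x] `<=` B.
  move=> x /= /ereal_sup_gt[_ [k _ <-]] lk; exists k => //=.
  have p2 : (0 < 2 ^+ (n * k) :> R)%R by rewrite exprn_gt0.
  by rewrite lebesgue_cell lee_pdivrMr// muleC ltW.
apply: (@le_trans _ _ (l%:E * lebesgue R n B)).
  by apply: lee_wpmul2l; [rewrite lee_fin ltW|exact: le_lebesgue].
apply: (le_trans lB).
by apply: ge0_subset_integral_any => // x; rewrite lee_fin.
Qed.

End dyadic_grids.

(** * The Mehler kernel *)

Section mehler_kernel.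
Context (R : realType) (n : nat).
Local Notation E := (euclid R n).
Implicit Types (x y : E) (b s t : R).

Definition gauss_weight b y : R := expR (- (b * sqnorm y)).

Definition sqdist x y : R := \sum_(i < n) (coord y i - coord x i) ^+ 2.

Lemma sqnorm_ge0 x : 0 <= sqnorm x.
Proof. by apply: sumr_ge0 => i _; exact: sqr_ge0. Qed.

Lemma sqdist_ge0 x y : 0 <= sqdist x y.
Proof. by apply: sumr_ge0 => i _; exact: sqr_ge0. Qed.

Lemma measurable_gauss_weight b : measurable_fun setT (gauss_weight b).
Proof.
apply: (measurableT_comp (@measurable_expR R)).
apply: measurable_funN; apply: measurable_funM; first exact: measurable_cst.
exact: measurable_sqnorm.
Qed.

Lemma gauss_weight_gt0 b y : 0 < gauss_weight b y. Proof. exact: expR_gt0. Qed.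

Lemma sqnorm_le_sqdist x y : sqnorm y <= 2 * sqdist x y + 2 * sqnorm x.
Proof.
rewrite /sqnorm /sqdist !mulr_sumr -big_split; apply: ler_sum => i _ /=.
have := sqr_ge0 (coord y i - coord x i - coord x i); nra.
Qed.

Section time.
Variable t : R.
Hypothesis t0 : 0 < t.
Local Notation s := (1 - expR (- (4 * t))).

Lemma mehler_var_gt0 : 0 < s.
Proof. by rewrite subr_gt0 expR_lt1 oppr_lt0 mulr_gt0. Qed.

Lemma mehler_var_lt1 : s < 1.
Proof. by rewrite ltrBlDr ltrDl expR_gt0. Qed.

Lemma mehler_var_le : s <= 4 * t.
Proof. by have := expR_ge1Dx (- (4 * t)); lra. Qed.

(** Mehler's exponent is comparable with a heat exponent centred at [x]: the
    drift [exp(-2t) x - x] is at most [s |x|], which costs a factor depending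
    on [x] only; the part of the Gaussian decay left over pays for the growth
    of [1 / gauss_weight b]. *)
Lemma mehler_exp_le b x y : 0 < b -> 8 * b * s <= 1 ->
  mehler_exp t x y <=
  expR ((1 + 2 * b) * sqnorm x) * expR (- (sqdist x y / (4 * s))) * gauss_weight b y.
Proof.
move=> b0 bs; have s0 := mehler_var_gt0; have s1 := mehler_var_lt1.
rewrite /mehler_exp /gauss_weight -!expRD ler_expR.
set c := expR (- (2 * t)).
have cc : c * c = expR (- (4 * t)) by rewrite -expRD; congr expR; ring.
have c0 : 0 < c by exact: expR_gt0.
have c1 : c < 1 by rewrite expR_lt1 oppr_lt0 mulr_gt0.
have d1 : 1 - c <= s by rewrite -cc; nra.
have low : sqdist x y / 2 - s * sqnorm x <=
    \sum_(i < n) (coord y i - c * coord x i) ^+ 2.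
  rewrite /sqnorm /sqdist mulr_suml mulr_sumr -sumrB; apply: ler_sum => i _ /=.
  set u := coord x i; set w := coord y i.
  have h1 : 0 <= (w - u + 2 * ((1 - c) * u)) ^+ 2 by exact: sqr_ge0.
  have h2 : (1 - c) ^+ 2 * u ^+ 2 <= s * u ^+ 2.
    by apply: ler_wpM2r; [exact: sqr_ge0|nra].
  have -> : w - c * u = (w - u) + (1 - c) * u by ring.
  nra.
have yd := sqnorm_le_sqdist x y.
have x0 := sqnorm_ge0 x; have sd0 := sqdist_ge0 x y.
move: low yd; set S := \sum_(i < n) _; set D := sqdist x y; set X := sqnorm x.
move=> low yd.
have h : D / (2 * s) - X <= S / s.
  rewrite -(ler_pM2r s0) divfK ?gt_eqF//.
  suff -> : (D / (2 * s) - X) * s = D / 2 - s * X by [].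
  by field; rewrite gt_eqF.
have h2 : 2 * b * D <= D / (4 * s).
  rewrite ler_pdivlMr ?mulr_gt0// (_ : 2 * b * D * (4 * s) = 8 * b * s * D); last by ring.
  by rewrite ler_piMl.
have h3 : D / (2 * s) = D / (4 * s) + D / (4 * s) by field; rewrite gt_eqF.
have h4 : b * sqnorm y <= 2 * b * D + 2 * b * X by nra.
lra.
Qed.

Lemma mehler_factor_le :
  ((pi * s) `^ (n%:R / 2))^-1 <= (Num.sqrt s ^+ n)^-1.
Proof.
have s0 := mehler_var_gt0.
have e : s `^ (n%:R / 2) = Num.sqrt s ^+ n.
  by rewrite [n%:R / 2]mulrC powRrM (powR12_sqrt (ltW s0)) powR_mulrn ?sqrtr_ge0.
rewrite -e lef_pV2 ?posrE ?powR_gt0 ?mulr_gt0 ?pi_gt0//.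
apply: ge0_ler_powR; rewrite ?nnegrE; last 1 first.
- by apply: ler_peMl; [exact: ltW|apply: le_trans (pi_ge2 R); rewrite ler1n].
- by rewrite divr_ge0.
- exact: ltW.
- by rewrite mulr_ge0 ?pi_ge0// ltW.
Qed.

End time.

Lemma expRN_le (w : R) m : 0 < w -> expR (- w) <= m.+1`!%:R / w ^+ m.+1.
Proof.
move=> w0; rewrite expRN -[leRHS]invf_div lef_pV2 ?posrE ?expR_gt0 ?divr_gt0 ?exprn_gt0 ?ltr0n ?fact_gt0//.
apply: le_trans (expR_ge1Dxn m (ltW w0)).
by rewrite lerDr.
Qed.

Lemma sqdist_ge (x y : E) (r : R) i : 0 <= r ->
  r <= `|coord y i - coord x i| -> r ^+ 2 <= sqdist x y.
Proof.
move=> r0 h; rewrite /sqdist (bigD1 i)//=.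
apply: ler_wpDr; first by apply: sumr_ge0 => l _; exact: sqr_ge0.
by rewrite -[leRHS]real_normK ?num_real// ler_pXn2r// nnegrE.
Qed.

(** Off a cube around [x] the exponential beats the normalising factor
    [s ^ (- n / 2)], with one power of [s] to spare. *)
Lemma gauss_far (x y : E) s (r : R) i : 0 < s -> s < 1 -> 0 < r ->
  r <= `|coord y i - coord x i| ->
  (Num.sqrt s ^+ n)^-1 * expR (- (sqdist x y / (4 * s))) <=
  n.+1`!%:R * (4 / r ^+ 2) ^+ n.+1 * s.
Proof.
move=> s0 s1 r0 ri; have q0 : 0 < Num.sqrt s by rewrite sqrtr_gt0.
have q1 : Num.sqrt s <= 1 by rewrite -(sqrtr1 R) ler_wsqrtr// ltW.
have qs : Num.sqrt s ^+ 2 = s by rewrite sqr_sqrtr// ltW.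
have w0 : 0 < r ^+ 2 / (4 * s) by rewrite divr_gt0 ?exprn_gt0 ?mulr_gt0.
have h1 : expR (- (sqdist x y / (4 * s))) <= expR (- (r ^+ 2 / (4 * s))).
  by rewrite ler_expR lerN2 ler_pM2r ?invr_gt0 ?mulr_gt0//; apply: sqdist_ge ri; exact: ltW.
apply: le_trans (ler_wpM2l _ (le_trans h1 (expRN_le n w0))) _.
  by rewrite invr_ge0 exprn_ge0// ltW.
rewrite mulrCA -[leRHS]mulrA ler_wpM2l//.
have e : (r ^+ 2 / (4 * s))^-1 = 4 / r ^+ 2 * s by field; rewrite !gt_eqF.
rewrite -[X in _ * X <= _]exprVn e exprMn mulrCA ler_wpM2l//.
  by rewrite exprn_ge0// divr_ge0// exprn_ge0// ltW.
rewrite mulrC ler_pdivrMr ?exprn_gt0//.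
rewrite -{1}qs -exprM -{2}qs -exprD.
by apply: ler_wiXn2l; [exact: ltW|exact: q1|lia].
Qed.

Definition in_cube x k y := [forall i, `|coord y i - coord x i| < (6 * 2 ^+ k)^-1].

Lemma measurable_in_cube x k : measurable [set y | in_cube x k y].
Proof.
rewrite (_ : mkset _ = [set y | forall i, [set r : R | `|r - coord x i| < (6 * 2 ^+ k)^-1] (coord y i)]).
  apply: (@measurable_box _ _ (fun i => [set r : R | `|r - coord x i| < (6 * 2 ^+ k)^-1])) => i.
  rewrite (_ : mkset _ = `]coord x i - (6 * 2 ^+ k)^-1, coord x i + (6 * 2 ^+ k)^-1[%classic); first exact: measurable_itv.
  by apply/seteqP; split=> r /=; rewrite in_itv/= ltr_distl.
by apply/seteqP; split=> y /forallP.
Qed.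

Let A : R := n.+1`!%:R * (2 ^+ 10) ^+ n.+1.

Let A_ge1 : 1 <= A.
Proof.
apply: mulr_ege1; first by rewrite ler1n fact_gt0.
by do 2 apply: exprn_ege1; rewrite ler1n.
Qed.

Let A_gt0 : 0 < A. Proof. exact: lt_le_trans A_ge1. Qed.

Definition cube_const : R := 2 ^+ n * A.

Lemma cube_const_gt0 : 0 < cube_const.
Proof. by apply: mulr_gt0 => //; rewrite exprn_gt0. Qed.

Lemma cube_const_ge1 : 1 <= cube_const.
Proof. by apply: mulr_ege1 => //; apply: exprn_ege1; rewrite ler1n. Qed.

Let A_le_cube_const : A <= cube_const.
Proof. by apply: ler_peMl; [exact: ltW|apply: exprn_ege1; rewrite ler1n]. Qed.

Lemma dyadic_scale (q : R) : 0 < q -> q < 1 -> exists j : nat, (2 ^+ j.+1)^-1 <= q < (2 ^+ j)^-1.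
Proof.
move=> q0 q1; have ex : exists j : nat, (2 ^+ j.+1)^-1 <= q.
  exists (Num.truncn q^-1); rewrite -[leRHS]invrK lef_pV2 ?posrE ?exprn_gt0 ?invr_gt0//.
  by apply/ltW; apply: (lt_trans (truncnS_gt _)); exact: ltr_nat_expr2.
case: (ex_minnP ex) => j jq jmin; exists j; rewrite jq/=.
case: j jq jmin => [|j] jq jmin; first by rewrite expr0 invr1.
by rewrite ltNge; apply/negP => /jmin; rewrite ltnn.
Qed.

Lemma cube_exponent j k : (k <= j)%N ->
  (j - k + j.+1 * n = n + n * k + (j - k) * n.+1)%N.
Proof.
move=> kj; rewrite -{2}(subnK kj); move: (j - k)%N => e.
by rewrite mulnS mulSn mulnDl (mulnC k); lia.
Qed.

(** The heat kernel at variance [s ~ 4 ^ -j] is a superposition, with geometric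
    weights, of normalised indicators of the cubes of side [2 ^ -k], [k <= j],
    up to a bounded remainder far from [x]. *)
Lemma gauss_le_cubes s : 0 < s -> s < 1 -> exists j : nat, forall x y,
  (Num.sqrt s ^+ n)^-1 * expR (- (sqdist x y / (4 * s))) <=
  cube_const *
    (\sum_(k < j.+1) (2 ^+ (j - k))^-1 * (2 ^+ (n * k) * (in_cube x k y)%:R) + 1).
Proof.
move=> s0 s1; have q0 : 0 < Num.sqrt s by rewrite sqrtr_gt0.
have q1 : Num.sqrt s < 1 by rewrite -[ltRHS](sqrtr1 R) ltr_sqrt.
have qs : Num.sqrt s ^+ 2 = s by rewrite sqr_sqrtr// ltW.
have [j /andP[jq qj]] := dyadic_scale q0 q1; exists j => x y.
have sum0 : 0 <= \sum_(k < j.+1) (2 ^+ (j - k))^-1 * (2 ^+ (n * k) * (in_cube x k y)%:R) :> R.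
  by apply: sumr_ge0 => k _; rewrite !mulr_ge0// ?invr_ge0 exprn_ge0.
have [cube0|] := boolP (in_cube x 0 y); last first.
  rewrite negb_forall => /existsP[i]; rewrite -leNgt expr0 mulr1 => hi.
  apply: le_trans (gauss_far s0 s1 _ hi) _; first by rewrite invr_gt0.
  apply: (@le_trans _ _ cube_const); last by rewrite ler_peMr ?lerDr// ltW// cube_const_gt0.
  apply: le_trans A_le_cube_const; rewrite -[leRHS]mulr1.
  apply: ler_pM; [|exact: ltW| |exact: ltW].
    by rewrite mulr_ge0// exprn_ge0// divr_ge0// exprn_ge0// invr_ge0.
  rewrite /A ler_wpM2l//; apply: lerXn2r; rewrite ?nnegrE ?exprn_ge0//.
  lra.
have ex : exists k, (k <= j)%N && in_cube x k y by exists 0%N.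
have bnd k : (k <= j)%N && in_cube x k y -> (k <= j)%N by case/andP.
(* the smallest cube containing [y]: its term alone dominates the kernel *)
case: (ex_maxnP ex bnd) => k /andP[kj ck] kmax.
have kj1 : (k < j.+1)%N by [].
have sumk : (2 ^+ (j - k))^-1 * 2 ^+ (n * k) <=
    \sum_(k < j.+1) (2 ^+ (j - k))^-1 * (2 ^+ (n * k) * (in_cube x k y)%:R) + 1 :> R.
  apply: ler_wpDr => //; rewrite (bigD1 (Ordinal kj1))//= ck mulr1.
  apply: ler_wpDr => //; apply: sumr_ge0 => l _.
  by rewrite !mulr_ge0// ?invr_ge0 exprn_ge0.
apply: le_trans (ler_wpM2l (ltW cube_const_gt0) sumk).
have qn : (Num.sqrt s ^+ n)^-1 <= 2 ^+ (j.+1 * n).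
  rewrite exprM -[leRHS]invrK lef_pV2 ?posrE ?invr_gt0 ?exprn_gt0//.
  by rewrite -exprVn; apply: lerXn2r => //; rewrite nnegrE ?(ltW q0)// invr_ge0 exprn_ge0.
suff eb : expR (- (sqdist x y / (4 * s))) <=
    A * (2 ^+ ((j - k) * n.+1))^-1.
  apply: le_trans (ler_pM _ _ qn eb) _; rewrite ?invr_ge0 ?exprn_ge0 ?expR_ge0 ?(ltW q0)//.
  rewrite /cube_const [2 ^+ n * A]mulrC -[leRHS]mulrA mulrCA ler_wpM2l//; first exact: ltW.
  rewrite ler_pdivrMr ?exprn_gt0// [2 ^+ n * _]mulrCA -mulrA ler_pdivlMl ?exprn_gt0// -!exprD.
  by rewrite cube_exponent.
have [jk|jk] := eqVneq j k.
  rewrite jk subnn mul0n expr0 invr1 mulr1 (le_trans _ A_ge1)// expR_le1.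
  by rewrite oppr_le0 divr_ge0 ?sqdist_ge0 ?mulr_ge0 ?ltW.
have kj' : (k < j)%N by rewrite ltn_neqAle eq_sym jk.
have : ~~ in_cube x k.+1 y.
  by apply/negP => ck1; have := kmax k.+1; rewrite ck1 kj' => /(_ isT); rewrite ltnn.
rewrite negb_forall => /existsP[i]; rewrite -leNgt => hi.
have r0 : 0 < (6 * 2 ^+ k.+1)^-1 :> R by rewrite invr_gt0 mulr_gt0 ?exprn_gt0.
have sd := sqdist_ge (ltW r0) hi.
have w : (2 ^+ 2) ^+ (j - k) / 2 ^+ 10 <= sqdist x y / (4 * s).
  have s4 : s <= ((2 ^+ j)^-1) ^+ 2.
    by rewrite -qs; apply: lerXn2r; rewrite ?nnegrE ?(ltW q0) ?(ltW qj)// invr_ge0 exprn_ge0.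
  rewrite ler_pdivlMr ?mulr_gt0//; apply: le_trans sd.
  apply: le_trans (ler_wpM2l _ (ler_wpM2l _ s4)) _ => //.
  have -> : (2 : R) ^+ j = 2 ^+ (j - k) * 2 ^+ k by rewrite -exprD subnK.
  rewrite [2 ^+ k.+1]exprS exprAC.
  set a : R := 2 ^+ (j - k); set c : R := 2 ^+ k.
  have a0 : 0 < a by rewrite exprn_gt0.
  have c0 : 0 < c by rewrite exprn_gt0.
  have -> : a ^+ 2 / 2 ^+ 10 * (4 * (a * c)^-1 ^+ 2) = (c ^+ 2)^-1 * (4 / 2 ^+ 10).
    by field; rewrite !gt_eqF.
  have -> : (6 * (2 * c))^-1 ^+ 2 = (c ^+ 2)^-1 * (12^-1 ^+ 2).
    by field; rewrite gt_eqF.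
  by rewrite ler_wpM2l ?invr_ge0 ?exprn_ge0 ?ltW//; lra.
have w0 : 0 < (2 ^+ 2) ^+ (j - k) / 2 ^+ 10 :> R by rewrite divr_gt0 ?exprn_gt0.
apply: (@le_trans _ _ (expR (- ((2 ^+ 2) ^+ (j - k) / 2 ^+ 10)))); first by rewrite ler_expR lerN2.
apply: le_trans (expRN_le n w0) _; rewrite /A -mulrA ler_wpM2l//.
rewrite expr_div_n invf_div ler_wpM2l ?exprn_ge0// lef_pV2 ?posrE ?exprn_gt0//.
rewrite exprM; apply: lerXn2r; rewrite ?nnegrE ?exprn_ge0//.
by apply: lerXn2r; rewrite ?nnegrE ?exprn_ge0// ler_eXnr// ler1n.
Qed.

End mehler_kernel.

(** * The dyadic majorant of the Mehler means *)

Section heat_majorant.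
Context (R : realType) (n : nat).
Local Notation E := (euclid R n).
Local Notation leb := (lebesgue R n).
Implicit Types (x y : E) (u : E -> R) (b t : R).
Local Open Scope ereal_scope.

(** The shifted grids together control averages over all small cubes centred at
    [x], and the integral of [u] controls what happens far from [x]. *)
Definition local_max u x : \bar R := \sum_(tau : {ffun 'I_n -> bool}) grid_max tau u x.

Definition heat_major u x : \bar R := 2%:E * local_max u x + \int[leb]_y (u y)%:E.

Lemma local_max_ge0 u x : (forall y, 0 <= u y)%R -> 0 <= local_max u x.
Proof. by move=> u0; apply: sume_ge0 => tau _; exact: grid_max_ge0. Qed.

Lemma heat_major_ge0 u x : (forall y, 0 <= u y)%R -> 0 <= heat_major u x.
Proof.
move=> u0; apply: adde_ge0; first by rewrite mule_ge0// local_max_ge0.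
by apply: integral_ge0 => y _; rewrite lee_fin.
Qed.

Lemma measurable_local_max u : measurable_fun setT (local_max u).
Proof. by apply: emeasurable_sum => tau; exact: measurable_grid_max. Qed.

Lemma measurable_heat_major u : measurable_fun setT (heat_major u).
Proof.
apply: emeasurable_funD; last exact: measurable_cst.
by apply: measurable_funeM; exact: measurable_local_max.
Qed.

Lemma integral_cube_le u x k : measurable_fun setT u -> (forall y, 0 <= u y)%R ->
  \int[leb]_y (2 ^+ (n * k) * (in_cube x k y)%:R * u y)%:E <= local_max u x.
Proof.
move=> mu u0; have [tau sub] := cube_sub_cell k x.
apply: (@le_trans _ _ (grid_max tau u x)); last first.
  rewrite /local_max (bigD1 tau)//= leeDl//.
  by apply: sume_ge0 => i _; exact: grid_max_ge0.
apply: (@le_trans _ _ ((2 ^+ (n * k))%:E * \int[leb]_(y in cell (grid_label tau) k x) (u y)%:E)); last first.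
  by apply: ereal_sup_ubound; exists k.
under eq_integral do rewrite -mulrA EFinM.
rewrite ge0_integralZl_EFin; last 4 first.
- exact: measurableT.
- by move=> y _; rewrite lee_fin mulr_ge0.
- apply/measurable_EFinP; apply: measurable_funM; last exact: mu.
  by rewrite (indic_boolE _ (in_cube x k)); apply: measurable_indic; exact: measurable_in_cube.
- by rewrite exprn_ge0.
apply: lee_wpmul2l; first by rewrite lee_fin exprn_ge0.
rewrite [leRHS]integral_mkcond; apply: ge0_le_integral_any => y _.
  by rewrite lee_fin mulr_ge0.
rewrite /patch; case: ifPn => [_|]; first by rewrite lee_fin ler_piMl// lern1 leq_b1.
rewrite notin_setE => ny; have [/forallP/sub//|_] := boolP (in_cube x k y).
by rewrite mul0r.
Qed.

Lemma sum_half_powers j : (\sum_(k < j.+1) (2 ^+ (j - k))^-1 <= 2 :> R)%R.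
Proof.
elim: j => [|j ih]; first by rewrite big_ord1 subnn expr0 invr1 ler1n.
rewrite big_ord_recr/= subnn expr0 invr1.
rewrite (eq_bigr (fun k : 'I_j.+1 => 2^-1 * (2 ^+ (j - k))^-1)%R); last first.
  by move=> k _; rewrite subSn ?exprS ?invfM// -ltnS.
rewrite -mulr_sumr; move: ih; set S := (\sum_(_ < _) _)%R; lra.
Qed.

Definition mehler_factor t : R := ((pi * (1 - expR (- (4 * t)))) `^ (n%:R / 2))^-1.

Lemma mehler_factor_gt0 t : (0 < t)%R -> (0 < mehler_factor t)%R.
Proof.
by move=> t0; rewrite invr_gt0 powR_gt0// mulr_gt0 ?pi_gt0// mehler_var_gt0.
Qed.

(** The variance [s = 1 - exp(-4t)] is at most [4t], so [32 b t <= 1] is what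
    makes [8 b s <= 1]. *)
Lemma mehler_kernel_le b t x y : (0 < b)%R -> (0 < t)%R -> (32 * b * t <= 1)%R ->
  (mehler_factor t * mehler_exp t x y <=
   expR ((1 + 2 * b) * sqnorm x) * gauss_weight b y *
   ((Num.sqrt (1 - expR (- (4 * t))) ^+ n)^-1 *
    expR (- (sqdist x y / (4 * (1 - expR (- (4 * t))))))))%R.
Proof.
move=> b0 t0 bt; have s4 := mehler_var_le t; have s0 := mehler_var_gt0 t0.
have bs : (8 * b * (1 - expR (- (4 * t))) <= 1)%R.
  apply: le_trans bt; have -> : (32 * b * t = 8 * b * (4 * t))%R by ring.
  by rewrite ler_wpM2l// mulr_ge0// ltW.
have := ler_pM (ltW (mehler_factor_gt0 t0)) (expR_ge0 _) (mehler_factor_le n t0) (mehler_exp_le t0 x y b0 bs).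
move/le_trans; apply.
by rewrite le_eqVlt; apply/orP; left; apply/eqP; ring.
Qed.

Definition mehler_growth b x : R := (cube_const R n * expR ((1 + 2 * b) * sqnorm x))%R.

Lemma mehler_growth_gt0 b x : (0 < mehler_growth b x)%R.
Proof. by rewrite mulr_gt0 ?cube_const_gt0// expR_gt0. Qed.

Lemma measurable_mehler_growth b : measurable_fun setT (mehler_growth b).
Proof.
apply: measurable_funM; first exact: measurable_cst.
apply: (measurableT_comp (@measurable_expR R)).
apply: measurable_funM; first exact: measurable_cst.
exact: measurable_sqnorm.
Qed.

(** Each normalised cube integral is a maximal average and the geometric weights
    sum to at most 2, whence a bound uniform in [t]. *)
Lemma mehler_integral_le b t (f : E -> R) x :
  (0 < b)%R -> (0 < t)%R -> (32 * b * t <= 1)%R -> measurable_fun setT f ->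
  \int[leb]_y (mehler_factor t * mehler_exp t x y * `|f y|)%:E <=
  (mehler_growth b x)%:E * heat_major (fun y => `|f y| * gauss_weight b y)%R x.
Proof.
move=> b0 t0 bt mf; set u := (fun y : E => _).
have mu : measurable_fun setT u.
  by apply: measurable_funM; [exact: measurableT_comp|exact: measurable_gauss_weight].
have u0 y : (0 <= u y)%R by rewrite mulr_ge0// ltW// gauss_weight_gt0.
have [j hj] := gauss_le_cubes n (mehler_var_gt0 t0) (mehler_var_lt1 t).
have mcube k : measurable_fun setT (fun y => (in_cube x k y)%:R : R).
  by rewrite (indic_boolE _ (in_cube x k)); apply: measurable_indic; exact: measurable_in_cube.
apply: (@le_trans _ _ (\int[leb]_y ((mehler_growth b x)%:E *
   (\sum_(k < j.+1) ((2 ^+ (j - k))^-1)%:E * (2 ^+ (n * k) * (in_cube x k y)%:R * u y)%:E + (u y)%:E)))).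
  apply: ge0_le_integral_any => y _.
    by rewrite lee_fin !mulr_ge0// ?expR_ge0// ltW// mehler_factor_gt0.
  rewrite (eq_bigr (fun k : 'I_j.+1 => ((2 ^+ (j - k))^-1 * (2 ^+ (n * k) * (in_cube x k y)%:R * u y))%:E)) => [|k _]; last by rewrite EFinM.
  rewrite sumEFin -EFinD -EFinM lee_fin.
  apply: (le_trans (ler_wpM2r (normr_ge0 _) (mehler_kernel_le x y b0 t0 bt))).
  have h := ler_wpM2l (expR_ge0 ((1 + 2 * b) * sqnorm x)) (ler_wpM2l (u0 y) (hj x y)).
  apply: le_trans (le_trans h _); rewrite le_eqVlt; apply/orP; left; apply/eqP.
    by rewrite /u; ring.
  rewrite /mehler_growth mulrDr mulr1 mulr_sumr.
  rewrite mulrA [RHS]mulrDr mulr_sumr !mulr_sumr mulrDr !mulr_sumr.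
  congr (_ + _)%R; last by ring.
  by apply: eq_bigr => k _; ring.
have mterm k : measurable_fun setT (fun y => ((2 ^+ (j - k))^-1)%:E * (2 ^+ (n * k) * (in_cube x k y)%:R * u y)%:E).
  apply: measurable_funeM; apply/measurable_EFinP; apply: measurable_funM; last exact: mu.
  by apply: measurable_funM; [exact: measurable_cst|exact: mcube].
have term0 k y : 0 <= ((2 ^+ (j - k))^-1)%:E * (2 ^+ (n * k) * (in_cube x k y)%:R * u y)%:E.
  rewrite -EFinM lee_fin; apply: mulr_ge0; first by rewrite invr_ge0 exprn_ge0.
  by apply: mulr_ge0; [rewrite mulr_ge0 ?exprn_ge0|exact: u0].
have mu' : measurable_fun setT (fun y => (u y)%:E) by exact/measurable_EFinP.
have msum : measurable_fun setT (fun y => \sum_(k < j.+1) ((2 ^+ (j - k))^-1)%:E * (2 ^+ (n * k) * (in_cube x k y)%:R * u y)%:E).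
  by apply: emeasurable_sum => k; exact: mterm.
rewrite ge0_integralZl_EFin; last 4 first.
- exact: measurableT.
- by move=> y _; apply: adde_ge0; [apply: sume_ge0 => k _; exact: term0|rewrite lee_fin].
- by apply: emeasurable_funD; [exact: msum|exact: mu'].
- exact/ltW/mehler_growth_gt0.
apply: lee_wpmul2l; first by rewrite lee_fin ltW// mehler_growth_gt0.
rewrite ge0_integralD; last 5 first.
- exact: measurableT.
- by move=> y _; apply: sume_ge0 => k _; exact: term0.
- exact: msum.
- by move=> y _; rewrite lee_fin.
- exact: mu'.
apply: leeD; last exact: lexx.
rewrite ge0_integral_sum; last 3 first.
- exact: measurableT.
- by move=> k; exact: mterm.
- by move=> k y _; exact: term0.
apply: (@le_trans _ _ (\sum_(k < j.+1) ((2 ^+ (j - k))^-1)%:E * local_max u x)).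
  apply: lee_sum => k _; rewrite ge0_integralZl_EFin; last 4 first.
  - exact: measurableT.
  - by move=> y _; rewrite lee_fin; apply: mulr_ge0; [rewrite mulr_ge0 ?exprn_ge0|exact: u0].
  - apply/measurable_EFinP; apply: measurable_funM; last exact: mu.
    by apply: measurable_funM; [exact: measurable_cst|exact: mcube].
  - by rewrite invr_ge0 exprn_ge0.
  apply: lee_wpmul2l; first by rewrite lee_fin invr_ge0 exprn_ge0.
  exact: integral_cube_le.
rewrite -ge0_sume_distrl; last by move=> k _; rewrite lee_fin invr_ge0 exprn_ge0.
rewrite sumEFin; apply: lee_wpmul2r; first exact: local_max_ge0.
by rewrite lee_fin sum_half_powers.
Qed.

Lemma measurable_mehler_exp t x : measurable_fun setT (mehler_exp t x).
Proof.
apply: (measurableT_comp (@measurable_expR R)); apply: measurable_funN.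
apply: measurable_funM; last exact: measurable_cst.
apply: measurable_sum => i; apply: measurable_funX; apply: measurable_funB.
  exact: measurable_coord.
exact: measurable_cst.
Qed.

(** When the integral on the left diverges, both sides are infinite. *)
Lemma mehler_abs_le_integral t (f : E -> R) x : (0 < t)%R -> measurable_fun setT f ->
  `|mehler t f x| <= \int[leb]_y (mehler_factor t * mehler_exp t x y * `|f y|)%:E.
Proof.
move=> t0 mf.
have me := measurable_mehler_exp t x.
have c0 := ltW (mehler_factor_gt0 t0).
have mef : measurable_fun setT (fun y => (mehler_exp t x y * f y)%:E).
  by apply/measurable_EFinP; apply: measurable_funM; [exact: me|exact: mf].
have -> : \int[leb]_y (mehler_factor t * mehler_exp t x y * `|f y|)%:E =
    (mehler_factor t)%:E * \int[leb]_y `|(mehler_exp t x y * f y)%:E|.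
  rewrite -ge0_integralZl_EFin; last 4 first.
  - exact: measurableT.
  - by move=> y _; exact: abse_ge0.
  - exact: (measurableT_comp _ mef).
  - exact: c0.
  apply: eq_integral => y _; rewrite -EFinM normrM (ger0_norm (expR_ge0 _)).
  by rewrite mulrA.
rewrite /mehler; case: asboolP => [cv|ncv].
  rewrite abseM gee0_abs ?lee_fin//; apply: lee_wpmul2l; first by rewrite lee_fin.
  by apply: le_abse_integral; [exact: measurableT|exact: mef].
rewrite leye_eq; apply/eqP.
have -> : \int[leb]_y `|(mehler_exp t x y * f y)%:E| = +oo.
  apply: contra_notP ncv => /eqP; rewrite -ltey => h; apply/integrableP; split => //; exact: mef.
by rewrite gt0_muley// lte_fin mehler_factor_gt0.
Qed.

Lemma mehler_abs_le b t (f : E -> R) x :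
  (0 < b)%R -> (0 < t)%R -> (32 * b * t <= 1)%R -> measurable_fun setT f ->
  `|mehler t f x| <=
  (mehler_growth b x)%:E * heat_major (fun y => `|f y| * gauss_weight b y)%R x.
Proof.
move=> b0 t0 bt mf; apply: le_trans (mehler_integral_le x b0 t0 bt mf).
exact: mehler_abs_le_integral.
Qed.

Lemma mehler_max_le b r (f : E -> R) x :
  (0 < b)%R -> (32 * b * r <= 1)%R -> measurable_fun setT f ->
  mehler_max r f x <=
  (mehler_growth b x)%:E * heat_major (fun y => `|f y| * gauss_weight b y)%R x.
Proof.
move=> b0 br mf; apply: ge_ereal_sup => _ [t /= + <-]; rewrite in_itv/= => /andP[t0 tr].
apply: mehler_abs_le => //; apply: le_trans br.
by rewrite ler_wpM2l ?mulr_ge0 ?(ltW b0)// ltW.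
Qed.

Lemma gauss_density_le1 x : (gauss_density x <= 1)%R.
Proof.
rewrite /gauss_density; apply: mulr_ile1; rewrite ?powR_ge0 ?expR_ge0//; last first.
  by rewrite expR_le1 oppr_le0 sqnorm_ge0.
rewrite powRN invf_le1 ?powR_gt0 ?pi_gt0//.
have pi1 : (1 <= pi :> R)%R by apply: le_trans (pi_ge2 R); rewrite ler1n.
rewrite -[leLHS](powRr0 (pi : R)); by apply: ler_powR => //; rewrite divr_ge0.
Qed.

Lemma gauss_density_gt0 x : (0 < gauss_density x)%R.
Proof. by rewrite /gauss_density mulr_gt0 ?powR_gt0 ?pi_gt0 ?expR_gt0. Qed.

Lemma integral_gauss_weight_lty b : (0 < b)%R ->
  \int[leb]_y (gauss_weight b y)%:E < +oo.
Proof.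
move=> b0.
pose phi (i : 'I_n) (r : R) := expR (- (b * r ^+ 2)).
have -> : \int[leb]_y (gauss_weight b y)%:E =
    \int[leb]_y (\prod_(i < n) phi i (coord y i))%:E.
  apply: eq_integral => y _; congr (_%:E).
  by rewrite /gauss_weight /sqnorm mulr_sumr -sumrN expR_sum.
have mphi i : measurable_fun setT (phi i).
  apply: (measurableT_comp (@measurable_expR R)); apply: measurable_funN.
  by apply: measurable_funM => //; exact: measurable_funX.
rewrite integral_prod_coord//; last by move=> i r; exact: expR_ge0.
have phi_fin i : \int[lebesgue_measure]_r (phi i r)%:E < +oo.
  set s : R := Num.sqrt (2 * b)^-1.
  have s0 : (s != 0)%R by rewrite gt_eqF// sqrtr_gt0 invr_gt0 mulr_gt0.
  have e r : phi i r = ((normal_peak s)^-1 * normal_pdf 0 s r)%R.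
    rewrite normal_pdfE// mulrA mulVf ?mul1r; last by rewrite gt_eqF// normal_peak_gt0.
    rewrite /phi /normal_fun subr0 sqr_sqrtr ?invr_ge0 ?mulr_ge0 ?(ltW b0)//.
    by congr expR; field; rewrite gt_eqF.
  under eq_integral do rewrite e EFinM.
  rewrite ge0_integralZl_EFin//.
  - by rewrite integral_normal_pdf mule1 ltry.
  - by move=> r _; rewrite lee_fin normal_pdf_ge0.
  - by apply/measurable_EFinP; exact: measurable_normal_pdf.
  - by rewrite invr_ge0 normal_peak_ge0.
suff : 0 <= \prod_(i < n) \int[lebesgue_measure]_r (phi i r)%:E < +oo by case/andP.
elim/big_ind : _ => [|a c /andP[a0 ay] /andP[c0 cy]|i _].
- by rewrite ltry andbT.
- by rewrite mule_ge0// lte_mul_pinfty// ge0_fin_numE.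
- by rewrite phi_fin andbT; apply: integral_ge0 => r _; rewrite lee_fin expR_ge0.
Qed.

Lemma integral_scaled_gauss_weight_lty b (c : R) : (0 < b)%R -> (0 <= c)%R ->
  \int[leb]_y (c%:E * (gauss_weight b y)%:E) < +oo.
Proof.
move=> b0 c0; rewrite ge0_integralZl_EFin; last 4 first.
- exact: measurableT.
- by move=> x _; rewrite lee_fin ltW// gauss_weight_gt0.
- by apply/measurable_EFinP; exact: measurable_gauss_weight.
- exact: c0.
by rewrite lte_mul_pinfty ?lee_fin//; exact: integral_gauss_weight_lty.
Qed.

End heat_majorant.

(** * Weak type inequalities *)

Lemma measurable_fun_inv d (T : measurableType d) (R : realType) (D : T -> R) :
  measurable_fun setT D -> (forall x, 0 < D x) ->
  measurable_fun setT (fun x => (D x)^-1).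
Proof.
move=> mD D0; rewrite (_ : (fun x => _) = (fun x => D x `^ (-1))).
  exact: (measurableT_comp (measurable_powR (-1))).
by apply/funext => x; rewrite powR_inv1// ltW.
Qed.

Section weak_type_tools.
Context d (T : measurableType d) (R : realType).
Variable mu : {measure set T -> \bar R}.
Local Open Scope ereal_scope.

Lemma le_measure_fin_cover (I : finType) (A : set T) (B : I -> set T) :
  measurable A -> (forall i, measurable (B i)) ->
  (forall x, A x -> exists i, B i x) -> mu A <= \sum_i mu (B i).
Proof.
move=> mA mB AB.
rewrite -[A]setIT -integral_indic//.
under eq_bigr do rewrite -[B _]setIT -integral_indic//.
rewrite -ge0_integral_sum//; last first.
  by move=> i; apply/measurable_EFinP; exact: measurable_indic.
apply: ge0_le_integral_any => x _; first by rewrite lee_fin.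
rewrite sumEFin lee_fin indicE; have [/set_mem/AB[i Bi]|_] := boolP (x \in A).
  rewrite (bigD1 i)//= indicE mem_set//= lerDl.
  by apply: sumr_ge0 => j _; rewrite indicE.
by apply: sumr_ge0 => i _; rewrite indicE.
Qed.

Lemma sum_half_geometric m : (\sum_(k < m) (2 ^+ k)^-1 <= 2 :> R)%R.
Proof.
suff -> : (\sum_(k < m) (2 ^+ k)^-1 = 2 - 2 * (2 ^+ m)^-1 :> R)%R.
  by rewrite gerBl mulr_ge0// invr_ge0 exprn_ge0.
elim: m => [|m ih]; first by rewrite big_ord0 expr0 invr1 mulr1 subrr.
rewrite big_ord_recr/= ih exprS; field; rewrite expf_neq0//.
Qed.

(** A weak type bound survives multiplication by an arbitrary function [D >= 1]
    once the measure is divided by [D ^ 2]: on the dyadic shell [D ~ 2 ^ k] the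
    level drops by [2 ^ k] and the measure by [4 ^ k]. *)
Lemma weak_type_mul (D : T -> R) (g : T -> \bar R) (A : \bar R) :
  measurable_fun setT D -> measurable_fun setT g ->
  (forall x, 1 <= D x)%R -> (forall x, 0 <= g x) -> 0 <= A ->
  (forall l : R, (0 < l)%R -> l%:E * mu [set x | l%:E < g x] <= A) ->
  forall l : R, (0 < l)%R ->
  l%:E * \int[mu]_(x in [set x | l%:E < (D x)%:E * g x]) ((D x ^+ 2)^-1)%:E <= 4%:E * A.
Proof.
move=> mD mg D1 g0 A0 weak l l0.
have mgl (r : R) : measurable [set x | r%:E < g x].
  exact: measurable_superlevel.
pose a (k : nat) : R := (l / 2 ^+ k.+1)%R.
have a0 k : (0 < a k)%R by rewrite divr_gt0// exprn_gt0.
pose F (k : nat) (x : T) : \bar R := ((4 ^+ k)^-1)%:E * (\1_[set y | ((a k)%:E < g y)%E] x)%:E.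
have F0 k x : 0 <= F k x by rewrite /F -EFinM lee_fin mulr_ge0 ?invr_ge0 ?exprn_ge0.
have mind k : measurable_fun setT (fun x : T => (\1_[set y | ((a k)%:E < g y)%E] x : R)%:E).
  by apply/measurable_EFinP; exact: measurable_indic.
have shell x : l%:E < (D x)%:E * g x -> ((D x ^+ 2)^-1)%:E <= \sum_(k <oo) F k x.
  move=> lx.
  have Dx0 : (0 < D x)%R by rewrite (lt_le_trans _ (D1 x)).
  have ex : exists k, (D x < 2 ^+ k.+1)%R.
    exists (Num.truncn (D x)); apply: (lt_trans (truncnS_gt _)).
    exact: ltr_nat_expr2.
  case: (ex_minnP ex) => k Dk kmin.
  have kD : (2 ^+ k <= D x)%R.
    case: k Dk kmin => [|k] _ kmin; first by rewrite expr0.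
    by rewrite leNgt; apply/negP => /kmin; rewrite ltnn.
  apply: le_trans (nneseries_lim_ge k.+1 (fun i _ _ => F0 i x)).
  rewrite big_nat_recr//=; apply: lee_paddl; first exact: sume_ge0.
  rewrite /F indicE mem_set/=; last first.
    rewrite ltNge; apply/negP => gx; move: lx; rewrite ltNge => /negP; apply.
    apply: le_trans (lee_wpmul2l _ gx) _; first by rewrite lee_fin ltW.
    rewrite -EFinM lee_fin /a mulrCA ler_piMr ?(ltW l0)//.
    by rewrite ler_pdivrMr ?exprn_gt0// mul1r ltW.
  rewrite mule1 lee_fin lef_pV2 ?posrE ?exprn_gt0//.
  have -> : (4 = 2 ^+ 2 :> R)%R by ring.
  by rewrite exprAC; apply: lerXn2r; rewrite ?nnegrE ?exprn_ge0// ltW.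
apply: (@le_trans _ _ (l%:E * \sum_(k <oo) \int[mu]_x F k x)).
  apply: lee_wpmul2l; first by rewrite lee_fin ltW.
  rewrite -integral_nneseries//; last by move=> k; exact: measurable_funeM.
  rewrite integral_mkcond; apply: ge0_le_integral_any => x _; rewrite /patch.
    by case: ifP => // _; rewrite lee_fin invr_ge0 sqr_ge0.
  by case: ifPn => [/[!inE]/= /shell//|_]; exact: nneseries_ge0.
rewrite -nneseriesZl; last by move=> k _; exact: integral_ge0.
apply: lime_le.
  apply: is_cvg_nneseries => k _ _; rewrite mule_ge0// ?lee_fin ?(ltW l0)//.
  exact: integral_ge0.
apply: nearW => m; rewrite big_mkord.
apply: (@le_trans _ _ (\sum_(k < m) (2 * (2 ^+ k)^-1)%:E * A)).
  apply: lee_sum => k _; rewrite ge0_integralZl_EFin; last 4 first.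
  - exact: measurableT.
  - by move=> x _; rewrite lee_fin.
  - exact: mind.
  - by rewrite invr_ge0 exprn_ge0.
  rewrite integral_indic// setIT.
  have e : (l * (4 ^+ k)^-1 = 2 * (2 ^+ k)^-1 * a k)%R.
    have -> : (4 = 2 ^+ 2 :> R)%R by ring.
    rewrite /a exprAC [(2 ^+ k.+1)%R]exprS; field; rewrite expf_neq0//.
  rewrite muleA -EFinM e EFinM -muleA; apply: lee_wpmul2l (weak _ (a0 k)).
  by rewrite lee_fin mulr_ge0// invr_ge0 exprn_ge0.
rewrite -ge0_sume_distrl; last by move=> k _; rewrite lee_fin mulr_ge0// invr_ge0 exprn_ge0.
rewrite sumEFin -mulr_sumr; apply: lee_wpmul2r => //; rewrite lee_fin.
have := sum_half_geometric m; set S := (\sum_(_ < _) _)%R; lra.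
Qed.

End weak_type_tools.

Section gauss_weak_type.
Context (R : realType) (n : nat).
Local Notation E := (euclid R n).
Local Notation leb := (lebesgue R n).
Local Notation gamma := (@gauss_measure R n).
Local Open Scope ereal_scope.

Lemma gauss_measure_le (A : set E) : measurable A -> gamma A <= leb A.
Proof.
move=> mA; rewrite -[leRHS]mul1e -integral_cst//; apply: ge0_le_integral_any => x _.
  by rewrite lee_fin gauss_density_ge0.
by rewrite lee_fin gauss_density_le1.
Qed.

Lemma gauss_measure_setT_lty : gamma setT < +oo.
Proof.
rewrite /gauss_measure /density_measure.
have e (x : E) : gauss_density x = (pi `^ (- (n%:R / 2)) * gauss_weight 1 x)%R :> R.
  by rewrite /gauss_density /gauss_weight mul1r.
under eq_integral do rewrite e EFinM.
by apply: integral_scaled_gauss_weight_lty => //; exact: powR_ge0.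
Qed.

(** The grids are handled by [grid_max_weak_type] and [gamma <= dx]; the constant
    term of the majorant only matters at levels below twice its value, where
    the finiteness of [gamma] suffices. *)
Lemma heat_major_weak_type : exists2 K : R, (0 < K)%R &
  forall u : E -> R, measurable_fun setT u -> (forall x, 0 <= u x)%R ->
  forall l : R, (0 < l)%R ->
  l%:E * gamma [set x | l%:E < heat_major u x] <= K%:E * \int[leb]_x (u x)%:E.
Proof.
pose N : R := #|{: {ffun 'I_n -> bool}}|%:R.
have N1 : (1 <= N)%R.
  by rewrite ler1n card_ffun card_bool card_ord expn_gt0.
have N0 : (0 < N)%R by exact: lt_le_trans N1.
have sumN (c : R) : (\sum_(tau : {ffun 'I_n -> bool}) c = c * N)%R.
  by rewrite sumr_const -mulr_natr.
pose g := fine (gamma setT).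
have gE : gamma setT = g%:E.
  by rewrite fineK// ge0_fin_numE//; exact: gauss_measure_setT_lty.
have g0 : (0 <= g)%R by exact: fine_ge0.
exists (4 * N ^+ 2 + 2 * g)%R; first by rewrite ltr_wpDr ?mulr_ge0// mulr_gt0// exprn_gt0.
move=> u mu u0 l l0; set I := \int[leb]_x _.
have I0 : 0 <= I by apply: integral_ge0 => x _; rewrite lee_fin.
have mH : measurable [set x | l%:E < heat_major u x].
  exact/measurable_superlevel/measurable_heat_major.
rewrite EFinD ge0_muleDl ?lee_fin ?mulr_ge0//.
have [lI|Il] := ltP (l / 2)%:E I.
  apply: lee_paddl; first by rewrite mule_ge0// lee_fin mulr_ge0// sqr_ge0.
  apply: (@le_trans _ _ (l%:E * gamma setT)).
    apply: lee_wpmul2l; first by rewrite lee_fin ltW.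
    by apply: le_measure; rewrite ?inE.
  rewrite gE -EFinM (_ : (l * g = 2 * g * (l / 2))%R); last by field.
  by rewrite EFinM; apply: lee_wpmul2l; [rewrite lee_fin mulr_ge0|exact: ltW].
apply: lee_paddr; first by rewrite mule_ge0// lee_fin mulr_ge0.
pose B tau := [set x : E | (l / (4 * N))%:E < grid_max tau u x].
have c0 : (0 < l / (4 * N))%R by rewrite divr_gt0// mulr_gt0.
have mB tau : measurable (B tau).
  exact/measurable_superlevel/measurable_grid_max.
have cov x : [set x | l%:E < heat_major u x] x -> exists tau, B tau x.
  move=> /= lx; have [//|nB] := pselect (exists tau, B tau x); exfalso.
  move: lx; apply/negP; rewrite -leNgt.
  apply: (@le_trans _ _ (2%:E * (l / 4)%:E + (l / 2)%:E)); last first.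
    by rewrite -EFinM -EFinD lee_fin le_eqVlt; apply/orP; left; apply/eqP; field.
  apply: leeD => //; apply: lee_wpmul2l => //.
  apply: (@le_trans _ _ (\sum_(tau : {ffun 'I_n -> bool}) (l / (4 * N))%:E)).
    by apply: lee_sum => tau _; rewrite leNgt; apply/negP => Bt; apply: nB; exists tau.
  rewrite sumEFin sumN lee_fin le_eqVlt; apply/orP; left; apply/eqP.
  by field; rewrite gt_eqF.
apply: (@le_trans _ _ (l%:E * \sum_tau leb (B tau))).
  apply: lee_wpmul2l; first by rewrite lee_fin ltW.
  apply: (le_trans (le_measure_fin_cover gamma mH mB cov)).
  by apply: lee_sum => tau _; exact: gauss_measure_le.
apply: (@le_trans _ _ (\sum_(tau : {ffun 'I_n -> bool}) (4 * N)%:E * I)); last first.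
  rewrite -ge0_sume_distrl; last by move=> tau _; rewrite lee_fin mulr_ge0// ltW.
  rewrite sumEFin sumN; apply: lee_wpmul2r => //; rewrite lee_fin.
  by rewrite le_eqVlt; apply/orP; left; apply/eqP; ring.
rewrite ge0_sume_distrr; last by move=> tau _; exact: measure_ge0.
apply: lee_sum => tau _.
have -> : (l = 4 * N * (l / (4 * N)))%R by field; rewrite gt_eqF.
rewrite EFinM -muleA; apply: lee_wpmul2l; first by rewrite lee_fin mulr_ge0// ltW.
exact: grid_max_weak_type.
Qed.

Lemma bounded_locally_integrable (h : E -> R) (r : R) :
  measurable_fun setT h -> (forall x, 0 <= h x <= 1)%R ->
  leb.-integrable [set x | (enorm x <= r)%R] (EFin \o h).
Proof.
move=> mh h01.
have mball : measurable [set x : E | (enorm x <= r)%R].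
  have msq : measurable_fun setT (@enorm R n).
    by apply: (measurableT_comp (continuous_measurable_fun (@sqrt_continuous R))); exact: measurable_sqnorm.
  have := measurable_fun_ler msq (measurable_cst r).
  by move=> /(_ measurableT [set true] I); rewrite setTI.
apply/integrableP; split.
  by apply/measurable_EFinP; exact: measurable_funTS.
apply: (@le_lt_trans _ _ (\int[leb]_x ((expR (r ^+ 2))%:E * (gauss_weight 1 x)%:E))).
  rewrite integral_mkcond; apply: ge0_le_integral_any => x _; rewrite /patch.
    by case: ifP.
  case: ifPn => [/[!inE]/= xr|_]; last first.
    by rewrite -EFinM lee_fin mulr_ge0 ?expR_ge0.
  have /andP[h0 h1] := h01 x.
  rewrite ger0_norm// -EFinM lee_fin; apply: (le_trans h1).
  rewrite /gauss_weight -expRD mul1r -[leLHS]expR0 ler_expR subr_ge0.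
  rewrite -[leLHS]sqr_sqrtr ?sqnorm_ge0//; apply: lerXn2r; rewrite ?nnegrE ?sqrtr_ge0//.
  by apply: le_trans xr; exact: sqrtr_ge0.
by apply: integral_scaled_gauss_weight_lty => //; exact: expR_ge0.
Qed.

(** All weights built below are bounded by 1, hence locally integrable. *)
Definition bounded_weight (h : E -> R) (mh : measurable_fun setT h)
    (h_gt0 : forall x, (0 < h x)%R) (h_le1 : forall x, (h x <= 1)%R) : weight R n :=
  Weight mh h_gt0 (fun r => bounded_locally_integrable r mh
    (fun x => introT andP (conj (ltW (h_gt0 x)) (h_le1 x)))).

Lemma mehler_growth_ge1 (b : R) (x : E) : (0 < b)%R -> (1 <= mehler_growth b x)%R.
Proof.
move=> b0; apply: mulr_ege1; first exact: cube_const_ge1.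
rewrite -[leLHS]expR0 ler_expR mulr_ge0 ?sqnorm_ge0//.
by rewrite addr_ge0// mulr_ge0// ltW.
Qed.

Lemma ge0_integral_weighted_gauss (w : weight R n) (F : E -> \bar R) :
  measurable_fun setT F -> (forall x, 0 <= F x) ->
  \int[weighted_gauss w]_x F x =
  \int[leb]_x (F x * (w x * gauss_density x)%:E).
Proof.
move=> mF F0; have mw := weight_measurable w.
rewrite (ge0_integral_density _ (weight_measurable w) (weight_ge0 w))//.
have -> : \int[gamma]_x (F x * (w x)%:E) =
    \int[density_measure leb (@measurable_gauss_density R n) (@gauss_density_ge0 R n)]_x (F x * (w x)%:E) by [].
rewrite ge0_integral_density.
- by apply: eq_integral => x _; rewrite -muleA -EFinM.
- by apply: emeasurable_funM; [exact: mF|apply/measurable_EFinP; exact: mw].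
- by move=> x; rewrite mule_ge0// lee_fin weight_ge0.
Qed.

Lemma mehler_max_ge0 (r : R) (f : E -> R) x : (0 < r)%R -> 0 <= mehler_max r f x.
Proof.
move=> r0; apply: (@le_trans _ _ `|mehler (r / 2) f x|) => //.
apply: ereal_sup_ubound; exists (r / 2)%R => //=; rewrite in_itv/=; apply/andP; split; lra.
Qed.

(** The weight absorbs the growth of the majorant in [x], through
    [weak_type_mul]. *)
Lemma mehler_max_weak_type (b r : R) : (0 < b)%R -> (0 < r)%R -> (32 * b * r <= 1)%R ->
  exists (w : weight R n) (K : R), (0 < K)%R /\
  forall f : E -> R, measurable_fun setT f -> forall l : R, (0 < l)%R ->
  l%:E * weighted_gauss w [set x | l%:E < mehler_max r f x] <=
  K%:E * \int[leb]_x (`|f x| * gauss_weight b x)%:E.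
Proof.
move=> b0 r0 br; pose D := @mehler_growth R n b.
have D1 x : (1 <= D x)%R by exact: mehler_growth_ge1.
have D0 x : (0 < D x)%R by exact: mehler_growth_gt0.
have mD : measurable_fun setT D by exact: measurable_mehler_growth.
pose h x := ((D x ^+ 2)^-1)%R.
have mh : measurable_fun setT h.
  apply: measurable_fun_inv; first exact: measurable_funX.
  by move=> x; rewrite exprn_gt0.
have h0 x : (0 < h x)%R by rewrite invr_gt0 exprn_gt0.
have h1 x : (h x <= 1)%R by rewrite invf_le1 ?exprn_gt0// exprn_ege1.
have [K K0 weak] := heat_major_weak_type.
exists (bounded_weight mh h0 h1), (4 * K)%R; split; first by rewrite mulr_gt0.
move=> f mf l l0; set u := (fun x => `|f x| * gauss_weight b x)%R.
have mu : measurable_fun setT u.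
  by apply: measurable_funM; [exact: measurableT_comp|exact: measurable_gauss_weight].
have u0 y : (0 <= u y)%R by rewrite mulr_ge0// ltW// gauss_weight_gt0.
rewrite EFinM -muleA.
apply: le_trans (weak_type_mul (mu := gamma) mD (measurable_heat_major u) D1 (fun x => heat_major_ge0 x u0) _ (weak u mu u0) l0); last first.
  rewrite mule_ge0// ?lee_fin ?(ltW K0)//.
  by apply: integral_ge0 => x _; rewrite lee_fin.
apply: lee_wpmul2l; first by rewrite lee_fin ltW.
apply: ge0_subset_integral_any => x; first by rewrite lee_fin ltW.
move=> /= lx; apply: (lt_le_trans lx); exact: mehler_max_le.
Qed.

End gauss_weak_type.

(** * The condition on the weight as a duality *)

Section integration_tools.
Context d (T : measurableType d) (R : realType).
Variable mu : {measure set T -> \bar R}.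
Local Open Scope ereal_scope.

Lemma ge0_integral_density_set (h : T -> R) (mh : measurable_fun setT h)
    (h0 : forall x, (0 <= h x)%R) (A : set T) (f : T -> R) :
  measurable A -> measurable_fun setT f -> (forall x, 0 <= f x)%R ->
  \int[density_measure mu mh h0]_(x in A) (f x)%:E = \int[mu]_(x in A) (f x * h x)%:E.
Proof.
move=> mA mf f0; rewrite [LHS]integral_mkcond (ge0_integral_density _ mh h0).
- rewrite [RHS]integral_mkcond; apply: eq_integral => x _; rewrite /patch.
  by case: ifP => _; rewrite ?mul0e.
- by apply/(measurable_restrictT _ _).1 => //; apply/measurable_EFinP; exact: measurable_funTS.
- by move=> x; rewrite /patch; case: ifP => _ //; rewrite lee_fin.
Qed.

Lemma density_measure_eq0 (h : T -> R) (mh : measurable_fun setT h)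
    (h0 : forall x, (0 <= h x)%R) (A : set T) :
  (forall x, 0 < h x)%R -> measurable A -> density_measure mu mh h0 A = 0 -> mu A = 0.
Proof.
move=> hgt0 mA; rewrite /density_measure => hA.
have mhA : measurable_fun A (EFin \o h) by apply/measurable_EFinP; exact: measurable_funTS.
have /(ae_eq_integral_abs mu mA mhA) : \int[mu]_(x in A) `|(h x)%:E| = 0.
  by rewrite -[RHS]hA; apply: eq_integral => x _; rewrite gee0_abs// lee_fin ltW.
move=> [N [mN N0 sN]]; apply/eqP; rewrite eq_le measure_ge0 andbT -N0.
apply: le_measure; rewrite ?inE//; apply: subset_trans sN => x Ax /= /(_ Ax) [] hx0.
by have := hgt0 x; rewrite hx0 ltxx.
Qed.

Lemma weak_type_ae_lty (g : T -> \bar R) (A : \bar R) :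
  measurable_fun setT g -> A < +oo ->
  (forall l : R, (0 < l)%R -> l%:E * mu [set x | l%:E < g x] <= A) ->
  {ae mu, forall x, g x < +oo}.
Proof.
move=> mg Aoo weak.
have A0 : 0 <= A by apply: le_trans (weak 1%R ltr01); rewrite mule_ge0.
have mgl (l : R) : measurable [set x | l%:E < g x] by exact: measurable_superlevel.
have mN : measurable [set x | g x = +oo].
  rewrite (_ : mkset _ = \bigcap_k [set x | (k%:R)%:E < g x]).
    by apply: bigcapT_measurable => k; exact: mgl.
  apply/seteqP; split=> [x /= gx k _ /=|x /= h]; first by rewrite gx ltry.
  apply/eqyP => r r0; apply/ltW; apply: lt_trans (h (Num.truncn r).+1 I).
  by rewrite lte_fin truncnS_gt.
exists [set x | g x = +oo]; split => //.
  apply/eqP; rewrite eq_le measure_ge0 andbT; apply/lee_addgt0Pr => e e0; rewrite add0e.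
  have [a Aa] : exists a : R, A = a%:E by exists (fine A); rewrite fineK// ge0_fin_numE.
  have a0 : (0 <= a)%R by rewrite -lee_fin -Aa.
  have l0 : (0 < (a + 1) / e)%R by rewrite divr_gt0// ltr_wpDl.
  have := weak _ l0; rewrite Aa muleC -lee_pdivlMr// => h.
  apply: (@le_trans _ _ (mu [set x | (((a + 1) / e)%R)%:E < g x])).
    by apply: le_measure; rewrite ?inE// => x /= ->; exact: ltry.
  apply: (le_trans h); rewrite -EFinM lee_fin invf_div mulrA ler_pdivrMr ?ltr_wpDl//.
  by rewrite mulrC ler_wpM2l ?lerDl// ltW.
move=> x /= /negP; rewrite -leNgt leye_eq => /eqP.
by [].
Qed.

Lemma poweR_sum_le (I : finType) (a : I -> \bar R) (p : R) : (0 < p)%R ->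
  (forall i, 0 <= a i) ->
  (\sum_i a i) `^ p <= (#|I|%:R `^ p)%:E * \sum_i a i `^ p.
Proof.
move=> p0 a0; set B := \sum_i a i `^ p.
have B0 : 0 <= B by apply: sume_ge0 => i _; exact: poweR_ge0.
have aB i : a i <= B `^ p^-1.
  rewrite -[leLHS]poweRe1 ?a0// -[X in _ `^ X](mulfV (lt0r_neq0 p0)) poweRrM.
  apply: gt0_ler_poweR; rewrite ?invr_ge0 ?(ltW p0)// ?in_itv/= ?poweR_ge0 ?B0 ?leey//.
  by rewrite /B (bigD1 i)//= leeDl// sume_ge0// => j _; exact: poweR_ge0.
apply: (@le_trans _ _ (((#|I|%:R)%:E * B `^ p^-1) `^ p)).
  have S0 : 0 <= \sum_i a i by exact: sume_ge0.
  apply: gt0_ler_poweR; rewrite ?(ltW p0)// ?in_itv/= ?leey ?andbT ?S0//.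
    by rewrite mule_ge0 ?poweR_ge0.
  apply: (@le_trans _ _ (\sum_(i : I) 1%:E * B `^ p^-1)).
    by apply: lee_sum => i _; rewrite mul1e.
  by rewrite -ge0_sume_distrl// sumEFin sumr_const.
rewrite poweRM ?poweR_ge0// -poweRrM mulVf ?gt_eqF// poweRe1//.
Qed.

Lemma poweRD_le (x y : \bar R) (p : R) : (0 < p)%R -> 0 <= x -> 0 <= y ->
  (x + y) `^ p <= (2 `^ p)%:E * (x `^ p + y `^ p).
Proof.
move=> p0 x0 y0.
have := @poweR_sum_le bool (fun c => if c then x else y) p p0.
by rewrite !big_bool card_bool; apply; case.
Qed.

Lemma measurable_fun_powR_comp (f : T -> R) (p : R) :
  measurable_fun setT f -> measurable_fun setT (fun x => f x `^ p)%R.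
Proof. by move=> mf; exact: (measurableT_comp (measurable_powR p)). Qed.

Lemma measurable_fun_norm_poweR (f : T -> R) (p : R) :
  measurable_fun setT f -> measurable_fun setT (fun x => `|(f x)%:E| `^ p).
Proof.
move=> mf; apply: (measurableT_comp (measurable_poweR p)).
by apply: measurableT_comp => //; exact/measurable_EFinP.
Qed.

End integration_tools.

Section dual_weight.
Context (R : realType) (n : nat) (v : weight R n).
Local Notation E := (euclid R n).
Local Notation leb := (lebesgue R n).
Local Open Scope ereal_scope.

Definition weighted_gauss_density (x : E) : R := (v x * gauss_density x)%R.
Local Notation vt := weighted_gauss_density.

Lemma weighted_gauss_density_gt0 x : (0 < vt x)%R.
Proof. by rewrite mulr_gt0 ?weight_gt0 ?gauss_density_gt0. Qed.

Lemma measurable_weighted_gauss_density : measurable_fun setT vt.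
Proof. by apply: measurable_funM; [exact: weight_measurable|exact: measurable_gauss_density]. Qed.

(** The function whose [L^p'] norm decides membership in [D_p^W], in the form
    dual to [L^p(v dgamma)]. *)
Definition dual_dens (p b : R) (x : E) : R := (gauss_weight b x * vt x `^ (- p^-1))%R.

Lemma dual_dens_gt0 p b x : (0 < dual_dens p b x)%R.
Proof. by rewrite mulr_gt0 ?gauss_weight_gt0// powR_gt0// weighted_gauss_density_gt0. Qed.

Lemma measurable_dual_dens p b : measurable_fun setT (dual_dens p b).
Proof.
apply: measurable_funM; first exact: measurable_gauss_weight.
exact/measurable_fun_powR_comp/measurable_weighted_gauss_density.
Qed.

(** The Gaussian density contributes [exp(|x|^2 / p)] to [vt^(-1/p)], which shifts
    the exponent [1 / (4 t0)] of the heat kernel by [1 / p]. *)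
Lemma dual_densE (p t0 : R) : (0 < p)%R -> (0 < t0)%R -> exists2 c : R, (0 < c)%R &
  forall x, dual_dens p (p^-1 + (4 * t0)^-1) x =
            (c * (heat_kernel t0 x * v x `^ (- p^-1)))%R.
Proof.
move=> p0 t00; set c1 : R := ((pi `^ (- (n%:R / 2))) `^ (- p^-1))%R.
set c2 : R := ((4 * pi * t0) `^ (- (n%:R / 2)))%R.
have c10 : (0 < c1)%R by rewrite !powR_gt0// pi_gt0.
have c20 : (0 < c2)%R by rewrite powR_gt0// !mulr_gt0// pi_gt0.
exists (c1 / c2)%R; first by rewrite divr_gt0.
move=> x; rewrite /dual_dens /weighted_gauss_density /heat_kernel /gauss_density /gauss_weight.
rewrite powRM; [|exact: weight_ge0|by rewrite mulr_ge0 ?powR_ge0 ?expR_ge0].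
rewrite powRM ?powR_ge0 ?expR_ge0// -/c1 -/c2 -expRM.
have -> : (c1 / c2 * (c2 * expR (- (sqnorm x / (4 * t0))) * v x `^ (- p^-1)) =
  v x `^ (- p^-1) * (c1 * expR (- (sqnorm x / (4 * t0)))))%R by field; rewrite gt_eqF.
rewrite mulrCA; congr (_ * _)%R; rewrite mulrCA; congr (_ * _)%R.
by rewrite -expRD; congr expR; ring.
Qed.

Lemma hoelder_conjugate_gt1 (p : R) : (1 < p)%R ->
  hoelder_conjugate p%:E = (p / (p - 1))%:E.
Proof.
move=> p1; rewrite /hoelder_conjugate/= gt_eqF ?lte_fin ?(lt_trans ltr01 p1)//.
by rewrite -EFinB inver subr_eq0 gt_eqF// -EFinM.
Qed.

Lemma DW_gt1P (p : R) : (1 < p)%R -> DW p v <-> exists2 t0 : R, (0 < t0)%R &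
  \int[leb]_x ((dual_dens p (p^-1 + (4 * t0)^-1) x) `^ (p / (p - 1)))%:E < +oo.
Proof.
move=> p1; have p0 : (0 < p)%R by exact: lt_trans p1.
have q0 : (0 < p / (p - 1))%R by rewrite divr_gt0// subr_gt0.
have key t0 : (0 < t0)%R ->
  ('N[leb]_(hoelder_conjugate p%:E)[(fun x => (heat_kernel t0 x * v x `^ (- p^-1))%:E)] < +oo) <->
  (\int[leb]_x ((dual_dens p (p^-1 + (4 * t0)^-1) x) `^ (p / (p - 1)))%:E < +oo).
  move=> t00; rewrite hoelder_conjugate_gt1//; set q := (p / (p - 1))%R.
  have [c c0 e] := dual_densE p0 t00.
  have k0 x : (0 <= heat_kernel t0 x * v x `^ (- p^-1))%R.
    by rewrite !mulr_ge0 ?powR_ge0 ?expR_ge0.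
  have mk : measurable_fun setT (fun x : E => heat_kernel t0 x * v x `^ (- p^-1))%R.
    rewrite (_ : (fun x => _) = (fun x => c^-1 * dual_dens p (p^-1 + (4 * t0)^-1) x)%R).
      apply: measurable_funM; [exact: measurable_cst|exact: measurable_dual_dens].
    by apply/funext => x; rewrite e mulKf// gt_eqF.
  have -> : \int[leb]_x ((dual_dens p (p^-1 + (4 * t0)^-1) x) `^ q)%:E =
      (c `^ q)%:E * ('N[leb]_q%:E[(fun x => (heat_kernel t0 x * v x `^ (- p^-1))%:E)] `^ q).
    rewrite poweR_Lnorm ?gt_eqF// -ge0_integralZl_EFin; last 4 first.
    - exact: measurableT.
    - by move=> x _; exact: poweR_ge0.
    - exact: (measurable_fun_norm_poweR q mk).
    - exact: powR_ge0.
    apply: eq_integral => x _; rewrite gee0_abs ?lee_fin// poweR_EFin -EFinM e.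
    by rewrite powRM ?(ltW c0).
  split=> h.
    by rewrite lte_mul_pinfty ?lee_fin ?powR_ge0//; exact: poweR_lty.
  have : 'N[leb]_q%:E[(fun x => (heat_kernel t0 x * v x `^ (- p^-1))%:E)] `^ q < +oo.
    rewrite ltey; apply: contraTN h => /eqP ->.
    by rewrite gt0_muley ?lte_fin ?powR_gt0// ltxx.
  by apply: lty_poweRy; rewrite gt_eqF.
by split=> -[t0 t00 /(key _ t00)]; exists t0.
Qed.

Lemma lebesgue_setT_gt0 : 0 < leb setT.
Proof.
pose tau : {ffun 'I_n -> bool} := [ffun=> false].
pose x : E := point.
apply: (@lt_le_trans _ _ (leb (cell (grid_label tau) 0 x))).
  by rewrite lebesgue_cell lte_fin invr_gt0 exprn_gt0.
by apply: le_lebesgue.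
Qed.

Lemma DW_1P : DW 1 v <-> exists2 t0 : R, (0 < t0)%R &
  exists M : R, {ae leb, forall x, (dual_dens 1 (1 + (4 * t0)^-1) x <= M)%R}.
Proof.
have key t0 : (0 < t0)%R ->
  ('N[leb]_(hoelder_conjugate 1)[(fun x => (heat_kernel t0 x * v x `^ (- 1^-1))%:E)] < +oo) <->
  exists M : R, {ae leb, forall x, (dual_dens 1 (1 + (4 * t0)^-1) x <= M)%R}.
  move=> t00; rewrite hoelder_conjugate1 unlock lebesgue_setT_gt0.
  have [c c0] := dual_densE (@ltr01 R) t00; rewrite invr1 => e.
  set k := (fun x => (heat_kernel t0 x * v x `^ (- 1))%:E).
  have k0 (x : E) : (0 <= heat_kernel t0 x * v x `^ (- 1))%R.
    by rewrite !mulr_ge0 ?powR_ge0 ?expR_ge0.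
  split=> [h|[M hM]].
    have S0 : 0 <= ess_sup leb (abse \o k).
      by apply: ess_sup_gee; [exact: lebesgue_setT_gt0|apply: nearW => x; exact: abse_ge0].
    have Sfin : ess_sup leb (abse \o k) \is a fin_num by rewrite ge0_fin_numE.
    exists (c * fine (ess_sup leb (abse \o k)))%R.
    have := ess_sup_ge leb (abse \o k); apply: filterS => x.
    rewrite -{1}(fineK Sfin) /= lee_fin e => hx.
    by rewrite ler_wpM2l ?(ltW c0)// (le_trans (ler_norm _)).
  apply: (@le_lt_trans _ _ (c^-1 * M)%:E); last exact: ltry.
  apply/ess_supP; apply: filterS hM => x; rewrite e /= lee_fin => hx.
  by rewrite ger0_norm// ler_pdivlMl.
by split=> -[t0 t00 /(key _ t00)]; exists t0.
Qed.

Lemma Lnorm_weighted (p : R) (f : E -> R) : (0 < p)%R -> measurable_fun setT f ->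
  'N[weighted_gauss v]_p%:E[EFin \o f] `^ p =
  \int[leb]_x (`|f x| `^ p * vt x)%:E.
Proof.
move=> p0 mf; rewrite poweR_Lnorm ?gt_eqF// ge0_integral_weighted_gauss.
- by apply: eq_integral => x _; rewrite [RHS]EFinM -poweR_EFin.
- exact: measurable_fun_norm_poweR.
- by move=> x; exact: poweR_ge0.
Qed.

(** Hoelder: the dual condition embeds [L^p(v dgamma)] into the
    Gaussian-weighted [L^1]. *)
Lemma dual_dens_L1 (p b : R) : (1 < p)%R ->
  \int[leb]_x ((dual_dens p b x) `^ (p / (p - 1)))%:E < +oo ->
  exists2 K : R, (0 <= K)%R & forall f : E -> R, measurable_fun setT f ->
  \int[leb]_x (`|f x| * gauss_weight b x)%:E <=
  K%:E * 'N[weighted_gauss v]_p%:E[EFin \o f].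
Proof.
move=> p1 h.
have p0 : (0 < p)%R by exact: lt_trans p1.
set q := (p / (p - 1))%R.
have q0 : (0 < q)%R by rewrite divr_gt0// subr_gt0.
have pq : (p^-1 + q^-1 = 1)%R by rewrite /q invf_div; field; rewrite gt_eqF.
have Nq : 'N[leb]_q%:E[EFin \o dual_dens p b] < +oo.
  rewrite unlock; apply: poweR_lty; apply: le_lt_trans h.
  rewrite le_eqVlt; apply/orP; left; apply/eqP; apply: eq_integral => x _ /=.
  by rewrite ger0_norm// ltW// dual_dens_gt0.
have Nfin : 'N[leb]_q%:E[EFin \o dual_dens p b] \is a fin_num by rewrite ge0_fin_numE// Lnorm_ge0.
exists (fine 'N[leb]_q%:E[EFin \o dual_dens p b]).
  by rewrite fine_ge0// Lnorm_ge0.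
move=> f mf; rewrite fineK// muleC.
pose F x := (f x * vt x `^ p^-1)%R.
have mF : measurable_fun setT F.
  by apply: measurable_funM; [exact: mf|exact/measurable_fun_powR_comp/measurable_weighted_gauss_density].
have -> : 'N[weighted_gauss v]_p%:E[EFin \o f] = 'N[leb]_p%:E[EFin \o F].
  rewrite -[LHS]poweRe1 ?Lnorm_ge0// -[RHS]poweRe1 ?Lnorm_ge0//.
  rewrite -(mulfV (lt0r_neq0 p0)) !poweRrM Lnorm_weighted// poweR_Lnorm ?gt_eqF//.
  congr (_ `^ _); apply: eq_integral => x _.
  rewrite -[RHS]/((`|F x| `^ p)%:E) /F normrM powRM// (ger0_norm (powR_ge0 _ _)) -powRrM mulVf ?gt_eqF//.
  by rewrite powRr1// ltW// weighted_gauss_density_gt0.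
apply: le_trans (hoelder leb mF (measurable_dual_dens p b) p0 q0 pq).
rewrite Lnorm1 le_eqVlt; apply/orP; left; apply/eqP; apply: eq_integral => x _ /=.
rewrite /F /dual_dens -mulrA [(vt x `^ p^-1 * _)%R]mulrCA powRN mulfV; last first.
  by rewrite gt_eqF// powR_gt0// weighted_gauss_density_gt0.
by rewrite mulr1 normrM (ger0_norm (ltW (gauss_weight_gt0 b x))).
Qed.

Lemma DW_L1 (p : R) : (1 <= p)%R -> DW p v ->
  exists (b K : R), [/\ (0 < b)%R, (0 <= K)%R &
  forall f : E -> R, measurable_fun setT f ->
  \int[leb]_x (`|f x| * gauss_weight b x)%:E <=
  K%:E * 'N[weighted_gauss v]_p%:E[EFin \o f]].
Proof.
rewrite le_eqVlt => /predU1P[<-|p1].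
  move=> /DW_1P[t0 t00 [M hM]]; exists (1 + (4 * t0)^-1)%R, (Num.max M 0%R); split.
  - by rewrite addr_gt0// invr_gt0 mulr_gt0.
  - by rewrite le_max lexx orbT.
  move=> f mf; rewrite -[X in _ * X]poweRe1 ?Lnorm_ge0// Lnorm_weighted//.
  have mu : measurable_fun setT (fun x => `|f x| `^ 1 * vt x)%R.
    apply: measurable_funM; last exact: measurable_weighted_gauss_density.
    by apply: measurable_fun_powR_comp; exact: measurableT_comp.
  have u0 x : (0 <= `|f x| `^ 1 * vt x)%R.
    by rewrite mulr_ge0 ?powR_ge0// ltW// weighted_gauss_density_gt0.
  rewrite -ge0_integralZl_EFin; last 4 first.
  - exact: measurableT.
  - by move=> x _; rewrite lee_fin u0.
  - exact/measurable_EFinP.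
  - by rewrite le_max lexx orbT.
  apply: ae_ge0_le_integral; first exact: measurableT.
  - by move=> x _; rewrite lee_fin mulr_ge0// ltW// gauss_weight_gt0.
  - apply/measurable_EFinP; apply: measurable_funM; last exact: measurable_gauss_weight.
    exact: measurableT_comp.
  - by move=> x _; rewrite -EFinM lee_fin mulr_ge0// le_max lexx orbT.
  - by apply: measurable_funeM; apply/measurable_EFinP.
  apply: filterS hM => x hx _; rewrite -EFinM lee_fin powRr1// mulrCA ler_wpM2l//.
  have vt0 := weighted_gauss_density_gt0 x.
  move: hx; rewrite /dual_dens invr1 powR_inv1 ?(ltW vt0)// ler_pdivrMr// => hx.
  by apply: (le_trans hx); rewrite ler_wpM2r ?(ltW vt0)// le_max lexx.
have p0 : (0 < p)%R by exact: lt_trans p1.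
move=> /(DW_gt1P p1)[t0 t00 h]; have [K K0 hK] := dual_dens_L1 p1 h.
exists (p^-1 + (4 * t0)^-1)%R, K; split => //.
by rewrite addr_gt0 ?invr_gt0// mulr_gt0.
Qed.

End dual_weight.

(** * Strong type inequality above exponent one *)

Lemma powR_inv_mul (R : realType) (s p : R) : 0 < s -> s^-1 `^ p * s = s `^ (1 - p).
Proof.
move=> s0; rewrite powRD; last by rewrite (gt_eqF s0) implybT.
by rewrite powRr1 ?(ltW s0)// -(powR_inv1 (ltW s0)) -powRrM mulN1r mulrC.
Qed.

Section strong_type.
Context (R : realType) (n : nat) (v : weight R n) (p : R).
Hypothesis p1 : 1 < p.
Local Notation E := (euclid R n).
Local Notation leb := (lebesgue R n).
Local Notation vt := (weighted_gauss_density v).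
Local Notation q := (p / (p - 1)).
Local Open Scope ereal_scope.

Let p0 : (0 < p)%R. Proof. exact: lt_trans p1. Qed.

Section fixed_dual_weight.
Variable b : R.
Hypothesis b0 : (0 < b)%R.
Let g : E -> R := gauss_weight b.

(** The dual weight [(g_b vt^(-1/p))^p']: a finite measure for which
    [L^p(v dgamma)] data times [g_b] is [h sp] with [h] in [L^p(sp)]. *)
Let sp (x : E) : R := dual_dens v p b x `^ q.

Hypothesis sp_fin : \int[leb]_x (sp x)%:E < +oo.

Let sp_gt0 x : (0 < sp x)%R. Proof. by rewrite powR_gt0// dual_dens_gt0. Qed.
Let sp_ge0 x : (0 <= sp x)%R. Proof. exact: ltW. Qed.

Let msp : measurable_fun setT sp.
Proof. exact/measurable_fun_powR_comp/measurable_dual_dens. Qed.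

Let mu : {measure set E -> \bar R} := density_measure leb msp sp_ge0.

Let mu_fin A : mu A < +oo.
Proof.
by apply: le_lt_trans sp_fin; apply: ge0_subset_integral_any => // x; rewrite lee_fin.
Qed.

Let quot (f : E -> R) (x : E) : R := (`|f x| * g x / sp x)%R.

Let quot_ge0 f x : (0 <= quot f x)%R.
Proof. by rewrite divr_ge0// mulr_ge0// ltW// gauss_weight_gt0. Qed.

Let measurable_quot f : measurable_fun setT f -> measurable_fun setT (quot f).
Proof.
move=> mf; apply: measurable_funM; last exact: (measurable_fun_inv msp).
apply: measurable_funM; last exact: measurable_gauss_weight.
exact: (measurableT_comp (@normr_measurable _ setT)).
Qed.

Let quot_norm f x : (quot f x `^ p * sp x = `|f x| `^ p * vt x)%R.
Proof.
have vt0 := weighted_gauss_density_gt0 v x; have g0 := gauss_weight_gt0 b x.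
have spE : sp x = (g x `^ q * (vt x `^ (- p^-1)) `^ q)%R.
  by rewrite /sp /dual_dens powRM ?powR_ge0// ltW.
have qm : (p - 1 != 0)%R by rewrite subr_eq0 gt_eqF.
have pn : (p != 0)%R by rewrite gt_eqF.
rewrite /quot powRM ?mulr_ge0 ?invr_ge0 ?(ltW g0)// powRM ?(ltW g0)//.
rewrite -mulrA -mulrA; congr (_ * _)%R.
have -> : ((sp x)^-1 `^ p * sp x = sp x `^ (1 - p))%R.
  exact: powR_inv_mul.
rewrite spE powRM ?powR_ge0// -!powRrM mulrA.
have -> : (q * (1 - p) = - p)%R by field.
have -> : (- p^-1 * - p = 1)%R by field.
rewrite powRr1 ?(ltW vt0)// powRN mulfV ?mul1r//.
by rewrite gt_eqF// powR_gt0.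
Qed.

(** A Lebesgue average of [h sp] is an average of [sp] times an average of [h]
    against [sp dx]. *)
Let grid_max_factor (f : E -> R) tau (x : E) : measurable_fun setT f ->
  grid_max tau (fun y => `|f y| * g y)%R x <=
  grid_max tau sp x * cell_max (grid_label tau) mu (quot f) x.
Proof.
move=> mf; apply: ge_ereal_sup => _ [k _ <-].
set Q := cell _ _ _; have mQ : measurable Q by exact/measurable_cell/measurable_grid.
have -> : \int[leb]_(y in Q) (`|f y| * g y)%:E = \int[mu]_(y in Q) (quot f y)%:E.
  rewrite (ge0_integral_density_set leb msp sp_ge0 mQ (measurable_quot mf) (quot_ge0 f)).
  by apply: eq_integral => y _; rewrite /quot divfK// gt_eqF.
have S0 : 0 <= mu Q by exact: measure_ge0.
have Sfin : mu Q \is a fin_num by rewrite ge0_fin_numE//; exact: mu_fin.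
have I0 : 0 <= \int[mu]_(y in Q) (quot f y)%:E.
  by apply: integral_ge0 => y _; rewrite lee_fin.
have t0 : 0 <= (2 ^+ (n * k))%:E * mu Q by rewrite mule_ge0 ?lee_fin ?exprn_ge0.
apply: (@le_trans _ _ (((2 ^+ (n * k))%:E * mu Q) *
   (\int[mu]_(y in Q) (quot f y)%:E * ((fine (mu Q))^-1)%:E))); last first.
  apply: lee_pmul; rewrite ?t0 ?mule_ge0 ?lee_fin ?invr_ge0 ?fine_ge0//.
    by apply: ereal_sup_ubound; exists k.
  by apply: ereal_sup_ubound; exists k.
rewrite -muleA; apply: lee_wpmul2l; first by rewrite lee_fin exprn_ge0.
have [Q0|Q0] := eqVneq (fine (mu Q)) 0%R.
  have muQ : mu Q = 0 by rewrite -(fineK Sfin) Q0.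
  have mqQ : measurable_fun Q (EFin \o quot f).
    by apply/measurable_EFinP/measurable_funTS; exact: measurable_quot.
  have -> : \int[mu]_(y in Q) (quot f y)%:E = 0 by apply: (null_set_integral mQ).
  by rewrite !mul0e mule0.
by rewrite muleCA -[X in _ * (X * _)](fineK Sfin) -EFinM mulfV// mule1.
Qed.

Let cell_max_norm (f : E -> R) tau : measurable_fun setT f ->
  \int[leb]_x (cell_max (grid_label tau) mu (quot f) x `^ p * (sp x)%:E) <=
  (marcinkiewicz_const p)%:E * \int[leb]_x (`|f x| `^ p * vt x)%:E.
Proof.
move=> mf; have mq := measurable_quot mf.
have mc := measurable_cell_max (measurable_grid tau) mu (quot f).
have := cell_max_strong_type (measurable_grid tau) (@grid_nested R n tau) p1
  (fun k x => mu_fin (cell (grid_label tau) k x)) mq (quot_ge0 f).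
rewrite (ge0_integral_density _ msp sp_ge0); last 2 first.
- exact: (measurableT_comp (measurable_poweR p) mc).
- by move=> x; exact: poweR_ge0.
rewrite (ge0_integral_density _ msp sp_ge0); last 2 first.
- by apply/measurable_EFinP; exact: measurable_fun_powR_comp.
- by move=> x; rewrite lee_fin powR_ge0.
by under [X in _ * X]eq_integral do rewrite -EFinM quot_norm.
Qed.

Let D := @mehler_growth R n b.
Let D0 x : (0 < D x)%R. Proof. exact: mehler_growth_gt0. Qed.
Let D1 x : (1 <= D x)%R. Proof. exact: mehler_growth_ge1. Qed.

(** A finite majorant of the averages of [sp]; [1] is added to make it positive
    where [local_max sp] vanishes or is infinite. *)
Let N (x : E) : R := (1 + fine (local_max sp x))%R.

Let N_ge1 x : (1 <= N x)%R.
Proof. by rewrite lerDl fine_ge0// local_max_ge0. Qed.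

Let N_gt0 x : (0 < N x)%R. Proof. exact: lt_le_trans (N_ge1 x). Qed.

Let mN : measurable_fun setT N.
Proof.
apply: measurable_funD; first exact: measurable_cst.
by apply: (measurableT_comp (@fine_measurable R _ measurableT)); exact: measurable_local_max.
Qed.

(** The target weight: [D ^ -p] pays for the growth of the majorant, and
    [sp / N ^ p] turns Lebesgue integrals of [(N M h)^p] into integrals of
    [(M h)^p] against [sp dx], where [M] is the maximal operator adapted to
    [sp dx]. The minimum with 1 keeps the weight bounded. *)
Let hw (x : E) : R := (D x `^ (- p) * Num.min 1 (sp x * N x `^ (- p)))%R.

Let hw_gt0 x : (0 < hw x)%R.
Proof. by rewrite mulr_gt0 ?powR_gt0// lt_min ltr01 mulr_gt0// powR_gt0. Qed.

Let hw_le1 x : (hw x <= 1)%R.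
Proof.
apply: mulr_ile1; rewrite ?powR_ge0//.
- by rewrite le_min ler01 mulr_ge0// powR_ge0.
- rewrite powRN invf_le1 ?powR_gt0//.
  by rewrite -[leLHS](powRr0 (D x)); apply: ler_powR => //; exact: ltW.
- by rewrite ge_min lexx.
Qed.

Let mhw : measurable_fun setT hw.
Proof.
apply: measurable_funM.
  by apply: measurable_fun_powR_comp; exact: measurable_mehler_growth.
apply: measurable_minr; first exact: measurable_cst.
apply: measurable_funM; first exact: msp.
exact: (measurable_fun_powR_comp _ mN).
Qed.

Let w : weight R n := bounded_weight mhw hw_gt0 hw_le1.

Let local_max_fin : {ae leb, forall x, local_max sp x < +oo}.
Proof.
have h tau : {ae leb, forall x, grid_max tau sp x < +oo}.
  apply: (weak_type_ae_lty (measurable_grid_max tau sp) sp_fin) => l l0.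
  exact: grid_max_weak_type.
have : \forall x \ae leb, forall tau, grid_max tau sp x < +oo.
  exact: filter_forall.
apply: filterS => x hx.
by apply: lte_sum_pinfty => tau _; exact: hx.
Qed.

Let term_bound (f : E -> R) tau : measurable_fun setT f ->
  \int[leb]_x ((D x `^ p)%:E * grid_max tau (fun y => `|f y| * g y)%R x `^ p *
    (w x * gauss_density x)%:E) <=
  (marcinkiewicz_const p)%:E * \int[leb]_x (`|f x| `^ p * vt x)%:E.
Proof.
move=> mf; apply: le_trans (cell_max_norm tau mf).
set u := (fun y => `|f y| * g y)%R.
have u0 y : (0 <= u y)%R by rewrite mulr_ge0// ltW// gauss_weight_gt0.
have c0 x : 0 <= cell_max (grid_label tau) mu (quot f) x by exact: cell_max_ge0.
have mDp : measurable_fun setT (fun x => (D x `^ p)%:E).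
  by apply/measurable_EFinP/measurable_fun_powR_comp; exact: measurable_mehler_growth.
apply: ae_ge0_le_integral; first exact: measurableT.
- move=> x _; rewrite !mule_ge0 ?poweR_ge0// lee_fin ?powR_ge0//.
  by rewrite mulr_ge0 ?weight_ge0 ?gauss_density_ge0.
- apply: emeasurable_funM.
    apply: emeasurable_funM; first exact: mDp.
    by apply: (measurableT_comp (measurable_poweR p)); exact: measurable_grid_max.
  apply/measurable_EFinP; apply: measurable_funM; last exact: measurable_gauss_density.
  exact: mhw.
- by move=> x _; rewrite mule_ge0 ?poweR_ge0 ?lee_fin.
- apply: emeasurable_funM; last by apply/measurable_EFinP; exact: msp.
  apply: (measurableT_comp (measurable_poweR p)).
  by apply: measurable_cell_max; exact: measurable_grid.
apply: filterS local_max_fin => x Nfin _.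
have NtauN : grid_max tau sp x <= (N x)%:E.
  apply: (@le_trans _ _ (local_max sp x)).
    rewrite /local_max (bigD1 tau)//= leeDl//.
    by apply: sume_ge0 => i _; exact: grid_max_ge0.
  rewrite /N EFinD fineK ?leeDr ?lee_fin//.
  by rewrite ge0_fin_numE//; exact: local_max_ge0.
have gp : grid_max tau u x `^ p <= (N x `^ p)%:E * cell_max (grid_label tau) mu (quot f) x `^ p.
  rewrite -poweR_EFin -poweRM ?lee_fin ?(ltW (N_gt0 x))//.
  apply: gt0_ler_poweR; rewrite ?(ltW p0)// ?in_itv/= ?leey ?andbT ?grid_max_ge0//.
    by rewrite mule_ge0// lee_fin ltW.
  apply: (le_trans (grid_max_factor tau x mf)).
  exact: lee_wpmul2r.
have wx : (D x `^ p * (N x `^ p * (w x * gauss_density x)) <= sp x)%R.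
  have -> : w x = hw x by [].
  have e1 : (D x `^ p * D x `^ (- p) = 1)%R by rewrite powRN mulfV// gt_eqF// powR_gt0.
  have e2 : (N x `^ p * N x `^ (- p) = 1)%R by rewrite powRN mulfV// gt_eqF// powR_gt0.
  have m2 : (Num.min 1 (sp x * N x `^ (- p)) <= sp x * N x `^ (- p))%R by rewrite ge_min lexx orbT.
  have gd := gauss_density_le1 x; have gd0 := gauss_density_ge0 x.
  have Np0 : (0 <= N x `^ p)%R by exact: powR_ge0.
  rewrite /hw.
  have -> : (D x `^ p * (N x `^ p * (D x `^ (- p) * Num.min 1 (sp x * N x `^ (- p)) * gauss_density x)) =
    (D x `^ p * D x `^ (- p)) * (N x `^ p * Num.min 1 (sp x * N x `^ (- p))) * gauss_density x)%R by ring.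
  rewrite e1 mul1r; apply: (@le_trans _ _ (sp x * 1)%R); last by rewrite mulr1.
  apply: ler_pM => //; first by rewrite mulr_ge0// le_min ler01 mulr_ge0 ?powR_ge0.
  by apply: (le_trans (ler_wpM2l Np0 m2)); rewrite mulrCA e2 mulr1.
apply: (@le_trans _ _ ((D x `^ p)%:E * ((N x `^ p)%:E * cell_max (grid_label tau) mu (quot f) x `^ p) *
    (w x * gauss_density x)%:E)).
  apply: lee_wpmul2r; first by rewrite lee_fin mulr_ge0 ?weight_ge0 ?gauss_density_ge0.
  by apply: lee_wpmul2l => //; rewrite lee_fin powR_ge0.
rewrite muleA -EFinM muleAC -EFinM muleC.
apply: lee_wpmul2l; first exact: poweR_ge0.
by rewrite lee_fin -mulrA.
Qed.

Let NT : R := #|{: {ffun 'I_n -> bool}}|%:R.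

(** The hypothesis on [f] is Hoelder's inequality, and deals with the constant
    term of the majorant. *)
Lemma heat_major_strong_type (K : R) : (0 <= K)%R -> exists (w : weight R n) (C : R), forall f : E -> R,
  measurable_fun setT f ->
  (\int[leb]_x (`|f x| * g x)%:E) `^ p <= K%:E * \int[leb]_x (`|f x| `^ p * vt x)%:E ->
  \int[weighted_gauss w]_x (((D x)%:E * heat_major (fun y => `|f y| * g y)%R x) `^ p) <=
  C%:E * \int[leb]_x (`|f x| `^ p * vt x)%:E.
Proof.
move=> K0; set G := fine (@gauss_measure R n setT).
have GE : @gauss_measure R n setT = G%:E.
  by rewrite fineK// ge0_fin_numE//; exact: gauss_measure_setT_lty.
have G0 : (0 <= G)%R by exact: fine_ge0.
pose c1 : R := ((2 `^ p) * (2 `^ p) * NT `^ p)%R.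
have c10 : (0 <= c1)%R by rewrite !mulr_ge0 ?powR_ge0.
have p2 : (1 <= 2 `^ p :> R)%R.
  by rewrite -[leLHS](powRr0 2) ler_powR ?ler1n// ltW.
exists w, (c1 * NT * marcinkiewicz_const p + 2 `^ p * (K * G))%R => f mf hf.
set u := (fun y => `|f y| * g y)%R in hf *.
have u0 y : (0 <= u y)%R by rewrite mulr_ge0// ltW// gauss_weight_gt0.
set I := \int[leb]_x _ in hf *; set F := \int[leb]_x (`|f x| `^ p * vt x)%:E in hf *.
have I0 : 0 <= I by apply: integral_ge0 => x _; rewrite lee_fin; exact: u0.
have F0 : 0 <= F.
  by apply: integral_ge0 => x _; rewrite lee_fin mulr_ge0 ?powR_ge0// ltW// weighted_gauss_density_gt0.
have mDp : measurable_fun setT (fun x => (D x `^ p)%:E).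
  by apply/measurable_EFinP/measurable_fun_powR_comp; exact: measurable_mehler_growth.
have mwg : measurable_fun setT (fun x => (w x * gauss_density x)%:E).
  apply/measurable_EFinP; apply: measurable_funM; last exact: measurable_gauss_density.
  exact: mhw.
have wg0 x : (0 <= w x * gauss_density x)%R by rewrite mulr_ge0 ?weight_ge0 ?gauss_density_ge0.
rewrite ge0_integral_weighted_gauss; last 2 first.
- apply: (measurableT_comp (measurable_poweR p)); apply: emeasurable_funM; last exact: measurable_heat_major.
  by apply/measurable_EFinP; exact: measurable_mehler_growth.
- by move=> x; exact: poweR_ge0.
pose T tau x := (D x `^ p)%:E * grid_max tau u x `^ p * (w x * gauss_density x)%:E.
have T0 tau x : 0 <= T tau x.
  by rewrite /T !mule_ge0 ?poweR_ge0 ?lee_fin ?powR_ge0.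
have mT tau : measurable_fun setT (T tau).
  apply: emeasurable_funM; last exact: mwg.
  apply: emeasurable_funM; first exact: mDp.
  by apply: (measurableT_comp (measurable_poweR p)); exact: measurable_grid_max.
apply: (@le_trans _ _ (\int[leb]_x (c1%:E * (\sum_tau T tau x) +
    (2 `^ p)%:E * I `^ p * (gauss_density x)%:E))).
  apply: ge0_le_integral_any => x _; first by rewrite mule_ge0 ?poweR_ge0 ?lee_fin.
  have L0 : 0 <= local_max u x by exact: local_max_ge0.
  have Hp : heat_major u x `^ p <= c1%:E * (\sum_tau grid_max tau u x `^ p) + (2 `^ p)%:E * I `^ p.
    apply: (le_trans (poweRD_le p0 _ I0)); first by rewrite mule_ge0.
    rewrite ge0_muleDr ?poweR_ge0//; apply: leeD => //.
    rewrite poweRM// poweR_EFin /c1 !EFinM -!muleA.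
    do 2 (apply: lee_wpmul2l; first by rewrite lee_fin powR_ge0).
    by apply: poweR_sum_le => // tau; exact: grid_max_ge0.
  rewrite poweRM ?lee_fin ?(ltW (D0 x))//; last exact: heat_major_ge0.
  rewrite poweR_EFin.
  apply: (@le_trans _ _ ((D x `^ p)%:E * (c1%:E * (\sum_tau grid_max tau u x `^ p) + (2 `^ p)%:E * I `^ p) * (w x * gauss_density x)%:E)).
    apply: lee_wpmul2r; first by rewrite lee_fin.
    by apply: lee_wpmul2l => //; rewrite lee_fin powR_ge0.
  rewrite ge0_muleDr; last 2 first.
  - by rewrite mule_ge0 ?lee_fin// sume_ge0// => tau _; exact: poweR_ge0.
  - by rewrite mule_ge0 ?poweR_ge0 ?lee_fin ?powR_ge0.
  rewrite ge0_muleDl; last 2 first.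
  - by rewrite !mule_ge0 ?lee_fin ?powR_ge0// sume_ge0// => tau _; exact: poweR_ge0.
  - by rewrite !mule_ge0 ?poweR_ge0 ?lee_fin ?powR_ge0.
  apply: leeD.
    rewrite muleCA -muleA; apply: lee_wpmul2l; first by rewrite lee_fin.
    rewrite ge0_sume_distrr; last by move=> tau _; exact: poweR_ge0.
    by rewrite ge0_sume_distrl// => tau _; rewrite mule_ge0 ?poweR_ge0 ?lee_fin ?powR_ge0.
  rewrite [X in X * _]muleC -muleA; apply: lee_wpmul2l.
    by rewrite mule_ge0 ?poweR_ge0 ?lee_fin ?powR_ge0.
  rewrite -EFinM lee_fin mulrA -[leRHS]mul1r; apply: ler_wpM2r; first exact: gauss_density_ge0.
  have -> : w x = hw x by [].
  rewrite /hw mulrA powRN mulfV ?mul1r ?ge_min ?lexx//.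
  by rewrite gt_eqF// powR_gt0.
rewrite ge0_integralD; last 5 first.
- exact: measurableT.
- by move=> x _; rewrite mule_ge0 ?lee_fin// sume_ge0.
- by apply: measurable_funeM; exact: emeasurable_sum.
- by move=> x _; rewrite !mule_ge0 ?poweR_ge0 ?lee_fin ?powR_ge0 ?gauss_density_ge0.
- by apply: measurable_funeM; apply/measurable_EFinP; exact: measurable_gauss_density.
have C20 : (0 <= 2 `^ p * (K * G))%R by rewrite !mulr_ge0 ?powR_ge0.
have mcst0 : (0 <= marcinkiewicz_const p)%R.
  rewrite /marcinkiewicz_const mulr_ge0 ?powR_ge0// invr_ge0 subr_ge0.
  rewrite powRN invf_le1 ?powR_gt0// -[leLHS](powRr0 2) ler_powR ?ler1n//.
  by rewrite subr_ge0 ltW.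
have NT0 : (0 <= NT)%R by [].
have C10 : (0 <= c1 * NT * marcinkiewicz_const p)%R.
  by apply: mulr_ge0 => //; exact: mulr_ge0.
rewrite EFinD (ge0_muleDl _ (y := (c1 * NT * marcinkiewicz_const p)%:E)); [|by rewrite lee_fin|by rewrite lee_fin].
apply: leeD.
  rewrite ge0_integralZl_EFin; last 4 first.
  - exact: measurableT.
  - by move=> x _; rewrite sume_ge0.
  - exact: emeasurable_sum.
  - exact: c10.
  rewrite -[(c1 * NT * _)%R]mulrA (EFinM c1) -muleA; apply: lee_wpmul2l; first by rewrite lee_fin.
  rewrite (EFinM NT) -muleA.
  rewrite ge0_integral_sum; last 3 first.
  - exact: measurableT.
  - exact: mT.
  - by move=> tau x _; exact: T0.
  apply: (@le_trans _ _ (\sum_(tau : {ffun 'I_n -> bool}) 1%:E * ((marcinkiewicz_const p)%:E * F))).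
    by apply: lee_sum => tau _; rewrite mul1e; exact: term_bound.
  rewrite -ge0_sume_distrl//.
  by rewrite sumEFin sumr_const.
rewrite ge0_integralZl; last 4 first.
- exact: measurableT.
- by apply/measurable_EFinP; exact: measurable_gauss_density.
- by move=> x _; rewrite lee_fin gauss_density_ge0.
- by rewrite mule_ge0 ?poweR_ge0 ?lee_fin ?powR_ge0.
rewrite (_ : integral _ _ _ = G%:E); last exact: GE.
rewrite !EFinM -!muleA.
apply: lee_wpmul2l; first by rewrite lee_fin powR_ge0.
rewrite muleC [leRHS]muleCA; apply: lee_wpmul2l; first by rewrite lee_fin.
exact: hf.
Qed.

End fixed_dual_weight.

End strong_type.

(** * Sufficiency of the condition for maximal inequalities *)

Lemma chebyshev_poweR d (T : measurableType d) (R : realType)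
    (mu : {measure set T -> \bar R}) (G : T -> \bar R) (p l : R) :
  0 < p -> 0 < l -> measurable_fun setT G -> (forall x, 0 <= G x)%E ->
  ((l `^ p)%:E * mu [set x | l%:E < G x]%E <= \int[mu]_x (G x `^ p))%E.
Proof.
move=> p0 l0 mG G0; have mA := measurable_superlevel l mG.
rewrite -integral_cst//.
apply: (@le_trans _ _ (\int[mu]_(x in [set x | l%:E < G x]) (G x `^ p))%E).
  apply: ge0_le_integral_any => x /= lx; first by rewrite lee_fin powR_ge0.
  rewrite -poweR_EFin; apply: gt0_ler_poweR; rewrite ?(ltW p0) ?(ltW lx)//.
    by rewrite in_itv/= leey lee_fin ltW.
  by rewrite in_itv/= leey G0.
by apply: ge0_subset_integral_any => // x; exact: poweR_ge0.
Qed.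

Section maximal_bounds.
Context (R : realType) (n : nat) (v : weight R n) (p : R).
Local Notation E := (euclid R n).
Local Notation leb := (lebesgue R n).
Local Open Scope ereal_scope.

Lemma Lfun_weightedP (f : E -> R) : f \in Lfun (weighted_gauss v) p%:E <->
  measurable_fun setT f /\ 'N[weighted_gauss v]_p%:E[EFin \o f] < +oo.
Proof.
split=> [/andP[]|[mf Nf]]; first by rewrite !inE.
by apply/andP; split; rewrite !inE.
Qed.

(** Stated for a measurable majorant so that both the norm inequality and
    Chebyshev's inequality can be drawn from it. *)
Lemma DW_strong_majorant : (1 < p)%R -> DW p v ->
  exists (r : R) (w : weight R n) (C : R), [/\ (0 < r)%R, (0 <= C)%R &
  forall f : E -> R, measurable_fun setT f -> exists G : E -> \bar R,
  [/\ measurable_fun setT G, forall x, mehler_max r f x <= G x &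
    \int[weighted_gauss w]_x (G x `^ p) <=
    C%:E * 'N[weighted_gauss v]_p%:E[EFin \o f] `^ p]].
Proof.
move=> p1 /(DW_gt1P v p1)[t0 t00 sp_fin]; have p0 : (0 < p)%R by exact: lt_trans p1.
set b := (p^-1 + (4 * t0)^-1)%R in sp_fin *.
have b0 : (0 < b)%R by rewrite addr_gt0 ?invr_gt0// mulr_gt0.
have [K K0 hK] := dual_dens_L1 p1 sp_fin.
have [w [C hC]] := heat_major_strong_type p1 b0 sp_fin (powR_ge0 K p).
exists (32 * b)^-1%R, w, (Num.max C 0)%R; split.
- by rewrite invr_gt0 mulr_gt0.
- by rewrite le_max lexx orbT.
move=> f mf; exists (fun x => (mehler_growth b x)%:E * heat_major (fun y => `|f y| * gauss_weight b y)%R x).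
split.
- apply: emeasurable_funM; last exact: measurable_heat_major.
  by apply/measurable_EFinP; exact: measurable_mehler_growth.
- by move=> x; apply: mehler_max_le => //; rewrite mulfV// gt_eqF// mulr_gt0.
rewrite Lnorm_weighted//.
apply: (@le_trans _ _ (C%:E * \int[leb]_x (`|f x| `^ p * weighted_gauss_density v x)%:E)); last first.
  apply: lee_wpmul2r; last by rewrite lee_fin le_max lexx.
  by apply: integral_ge0 => x _; rewrite lee_fin mulr_ge0 ?powR_ge0// ltW// weighted_gauss_density_gt0.
apply: hC => //; rewrite -Lnorm_weighted// -poweR_EFin -poweRM ?lee_fin ?Lnorm_ge0//.
apply: gt0_ler_poweR; rewrite ?(ltW p0) ?hK// ?in_itv/= ?leey ?andbT.
  by apply: integral_ge0 => x _; rewrite lee_fin mulr_ge0// ltW// gauss_weight_gt0.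
by rewrite mule_ge0 ?lee_fin ?Lnorm_ge0.
Qed.

Lemma DW_strong_type : (1 < p)%R -> DW p v -> exists2 r : R, (0 < r)%R &
  exists w : weight R n,
  strong_type p (weighted_gauss v) (weighted_gauss w) (@mehler_max R n r).
Proof.
move=> p1 /(DW_strong_majorant p1)[r [w [C [r0 C0 hC]]]].
have p0 : (0 < p)%R by exact: lt_trans p1.
exists r => //; exists w, (C `^ p^-1)%R => f /Lfun_weightedP[mf _].
have [G [mG MG hG]] := hC f mf.
rewrite -[leRHS]poweRe1 ?mule_ge0 ?lee_fin ?powR_ge0 ?Lnorm_ge0//.
rewrite -(mulfV (lt0r_neq0 p0)) poweRrM poweRM ?lee_fin ?powR_ge0 ?Lnorm_ge0//.
rewrite poweR_EFin -powRrM mulVf ?gt_eqF// powRr1//.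
have -> : 'N[weighted_gauss w]_p%:E[mehler_max r f] =
    (\int[weighted_gauss w]_x (`|mehler_max r f x| `^ p)) `^ p^-1 by rewrite unlock.
have h0 : 0 <= \int[weighted_gauss w]_x (`|mehler_max r f x| `^ p).
  by apply: integral_ge0 => x _; exact: poweR_ge0.
have h1 : 0 <= C%:E * 'N[weighted_gauss v]_p%:E[EFin \o f] `^ p.
  by rewrite mule_ge0 ?lee_fin ?poweR_ge0.
apply: gt0_ler_poweR; rewrite ?in_itv/= ?leey ?h0 ?h1 ?invr_ge0 ?(ltW p0)//.
apply: le_trans hG; apply: ge0_le_integral_any => x _; first exact: poweR_ge0.
have M0 := mehler_max_ge0 f x r0.
rewrite gee0_abs//; apply: gt0_ler_poweR; rewrite ?in_itv/= ?leey ?M0 ?(ltW p0)//.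
by rewrite (le_trans M0).
Qed.

Lemma DW_weak_type : (1 <= p)%R -> DW p v -> exists2 r : R, (0 < r)%R &
  exists w : weight R n,
  weak_type p (weighted_gauss v) (weighted_gauss w) (@mehler_max R n r).
Proof.
rewrite le_eqVlt => /predU1P[p1|p1].
  rewrite -p1 => /(DW_L1 (lexx _))[b [K [b0 K0 hK]]].
  have r0 : (0 < (32 * b)^-1)%R by rewrite invr_gt0 mulr_gt0.
  have br : (32 * b * (32 * b)^-1 <= 1)%R by rewrite mulfV// gt_eqF// mulr_gt0.
  have [w [K' [K'0 weak]]] := @mehler_max_weak_type R n b _ b0 r0 br.
  exists (32 * b)^-1%R => //; exists w, (K' * K)%R => f fL l l0.
  have [mf _] : measurable_fun setT f /\ 'N[weighted_gauss v]_1[EFin \o f] < +oo.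
    by move: fL; rewrite {1}p1 => /Lfun_weightedP; rewrite -p1.
  have := weak f mf l l0; under eq_set do rewrite -[X in l%:E < X]gee0_abs ?mehler_max_ge0//.
  move=> h; rewrite poweRe1 ?Lnorm_ge0// powR_inv1 ?(ltW l0)// muleAC.
  rewrite lee_pdivlMr// muleC; apply: (le_trans h).
  rewrite EFinM -muleA; apply: lee_wpmul2l; first by rewrite lee_fin ltW.
  exact: hK.
move=> /(DW_strong_majorant p1)[r [w [C [r0 C0 hC]]]].
have p0 : (0 < p)%R by exact: lt_trans p1.
exists r => //; exists w, C => f /Lfun_weightedP[mf _] l l0.
have [G [mG MG hG]] := hC f mf.
have G0 x : 0 <= G x by apply: le_trans (MG x); exact: mehler_max_ge0.
rewrite powRN muleAC lee_pdivlMr ?powR_gt0// muleC.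
apply: le_trans hG; apply: le_trans (chebyshev_poweR _ p0 l0 mG G0).
apply: lee_wpmul2l; first by rewrite lee_fin powR_ge0.
apply: ge0_subset_integral_any => x /=; first by rewrite lee_fin weight_ge0.
by rewrite gee0_abs ?mehler_max_ge0// => lx; exact: lt_le_trans (MG x).
Qed.

Lemma heat_major_ae_lty (b : R) (f : E -> R) : measurable_fun setT f ->
  \int[leb]_x (`|f x| * gauss_weight b x)%:E < +oo ->
  {ae leb, forall x, heat_major (fun y => `|f y| * gauss_weight b y)%R x < +oo}.
Proof.
move=> mf fin; set u := (fun y => `|f y| * gauss_weight b y)%R.
have mu : measurable_fun setT u.
  by apply: measurable_funM; [exact: measurableT_comp|exact: measurable_gauss_weight].
have u0 y : (0 <= u y)%R by rewrite mulr_ge0// ltW// gauss_weight_gt0.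
have h tau : {ae leb, forall x, grid_max tau u x < +oo}.
  apply: (weak_type_ae_lty (measurable_grid_max tau u) fin) => l l0.
  exact: grid_max_weak_type.
have : \forall x \ae leb, forall tau, grid_max tau u x < +oo by exact: filter_forall.
apply: filterS => x hx; apply: lte_add_pinfty; last exact: fin.
apply: lte_mul_pinfty => //.
by apply: lte_sum_pinfty => tau _; exact: hx.
Qed.

Lemma DW_mehler_max_lty : (1 <= p)%R -> DW p v -> exists2 r : R, (0 < r)%R &
  forall f : E -> R, f \in Lfun (weighted_gauss v) p%:E ->
  {ae leb, forall x, mehler_max r f x < +oo}.
Proof.
move=> p1 /(DW_L1 p1)[b [K [b0 K0 hK]]].
exists (32 * b)^-1%R; first by rewrite invr_gt0 mulr_gt0.
move=> f /Lfun_weightedP[mf Nf].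
have fin : \int[leb]_x (`|f x| * gauss_weight b x)%:E < +oo.
  by apply: le_lt_trans (hK f mf) _; rewrite lte_mul_pinfty.
have := heat_major_ae_lty mf fin; apply: filterS => x hx.
apply: (@le_lt_trans _ _ ((mehler_growth b x)%:E * heat_major (fun y => `|f y| * gauss_weight b y)%R x)).
  by apply: mehler_max_le => //; rewrite mulfV// gt_eqF// mulr_gt0.
by rewrite lte_mul_pinfty// lee_fin ltW// mehler_growth_gt0.
Qed.

End maximal_bounds.

(** * Necessity of the condition *)

Section converse_hoelder.
Context d (T : measurableType d) (R : realType).
Variable mu : {measure set T -> \bar R}.
Variables (V g : T -> R) (p : R).
Hypotheses (mV : measurable_fun setT V) (mg : measurable_fun setT g).
Hypotheses (V0 : forall x, 0 < V x) (g0 : forall x, 0 < g x).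
Hypothesis p1 : 1 <= p.
Local Open Scope ereal_scope.

Let p0 : (0 < p)%R. Proof. exact: lt_le_trans p1. Qed.

(** A gliding-hump form of the uniform boundedness principle: were the
    functional unbounded on the unit ball, functions [F_k] of norm at most one
    with [\int F_k g > 4^(k+1)] would be dominated, up to the factor [2^(k+1)],
    by the single function [(\sum_k 2^-(k+1) F_k^p)^(1/p)] of norm at most
    one. *)
Lemma finite_functional_bounded :
  (forall f : T -> R, measurable_fun setT f -> (forall x, 0 <= f x)%R ->
    \int[mu]_x (f x `^ p * V x)%:E < +oo -> \int[mu]_x (f x * g x)%:E < +oo) ->
  exists C : R, forall F : T -> R, measurable_fun setT F -> (forall x, 0 <= F x)%R ->
    \int[mu]_x (F x `^ p * V x)%:E <= 1 -> \int[mu]_x (F x * g x)%:E <= C%:E.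
Proof.
move=> fin; apply: contrapT => unb.
have /choice[F hF] : forall k : nat, exists F : T -> R,
    [/\ measurable_fun setT F, (forall x, 0 <= F x)%R,
      \int[mu]_x (F x `^ p * V x)%:E <= 1 &
      ((2 ^ k.+1)%:R ^+ 2)%:E < \int[mu]_x (F x * g x)%:E].
  move=> k; apply: contrapT => nF; apply: unb.
  exists ((2 ^ k.+1)%:R ^+ 2)%R => F mF F0 nF1.
  by rewrite leNgt; apply/negP => lt; apply: nF; exists F.
pose c k : R := (1 / (2 ^ k.+1)%:R)%R.
have c0 k : (0 < c k)%R by rewrite divr_gt0// ltr0n expn_gt0.
pose S_ k x : \bar R := (c k)%:E * (F k x `^ p * V x)%:E.
have mFV k : measurable_fun setT (fun x => F k x `^ p * V x)%R.
  have [mF _ _ _] := hF k.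
  by apply: measurable_funM; [exact: measurable_fun_powR_comp|exact: mV].
have FV0 k x : (0 <= F k x `^ p * V x)%R by rewrite mulr_ge0 ?powR_ge0// ltW.
have S0 k x : 0 <= S_ k x by rewrite mule_ge0 ?lee_fin ?(ltW (c0 k)).
have mS k : measurable_fun setT (S_ k).
  by apply: measurable_funeM; exact/measurable_EFinP.
pose S x := \sum_(0 <= k <oo) S_ k x.
have Sge0 x : 0 <= S x by apply: nneseries_ge0 => k _ _; exact: S0.
have mSS : measurable_fun setT S.
  have -> : S = (fun x => \sum_(0 <= k <oo | k \in predT) S_ k x) by [].
  exact: ge0_emeasurable_sum.
have S1 : \int[mu]_x S x <= 1.
  rewrite integral_nneseries//.
  apply: le_trans (epsilon_trick0 predT (@ler01 R)).
  apply: lee_nneseries => k _; first by move=> _; exact: integral_ge0.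
  rewrite ge0_integralZl_EFin; last 4 first.
  - exact: measurableT.
  - by move=> x _; rewrite lee_fin.
  - exact/measurable_EFinP.
  - exact: ltW.
  have [_ _ F1 _] := hF k.
  by rewrite -[leRHS]mule1; apply: lee_wpmul2l => //; rewrite lee_fin ltW.
have Sfin : {ae mu, forall x, S x \is a fin_num}.
  have /(integrable_ae measurableT) : mu.-integrable setT S.
    apply/integrableP; split => //; apply: le_lt_trans (ltry 1).
    by apply: le_trans S1; apply: ge0_le_integral_any => x _ //; rewrite gee0_abs.
  by apply: filterS => x; exact.
pose f x := ((fine (S x) / V x) `^ p^-1)%R.
have f0 x : (0 <= f x)%R by exact: powR_ge0.
have mf : measurable_fun setT f.
  apply: measurable_fun_powR_comp; apply: measurable_funM.
    by apply: (measurableT_comp (@fine_measurable R _ measurableT)).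
  exact: measurable_fun_inv.
have fV x : (f x `^ p * V x = fine (S x))%R.
  rewrite /f -powRrM mulVf ?gt_eqF// powRr1; first by rewrite divfK// gt_eqF.
  by rewrite divr_ge0 ?fine_ge0// ltW.
have fg : \int[mu]_x (f x * g x)%:E < +oo.
  apply: fin => //; apply: le_lt_trans (ltry 1); apply: le_trans S1.
  apply: ge0_le_integral_any => x _; rewrite fV ?lee_fin ?fine_ge0//.
  by case: (S x) (Sge0 x) => //= _; rewrite leey.
have fg0 : 0 <= \int[mu]_x (f x * g x)%:E.
  by apply: integral_ge0 => x _; rewrite lee_fin mulr_ge0// ltW.
have mfg : measurable_fun setT (fun x => (f x * g x)%:E).
  by apply/measurable_EFinP; exact: measurable_funM.
have dom k : \int[mu]_x (F k x * g x)%:E <= (2 ^ k.+1)%:R%:E * \int[mu]_x (f x * g x)%:E.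
  have [mF F0 _ _] := hF k.
  rewrite -ge0_integralZl_EFin; last 4 first.
  - exact: measurableT.
  - by move=> x _; rewrite lee_fin mulr_ge0// ltW.
  - exact: mfg.
  - by [].
  apply: ae_ge0_le_integral; first exact: measurableT.
  - by move=> x _; rewrite lee_fin mulr_ge0// ltW.
  - by apply/measurable_EFinP; exact: measurable_funM.
  - by move=> x _; rewrite -EFinM lee_fin !mulr_ge0// ltW.
  - exact: measurable_funeM.
  apply: filterS Sfin => x Sx _; rewrite -EFinM lee_fin mulrA ler_wpM2r ?(ltW (g0 x))//.
  have Sk : (c k * (F k x `^ p * V x) <= fine (S x))%R.
    rewrite -lee_fin fineK// EFinM.
    apply: le_trans (nneseries_lim_ge k.+1 (fun n _ _ => S0 n x)).
    by rewrite big_mkord big_ord_recr/= leeDr// sume_ge0.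
  have le1 : (F k x `^ p <= (2 ^ k.+1)%:R * (fine (S x) / V x))%R.
    rewrite mulrA ler_pdivlMr//; move: Sk.
    by rewrite /c mul1r ler_pdivrMl ?ltr0n ?expn_gt0.
  have SV0 : (0 <= fine (S x) / V x)%R by rewrite divr_ge0 ?fine_ge0// ltW.
  rewrite -[leLHS]powRr1// -[X in (_ `^ X <= _)%R](mulfV (lt0r_neq0 p0)) powRrM.
  apply: (@le_trans _ _ (((2 ^ k.+1)%:R * (fine (S x) / V x)) `^ p^-1)%R).
    by apply: ge0_ler_powR; rewrite ?nnegrE ?powR_ge0 ?invr_ge0 ?(ltW p0)// mulr_ge0.
  rewrite powRM//; apply: ler_wpM2r; first exact: powR_ge0.
  rewrite -[leRHS]powRr1//; apply: ler_powR; last by rewrite invf_le1.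
  by rewrite ler1n expn_gt0.
have [A fA] : exists A : R, \int[mu]_x (f x * g x)%:E = A%:E.
  by exists (fine (\int[mu]_x (f x * g x)%:E)); rewrite fineK// ge0_fin_numE.
have big k : ((2 ^ k.+1)%:R < A)%R.
  have [_ _ _ lt] := hF k; have := lt_le_trans lt (dom k).
  by rewrite fA -EFinM lte_fin expr2 ltr_pM2l// ltr0n expn_gt0.
have := big (Num.truncn A); apply/negP; rewrite -leNgt ltW//.
apply: (lt_trans (truncnS_gt A)); rewrite ltr_nat.
exact: ltn_expl.
Qed.

Variable h : T -> R.
Hypotheses (mh : measurable_fun setT h) (h0 : forall x, (0 < h x)%R).
Hypothesis hfin : \int[mu]_x (h x)%:E < +oo.

Variable C : R.
Hypothesis hC : forall F : T -> R, measurable_fun setT F -> (forall x, 0 <= F x)%R ->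
    \int[mu]_x (F x `^ p * V x)%:E <= 1 -> \int[mu]_x (F x * g x)%:E <= C%:E.

Let measurable_ler (a b : T -> R) : measurable_fun setT a -> measurable_fun setT b ->
  measurable [set x | (a x <= b x)%R].
Proof.
move=> ma mb; have := measurable_fun_ler ma mb.
by move=> /(_ measurableT [set true] I); rewrite setTI.
Qed.

(** Testing on [s / g], the extremal function of Hoelder's inequality, where
    [s = (g V^(-1/p))^p'], cut off and normalised on a set [A] of finite
    [s dx]-measure: the bound reads [s(A)^(1/p') <= C], uniformly in [A]. *)
Lemma bounded_functional_dual_gt1 : (1 < p)%R ->
  \int[mu]_x ((g x * V x `^ (- p^-1)) `^ (p / (p - 1)))%:E < +oo.
Proof.
move=> pgt1; set q := (p / (p - 1))%R.
have pm : (0 < p - 1)%R by rewrite subr_gt0.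
have q0 : (0 < q)%R by rewrite divr_gt0.
pose s x := ((g x * V x `^ (- p^-1)) `^ q)%R.
have s0 x : (0 < s x)%R by rewrite powR_gt0// mulr_gt0 ?powR_gt0.
have ms : measurable_fun setT s.
  apply: measurable_fun_powR_comp; apply: measurable_funM => //.
  exact: measurable_fun_powR_comp.
have sE x : ((s x / g x) `^ p * V x = s x)%R.
  have gx := g0 x; have Vx := V0 x; have sx := s0 x.
  rewrite powRM ?invr_ge0 ?(ltW sx) ?(ltW gx)//.
  have -> : ((g x)^-1 `^ p = g x `^ (- p))%R.
    by rewrite -(powR_inv1 (ltW gx)) -powRrM mulN1r.
  have gV : (g x = s x `^ q^-1 * V x `^ (p^-1))%R.
    rewrite /s -powRrM mulfV ?gt_eqF// powRr1 ?mulr_ge0 ?powR_ge0 ?(ltW gx)//.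
    by rewrite -mulrA powRN mulVf ?mulr1// gt_eqF// powR_gt0.
  have -> : (g x `^ (- p) = s x `^ (q^-1 * - p) * (V x)^-1)%R.
    rewrite {1}gV powRM ?powR_ge0// -!powRrM [(p^-1 * - p)%R]mulrN mulVf ?gt_eqF//.
    by rewrite powR_inv1// ltW.
  rewrite mulrA divfK ?gt_eqF//.
  rewrite -powRD; last by rewrite (gt_eqF sx) implybT.
  rewrite (_ : (p + q^-1 * - p = 1)%R) ?powRr1 ?(ltW sx)//.
  by rewrite /q invf_div; field; rewrite gt_eqF.
pose nu : {measure set T -> \bar R} := density_measure mu ms (fun x => ltW (s0 x)).
(* [h] is integrable and positive, so these sets have finite measure and exhaust
   the space *)
pose A (m : nat) := [set x | (s x <= m%:R * h x)%R].
have mA m : measurable (A m) by apply: measurable_ler => //; exact: measurable_funM.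
have AT : \bigcup_m A m = setT.
  apply/seteqP; split => // x _; exists (Num.truncn (s x / h x)).+1 => //=.
  by rewrite /A/= -ler_pdivrMr// ltW// truncnS_gt.
have Afin m : nu (A m) < +oo.
  apply: (@le_lt_trans _ _ (\int[mu]_x (m%:R%:E * (h x)%:E))).
    rewrite [leLHS]integral_mkcond; apply: ge0_le_integral_any => x _; rewrite /patch.
      by case: ifP => _ //; rewrite lee_fin ltW.
    case: ifPn => [/[!inE] xA|_]; first by rewrite -EFinM lee_fin.
    by rewrite -EFinM lee_fin mulr_ge0// ltW.
  rewrite ge0_integralZl_EFin; last 4 first.
  - exact: measurableT.
  - by move=> x _; rewrite lee_fin ltW.
  - exact/measurable_EFinP.
  - by [].
  by rewrite lte_mul_pinfty.
have Abound m : nu (A m) <= (`|C| `^ q)%:E.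
  have := Afin m; have : 0 <= nu (A m) by exact: measure_ge0.
  case nuA : (nu (A m)) => [a| |]//; rewrite !lee_fin => a0 _.
  have [->|an0] := eqVneq a 0%R; first exact: powR_ge0.
  have agt0 : (0 < a)%R by rewrite lt_neqAle eq_sym an0.
  pose F x := (s x / g x * (a `^ (- p^-1) * \1_(A m) x))%R.
  have F0 x : (0 <= F x)%R.
    have sx := ltW (s0 x); have gx := ltW (g0 x).
    by rewrite mulr_ge0// mulr_ge0 ?powR_ge0 ?invr_ge0.
  have mF : measurable_fun setT F.
    apply: measurable_funM.
      by apply: measurable_funM => //; exact: measurable_fun_inv.
    by apply: measurable_funM; [exact: measurable_cst|exact: measurable_indic].
  have intA (k : R) : (0 <= k)%R -> \int[mu]_x (k * (s x * \1_(A m) x))%:E = (k * a)%:E.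
    move=> k0; under eq_integral do rewrite EFinM.
    rewrite ge0_integralZl_EFin; last 4 first.
    - exact: measurableT.
    - by move=> x _; rewrite lee_fin mulr_ge0// ltW.
    - by apply/measurable_EFinP; apply: measurable_funM => //; exact: measurable_indic.
    - exact: k0.
    rewrite EFinM -nuA; congr (_ * _); rewrite /nu/= /density_measure [RHS]integral_mkcond.
    apply: eq_integral => x _; rewrite /patch indicE.
    by case: ifP => _; rewrite ?mulr1 ?mulr0.
  have Fp x : (F x `^ p * V x = a^-1 * (s x * \1_(A m) x))%R.
    rewrite /F powRM; [|by rewrite mulr_ge0 ?invr_ge0 ?ltW|by rewrite mulr_ge0 ?powR_ge0].
    rewrite mulrAC sE powRM ?powR_ge0// -powRrM mulNr mulVf ?gt_eqF// powR_inv1//.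
    rewrite mulrCA; congr (_ * (_ * _))%R; rewrite indicE; case: (_ \in _) => /=.
      by rewrite powR1.
    by rewrite powR0// gt_eqF.
  have := hC mF F0; under eq_integral do rewrite Fp.
  rewrite intA ?invr_ge0// mulVf// => /(_ (lexx _)).
  have Fg x : (F x * g x = a `^ (- p^-1) * (s x * \1_(A m) x))%R.
    by rewrite /F; field; rewrite gt_eqF.
  under eq_integral do rewrite Fg.
  rewrite intA ?powR_ge0// lee_fin => hCa.
  have aq : (a `^ (- p^-1) * a = a `^ q^-1)%R.
    rewrite -[X in (_ * X)%R]powRr1// -powRD; last by rewrite an0 implybT.
    by congr (_ `^ _)%R; rewrite /q invf_div; field; rewrite gt_eqF.
  rewrite -[leLHS]powRr1// -[X in (_ `^ X <= _)%R](mulVf (lt0r_neq0 q0)) powRrM -aq.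
  apply: ge0_ler_powR; rewrite ?nnegrE ?(ltW q0)//.
    by rewrite mulr_ge0 ?powR_ge0.
  by apply: (le_trans hCa); exact: ler_norm.
have cvgA : (nu \o A) m @[m --> \oo] --> nu (\bigcup_m A m).
  apply: nondecreasing_cvg_mu => //; first by rewrite AT.
  move=> i j ij; apply/subsetPset => x; rewrite /A/= => /le_trans; apply.
  by rewrite ler_wpM2r ?ler_nat// ltW.
apply: (@le_lt_trans _ _ (nu (\bigcup_m A m))); first by rewrite AT.
apply: (@le_lt_trans _ _ (`|C| `^ q)%:E); last exact: ltry.
rewrite -(cvg_lim _ cvgA)//; apply: lime_le.
  by apply/cvg_ex; exists (nu (\bigcup_m A m)).
by apply: nearW => m; exact: Abound.
Qed.

(** A set where [g >= M V] with [M > C] would violate the bound, unless it is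
    null. *)
Lemma bounded_functional_dual_1 : p = 1%R ->
  exists M : R, {ae mu, forall x, (g x / V x <= M)%R}.
Proof.
move=> pE; exists (`|C| + 1)%R; set M := (`|C| + 1)%R.
have M0 : (0 < M)%R by rewrite ltr_wpDl.
pose A (m : nat) := [set x | (M * V x <= g x)%R] `&` [set x | (V x <= m%:R * h x)%R].
have mA m : measurable (A m).
  by apply: measurableI; apply: measurable_ler => //; exact: measurable_funM.
pose nu : {measure set T -> \bar R} := density_measure mu mV (fun x => ltW (V0 x)).
have Afin m : nu (A m) < +oo.
  apply: (@le_lt_trans _ _ (\int[mu]_x (m%:R%:E * (h x)%:E))).
    rewrite [leLHS]integral_mkcond; apply: ge0_le_integral_any => x _; rewrite /patch.
      by case: ifP => _ //; rewrite lee_fin ltW.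
    case: ifPn => [/[!inE] -[_ xA]|_]; first by rewrite -EFinM lee_fin.
    by rewrite -EFinM lee_fin mulr_ge0// ltW.
  rewrite ge0_integralZl_EFin; last 4 first.
  - exact: measurableT.
  - by move=> x _; rewrite lee_fin ltW.
  - exact/measurable_EFinP.
  - by [].
  by rewrite lte_mul_pinfty.
have nuA0 m : nu (A m) = 0.
  have := Afin m; have : 0 <= nu (A m) by exact: measure_ge0.
  case nuA : (nu (A m)) => [a| |]//; rewrite lee_fin => a0 _.
  have [->//|an0] := eqVneq a 0%R; exfalso.
  have agt0 : (0 < a)%R by rewrite lt_neqAle eq_sym an0.
  pose F x := (a^-1 * \1_(A m) x)%R.
  have F0 x : (0 <= F x)%R by rewrite mulr_ge0// invr_ge0.
  have mF : measurable_fun setT F.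
    by apply: measurable_funM; [exact: measurable_cst|exact: measurable_indic].
  have intA (k : R) : (0 <= k)%R -> \int[mu]_x (k * (V x * \1_(A m) x))%:E = (k * a)%:E.
    move=> k0; under eq_integral do rewrite EFinM.
    rewrite ge0_integralZl_EFin; last 4 first.
    - exact: measurableT.
    - by move=> x _; rewrite lee_fin mulr_ge0// ltW.
    - by apply/measurable_EFinP; apply: measurable_funM => //; exact: measurable_indic.
    - exact: k0.
    rewrite EFinM -nuA; congr (_ * _); rewrite /nu/= /density_measure [RHS]integral_mkcond.
    apply: eq_integral => x _; rewrite /patch indicE.
    by case: ifP => _; rewrite ?mulr1 ?mulr0.
  have := hC mF F0.
  have -> : \int[mu]_x (F x `^ p * V x)%:E = \int[mu]_x (a^-1 * (V x * \1_(A m) x))%:E.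
    by apply: eq_integral => x _; rewrite pE powRr1// /F -mulrA (mulrC (V x)).
  rewrite intA ?invr_ge0// mulVf// => /(_ (lexx _)) hCF.
  have : \int[mu]_x (a^-1 * M * (V x * \1_(A m) x))%:E <= C%:E.
    apply: le_trans hCF; apply: ge0_le_integral_any => x _.
      by rewrite lee_fin !mulr_ge0 ?invr_ge0 ?(ltW M0) ?(ltW (V0 x)).
    rewrite lee_fin /F -!mulrA ler_wpM2l ?invr_ge0// indicE.
    case: (boolP (x \in A m)) => [/[!inE] -[/= xA _]|_]; last by rewrite !mulr0 mul0r.
    by rewrite mulr1 mul1r.
  rewrite intA ?mulr_ge0 ?invr_ge0 ?(ltW M0)// lee_fin mulrAC mulVf// mul1r.
  by apply/negP; rewrite -ltNge /M ltr_pwDr// ler_norm.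
have negA m : mu.-negligible (A m).
  exists (A m); split => //.
  exact: (density_measure_eq0 V0 (mA m) (nuA0 m)).
have [N [mN N0 sN]] := negligible_bigcup negA; exists N; split => // x /= ltM.
apply: sN; move/negP: ltM; rewrite -ltNge => ltM.
exists (Num.truncn (V x / h x)).+1 => //; split => /=.
  by rewrite -ler_pdivlMr// ltW.
by rewrite -ler_pdivrMr// ltW// truncnS_gt.
Qed.

End converse_hoelder.

Section necessity.
Context (R : realType) (n : nat) (v : weight R n) (p : R).
Hypothesis p1 : 1 <= p.
Local Notation E := (euclid R n).
Local Notation leb := (lebesgue R n).
Local Open Scope ereal_scope.

(** In [y] alone the kernel at time [t] is at least a Gaussian of exponent
    [2 / (1 - exp(-4t)) > 1]. *)
Lemma mehler_exp_ge (t : R) (x y : E) : (0 < t)%R ->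
  (gauss_weight (2 / (1 - expR (- (4 * t)))) x * gauss_weight (2 / (1 - expR (- (4 * t)))) y
   <= mehler_exp t x y)%R.
Proof.
move=> t0; have s0 := mehler_var_gt0 t0; set s := (1 - expR (- (4 * t)))%R in s0 *.
rewrite /gauss_weight /mehler_exp -expRD ler_expR -/s -opprD lerN2 -mulrDr.
rewrite ler_pdivrMr// mulrAC divfK ?gt_eqF//.
rewrite /sqnorm -big_split/= mulr_sumr; apply: ler_sum => i _.
set e := expR (- (2 * t)).
have e1 : (e <= 1)%R by rewrite /e -expR0 ler_expR oppr_le0 mulr_ge0// ltW.
have e0 : (0 <= e)%R by exact: expR_ge0.
have e2 : (e ^+ 2 * coord x i ^+ 2 <= coord x i ^+ 2)%R.
  by rewrite ler_piMl ?sqr_ge0// exprn_ile1.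
have := sqr_ge0 (coord y i + e * coord x i)%R.
nra.
Qed.

(** Although the point depends on the datum, comparison of the kernel with a
    Gaussian in [y] makes one and the same functional finite on all data, and
    duality applies to it. *)
Lemma mehler_cvg_DW (r : R) : (0 < r)%R ->
  (forall f : E -> R, f \in Lfun (weighted_gauss v) p%:E -> exists x, mehler_cvg r f x) ->
  DW p v.
Proof.
move=> r0 cvgf; have p0 : (0 < p)%R by exact: lt_le_trans p1.
pose a : R := (2 / (1 - expR (- (4 * r))))%R.
have s0 := mehler_var_gt0 r0; have s1 := mehler_var_lt1 r.
have a1 : (1 < a)%R by rewrite /a ltr_pdivlMr//; lra.
have a0 : (0 < a)%R by exact: lt_trans a1.
pose vt := weighted_gauss_density v.
have vt0 x : (0 < vt x)%R by exact: weighted_gauss_density_gt0.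
have mvt : measurable_fun setT vt by exact: measurable_weighted_gauss_density.
have ga0 (b : R) (x : E) : (0 < gauss_weight b x)%R by exact: gauss_weight_gt0.
have mga (b : R) : measurable_fun setT (@gauss_weight R n b) by exact: measurable_gauss_weight.
have fin (f : E -> R) : measurable_fun setT f -> (forall x, 0 <= f x)%R ->
    \int[leb]_x (f x `^ p * vt x)%:E < +oo -> \int[leb]_x (f x * gauss_weight a x)%:E < +oo.
  move=> mf f0 ff.
  have fL : f \in Lfun (weighted_gauss v) p%:E.
    apply/Lfun_weightedP; split => //; apply: (@lty_poweRy _ _ p); first by rewrite gt_eqF.
    rewrite (Lnorm_weighted v p0 mf); apply: le_lt_trans ff.
    by apply: ge0_le_integral_any => x _; rewrite lee_fin ger0_norm// mulr_ge0 ?powR_ge0// ltW.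
  have [x /integrableP[_ fx]] := cvgf f fL.
  have gx := ga0 a x.
  rewrite -(@lte_pmul2l _ (gauss_weight a x)%:E)// gt0_muley ?lte_fin//.
  rewrite -ge0_integralZl_EFin; last 4 first.
  - exact: measurableT.
  - by move=> y _; rewrite lee_fin mulr_ge0// ltW.
  - by apply/measurable_EFinP; exact: (measurable_funM mf (mga a)).
  - exact: ltW.
  apply: le_lt_trans fx; apply: ge0_le_integral_any => y _.
    by rewrite -EFinM lee_fin !mulr_ge0// ltW.
  rewrite -EFinM /= lee_fin normrM (ger0_norm (f0 y)) ger0_norm ?expR_ge0//.
  by rewrite (mulrC (f y)) mulrA ler_wpM2r// mehler_exp_ge.
have [C hC] := finite_functional_bounded mvt (mga a) vt0 (ga0 a) p1 fin.
have gfin := @integral_gauss_weight_lty R n 1%R ltr01.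
have tE : (a = p^-1 + (4 * (4 * (a - p^-1))^-1)^-1)%R.
  by rewrite invf_div mulrAC mulfV// mul1r addrC subrK.
have ap : (0 < a - p^-1)%R.
  by rewrite subr_gt0 (le_lt_trans _ a1)// invf_le1.
have t0 : (0 < (4 * (a - p^-1))^-1)%R by rewrite invr_gt0 mulr_gt0.
move: (p1); rewrite le_eqVlt => /predU1P[pE|pgt1]; last first.
  apply/(DW_gt1P v pgt1); exists (4 * (a - p^-1))^-1%R => //; rewrite -tE.
  exact: (bounded_functional_dual_gt1 mvt (mga a) vt0 (ga0 a) p1 (mga 1%R) (ga0 1%R) gfin hC pgt1).
have [M hM] := bounded_functional_dual_1 mvt (mga a) vt0 (mga 1%R) (ga0 1%R) gfin hC (esym pE).
rewrite -pE; apply/DW_1P; exists (4 * (a - p^-1))^-1%R => //; exists M.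
have -> : (1 + (4 * (4 * (a - p^-1))^-1)^-1)%R = a by rewrite [RHS]tE -pE invr1.
apply: filterS hM => x; rewrite /dual_dens invr1 powR_inv1//.
by rewrite ltW.
Qed.

Lemma mehler_max_lty_cvg (r t : R) (f : E -> R) x : (0 < t < r)%R ->
  mehler_max r f x < +oo -> mehler_cvg t f x.
Proof.
move=> tr; apply: contraPP => ncvg; rewrite ltey => /eqP; apply.
apply/eqP; rewrite -leye_eq; apply: ereal_sup_ubound; exists t => //=.
by rewrite /mehler; case: asboolP.
Qed.

End necessity.

(** * A closed space of data with almost everywhere limits *)

(** The set where every [Phi m] exceeds a given [e] has measure at most
    [K / (e (m + 1))] for all [m], hence zero. *)
Lemma weak_type_ae_small d (T : measurableType d) (R : realType)
    (mu : {measure set T -> \bar R}) (Phi : nat -> T -> \bar R) (K : R) :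
  (forall m, measurable_fun setT (Phi m)) ->
  (forall m (l : R), 0 < l ->
    (l%:E * mu [set x | l%:E < Phi m x] <= (K * (m.+1%:R)^-1)%:E)%E) ->
  exists N : set T, [/\ measurable N, mu N = 0%E &
    forall x, ~ N x -> forall k, exists m, (Phi m x <= ((k.+1%:R)^-1)%:E)%E].
Proof.
move=> mPhi weak; pose e k : R := (k.+1%:R)^-1.
have e0 k : 0 < e k by rewrite invr_gt0.
pose N k := \bigcap_m [set x | ((e k)%:E < Phi m x)%E].
have mN k : measurable (N k).
  by apply: bigcapT_measurable => m; exact: measurable_superlevel.
have N0 k : mu (N k) = 0%E.
  apply/eqP; rewrite eq_le measure_ge0 andbT; apply/lee_addgt0Pr => z z0; rewrite add0e.
  have K0 : 0 <= K.
    have := weak 0%N 1 ltr01; rewrite mul1e invr1 mulr1 => h.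
    by rewrite -lee_fin; apply: le_trans h; exact: measure_ge0.
  pose m := Num.truncn (K / (e k * z)).
  have le1 : (mu (N k) <= mu [set x | (e k)%:E < Phi m x])%E.
    apply: le_measure; rewrite ?inE//; first exact: measurable_superlevel.
    by move=> x; exact.
  apply: (le_trans le1); rewrite -(@lee_pmul2l _ (e k)%:E)// ?lte_fin//.
  apply: (le_trans (weak m _ (e0 k))); rewrite -EFinM lee_fin ler_pdivrMr//.
  rewrite mulrC -ler_pdivrMr; first exact/ltW/truncnS_gt.
  by rewrite mulr_gt0.
exists (\bigcup_k N k); split.
- exact: bigcupT_measurable.
- apply: measure_negligible; first exact: bigcupT_measurable.
  by apply: negligible_bigcup => k; apply/(negligibleP mu (mN k)); exact: N0.
move=> x nNx k; apply: contrapT => nm; apply: nNx; exists k => // m _ /=.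
by rewrite ltNge; apply/negP => le; apply: nm; exists m.
Qed.

Section mehler_linear.
Context (R : realType) (n : nat).
Local Notation E := (euclid R n).
Local Notation leb := (lebesgue R n).
Local Open Scope ereal_scope.

Lemma mehlerE t (f : E -> R) x : mehler_cvg t f x ->
  mehler t f x = (@mehler_factor R n t)%:E * \int[leb]_y (mehler_exp t x y * f y)%:E.
Proof. by move=> h; rewrite /mehler asboolT. Qed.

Lemma mehlerD t (f h : E -> R) x : mehler_cvg t f x -> mehler_cvg t h x ->
  mehler t (fun y => f y + h y)%R x = mehler t f x + mehler t h x.
Proof.
move=> cf ch.
have cD : mehler_cvg t (fun y => f y + h y)%R x.
  by apply: eq_integrable (integrableD measurableT cf ch) => // y _; rewrite -EFinD mulrDr.
rewrite !mehlerE// -muleDr//; last first.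
  by rewrite fin_num_adde_defl// integrable_fin_num.
by congr (_ * _); rewrite -integralD//; apply: eq_integral => y _; rewrite -EFinD mulrDr.
Qed.

Lemma mehlerZ t (k : R) (f : E -> R) x : mehler_cvg t f x ->
  mehler t (fun y => k * f y)%R x = k%:E * mehler t f x.
Proof.
move=> cf.
have cZ : mehler_cvg t (fun y => k * f y)%R x.
  by apply: eq_integrable (integrableZl measurableT k cf) => // y _; rewrite -EFinM mulrCA.
rewrite !mehlerE// muleCA; congr (_ * _); rewrite -integralZl//.
by apply: eq_integral => y _; rewrite -EFinM mulrCA.
Qed.

Lemma mehler_cvg_of_lty t (f : E -> R) x : mehler t f x < +oo -> mehler_cvg t f x.
Proof. by rewrite /mehler; case: asboolP. Qed.

End mehler_linear.

Section mehler_limits.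
Context (R : realType) (n : nat) (b : R).
Hypothesis b0 : 0 < b.
Local Notation E := (euclid R n).
Local Notation leb := (lebesgue R n).
Local Notation g := (@gauss_weight R n b).
Local Notation D := (@mehler_growth R n b).
Local Notation HM f := (heat_major (fun y : E => `|f y| * g y)%R).
Local Open Scope ereal_scope.

Let D0 x : (0 < D x)%R. Proof. exact: mehler_growth_gt0. Qed.
Let g0 x : (0 < g x)%R. Proof. exact: gauss_weight_gt0. Qed.

Let near_small : \forall t \near 0^'+, (0 < t)%R /\ (32 * b * t <= 1)%R.
Proof.
near=> t; split; first by near: t; exact: nbhs_right_gt.
have : (t <= (32 * b)^-1)%R by near: t; apply: nbhs_right_le; rewrite invr_gt0 mulr_gt0.
by rewrite -ler_pdivlMl ?mulr_gt0// mulr1.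
Unshelve. all: by end_near. Qed.

Lemma heat_major_fin_mehler t (f : E -> R) x : (0 < t)%R -> (32 * b * t <= 1)%R ->
  measurable_fun setT f -> HM f x < +oo ->
  mehler_cvg t f x /\ mehler t f x \is a fin_num.
Proof.
move=> t0 bt mf fin.
have : `|mehler t f x| < +oo.
  apply: le_lt_trans (mehler_abs_le x b0 t0 bt mf) _.
  by rewrite lte_mul_pinfty// lee_fin ltW.
rewrite -fin_num_abs => h; split => //; apply: mehler_cvg_of_lty.
by rewrite ltey_eq h.
Qed.

(** The difference [W_t f - f] is the sum of [W_t h - h], of [h - f], and of
    [W_t (f - h)], which the majorant bounds uniformly in [t]. *)
Lemma mehler_limit_approx (f : E -> R) x : measurable_fun setT f -> HM f x < +oo ->
  (forall e : R, (0 < e)%R -> exists h : E -> R,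
    [/\ measurable_fun setT h, HM h x < +oo,
      mehler t h x @[t --> 0^'+] --> (h x)%:E, (`|h x - f x| <= e)%R &
      (D x)%:E * HM (fun y => f y - h y)%R x <= e%:E]) ->
  mehler t f x @[t --> 0^'+] --> (f x)%:E.
Proof.
move=> mf ff approx; apply/fine_cvgP; split.
  near=> t; have [t0 bt] : (0 < t)%R /\ (32 * b * t <= 1)%R by near: t; exact: near_small.
  by have [] := heat_major_fin_mehler t0 bt mf ff.
apply/cvgrPdist_le => e e0; have e3 : (0 < e / 3)%R by rewrite divr_gt0.
have [h [mh hh /fine_cvgP[_ /cvgrPdist_le/(_ _ e3) nearh] fh Dh]] := approx _ e3.
near=> t; have [t0 bt] : (0 < t)%R /\ (32 * b * t <= 1)%R by near: t; exact: near_small.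
have hx : (`|h x - fine (mehler t h x)| <= e / 3)%R by near: t.
have mfh : measurable_fun setT (fun y => f y - h y)%R by exact: measurable_funB.
have fhfin : HM (fun y => f y - h y)%R x < +oo.
  rewrite ltey; apply: contraTN Dh => /eqP ->.
  by rewrite gt0_muley ?lte_fin// leye_eq.
have [cf _] := heat_major_fin_mehler t0 bt mf ff.
have [ch nh] := heat_major_fin_mehler t0 bt mh hh.
have [cfh nfh] := heat_major_fin_mehler t0 bt mfh fhfin.
have fE : mehler t f x = mehler t h x + mehler t (fun y => f y - h y)%R x.
  rewrite -mehlerD//; congr (mehler t _ x); apply/funext => y; by rewrite addrC subrK.
have dx : (`|fine (mehler t (fun y => f y - h y)%R x)| <= e / 3)%R.
  rewrite -lee_fin; apply: le_trans Dh.
  by rewrite -[leLHS]/(`|(fine (mehler t (fun y => f y - h y)%R x))%:E|) fineK// mehler_abs_le.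
rewrite /= fE fineD//.
have -> : (f x - (fine (mehler t h x) + fine (mehler t (fun y => f y - h y) x)) =
  - (h x - f x) + ((h x - fine (mehler t h x)) - fine (mehler t (fun y => f y - h y)%R x)))%R by ring.
apply: (le_trans (ler_normD _ _)); rewrite normrN.
rewrite (_ : e = e / 3 + (e / 3 + e / 3))%R; last by field.
apply: lerD => //; apply: (le_trans (ler_normB _ _)); exact: lerD.
Unshelve. all: by end_near. Qed.

Definition weighted_L1 (f : E -> R) :=
  measurable_fun setT f /\ \int[leb]_x (`|f x| * g x)%:E < +oo.

Definition ae_limit (f : E -> R) :=
  weighted_L1 f /\ {ae leb, forall x, mehler t f x @[t --> 0^'+] --> (f x)%:E}.

Lemma measurable_abs_weight (k : E -> R) :
  measurable_fun setT k -> measurable_fun setT (fun x => `|k x| * g x)%R.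
Proof.
move=> mk; apply: measurable_funM; last exact: measurable_gauss_weight.
exact: measurableT_comp.
Qed.

Lemma weighted_L1D f h : weighted_L1 f -> weighted_L1 h -> weighted_L1 (fun x => f x + h x)%R.
Proof.
move=> [mf ff] [mh fh]; split; first exact: measurable_funD.
have mabs (k : E -> R) : measurable_fun setT k -> measurable_fun setT (fun x => (`|k x| * g x)%:E).
  by move=> mk; apply/measurable_EFinP; exact: measurable_abs_weight.
have abs0 (k : E -> R) x : (0 <= `|k x| * g x)%R by rewrite mulr_ge0// ltW.
apply: (@le_lt_trans _ _ (\int[leb]_x ((`|f x| * g x)%:E + (`|h x| * g x)%:E))).
  apply: ge0_le_integral_any => x _; first by rewrite lee_fin mulr_ge0// ltW.
  by rewrite -EFinD lee_fin -mulrDl ler_wpM2r ?ler_normD// ltW.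
rewrite ge0_integralD; first exact: lte_add_pinfty.
- exact: measurableT.
- by move=> x _; rewrite lee_fin abs0.
- exact: mabs.
- by move=> x _; rewrite lee_fin abs0.
- exact: mabs.
Qed.

Lemma weighted_L1Z k f : weighted_L1 f -> weighted_L1 (fun x => k * f x)%R.
Proof.
move=> [mf ff]; split; first by apply: measurable_funM => //; exact: measurable_cst.
under eq_integral do rewrite normrM -mulrA EFinM.
rewrite ge0_integralZl_EFin; first by rewrite lte_mul_pinfty.
- exact: measurableT.
- by move=> x _; rewrite lee_fin mulr_ge0// ltW.
- by apply/measurable_EFinP; exact: measurable_abs_weight.
- by [].
Qed.

Lemma weighted_L1_le (f h : E -> R) : measurable_fun setT f ->
  (forall x, `|f x| <= `|h x|)%R -> weighted_L1 h -> weighted_L1 f.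
Proof.
move=> mf fh [mh hf]; split => //; apply: le_lt_trans hf.
apply: ge0_le_integral_any => x _; first by rewrite lee_fin mulr_ge0// ltW.
by rewrite lee_fin ler_wpM2r// ltW.
Qed.

Lemma weighted_L1_ae f : weighted_L1 f -> {ae leb, forall x, HM f x < +oo}.
Proof. by move=> [mf ff]; exact: heat_major_ae_lty. Qed.

Lemma ae_limitD f h : ae_limit f -> ae_limit h -> ae_limit (fun x => f x + h x)%R.
Proof.
move=> [Lf af] [Lh ah]; split; first exact: weighted_L1D.
have : \forall x \ae leb, HM f x < +oo /\ HM h x < +oo.
  by move: (weighted_L1_ae Lf) (weighted_L1_ae Lh); apply: filterS2.
move: af ah; apply: filterS3 => x cf ch [ff fh].
have : (mehler t f x + mehler t h x) @[t --> 0^'+] --> (f x)%:E + (h x)%:E by exact: cvgeD.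
apply: cvg_trans; apply: near_eq_cvg; near=> t.
have [t0 bt] : (0 < t)%R /\ (32 * b * t <= 1)%R by near: t; exact: near_small.
have [mf _] := Lf; have [mh _] := Lh.
have [c1 _] := heat_major_fin_mehler t0 bt mf ff.
have [c2 _] := heat_major_fin_mehler t0 bt mh fh.
by rewrite mehlerD.
Unshelve. all: by end_near. Qed.

Lemma ae_limitZ k f : ae_limit f -> ae_limit (fun x => k * f x)%R.
Proof.
move=> [Lf af]; split; first exact: weighted_L1Z.
move: af (weighted_L1_ae Lf); apply: filterS2 => x cf ff.
have : (k%:E * mehler t f x) @[t --> 0^'+] --> k%:E * (f x)%:E by exact: cvgeZl.
apply: cvg_trans; apply: near_eq_cvg; near=> t.
have [t0 bt] : (0 < t)%R /\ (32 * b * t <= 1)%R by near: t; exact: near_small.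
have [mf _] := Lf.
have [c1 _] := heat_major_fin_mehler t0 bt mf ff.
by rewrite mehlerZ.
Unshelve. all: by end_near. Qed.

(** If [h] approximates [f] in the Gaussian-weighted [L^1], then [h - f] is small
    off a set of small measure by Chebyshev's inequality, and so is the
    majorant of [f - h] by its weak type inequality. *)
Lemma ae_limit_closed (f : E -> R) : measurable_fun setT f ->
  (forall e : R, (0 < e)%R -> exists2 h, ae_limit h &
    \int[leb]_x (`|f x - h x| * g x)%:E <= e%:E) ->
  ae_limit f.
Proof.
move=> mf approx.
have Lf : weighted_L1 f.
  have [h [Lh _] fh] := approx 1%R ltr01; have [mh _] := Lh.
  have Lfh : weighted_L1 (fun x => f x - h x)%R.
    by split; [exact: measurable_funB|exact: le_lt_trans fh (ltry _)].
  have := weighted_L1D Lfh Lh.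
  by rewrite (_ : (fun x => _) = f)//; apply/funext => x; rewrite subrK.
split => //.
pose e (m : nat) : R := ((m.+1%:R)^-1)%R.
have e0 m : (0 < e m)%R by rewrite invr_gt0.
have /choice[h hh] : forall m : nat, exists h : E -> R, ae_limit h /\
    \int[leb]_x (`|f x - h x| * g x)%:E <= (e m)%:E.
  by move=> m; have [k k1 k2] := approx _ (e0 m); exists k.
have mh m : measurable_fun setT (h m) by have [[[]]] := hh m.
pose u m x := (`|f x - h m x| * g x)%R.
have u0 m x : (0 <= u m x)%R by rewrite mulr_ge0// ltW.
have mu m : measurable_fun setT (u m) := measurable_abs_weight (measurable_funB mf (mh m)).
have [K K0 weak] := @heat_major_weak_type R n.
pose Phi m x := heat_major (u m) x + (u m x)%:E.
have mPhi m : measurable_fun setT (Phi m).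
  by apply: emeasurable_funD; [exact: measurable_heat_major|exact/measurable_EFinP].
have weakPhi m (l : R) : (0 < l)%R ->
    l%:E * @gauss_measure R n [set x | l%:E < Phi m x] <= ((2 * K + 2) * e m)%:E.
  move=> l0; have l2 : (0 < l / 2)%R by rewrite divr_gt0.
  have [_ hm] := hh m.
  have mA : measurable [set x | (l / 2)%:E < heat_major (u m) x].
    by apply: measurable_superlevel; exact: measurable_heat_major.
  have mB : measurable [set x | (l / 2)%:E < (u m x)%:E].
    by apply: measurable_superlevel; exact/measurable_EFinP.
  have cheb : (l / 2)%:E * @gauss_measure R n [set x | (l / 2)%:E < (u m x)%:E] <= (e m)%:E.
    apply: (@le_trans _ _ ((l / 2)%:E * leb [set x | (l / 2)%:E < (u m x)%:E])).
      by apply: lee_wpmul2l; [rewrite lee_fin ltW|exact: gauss_measure_le].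
    apply: le_trans hm; rewrite -[X in X%:E * _](powRr1 (ltW l2)).
    apply: (@le_trans _ _ (\int[leb]_x ((u m x)%:E `^ 1))).
      apply: (chebyshev_poweR leb ltr01 l2); first exact/measurable_EFinP.
      by move=> x; rewrite lee_fin.
    by rewrite le_eqVlt; apply/orP; left; apply/eqP; apply: eq_integral => x _; rewrite poweRe1 ?lee_fin.
  have wk := le_trans (weak _ (mu m) (u0 m) _ l2) (lee_wpmul2l (ltW (K0 : 0 < K%:E)) hm).
  have cov : @gauss_measure R n [set x | l%:E < Phi m x] <=
      @gauss_measure R n [set x | (l / 2)%:E < heat_major (u m) x] +
      @gauss_measure R n [set x | (l / 2)%:E < (u m x)%:E].
    apply: (@le_trans _ _ (@gauss_measure R n ([set x | (l / 2)%:E < heat_major (u m) x] `|`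
        [set x | (l / 2)%:E < (u m x)%:E]))).
      apply: le_measure; rewrite ?inE; [exact: measurable_superlevel|exact: measurableU|].
      move=> x /= lx; have [|h1] := ltP (l / 2)%:E (heat_major (u m) x); first by left.
      right; rewrite ltNge; apply/negP => h2; move: lx; apply/negP; rewrite -leNgt.
      by rewrite [l in leRHS](splitr l) EFinD; exact: leeD.
    exact: measureU2.
  apply: (@le_trans _ _ (l%:E * (@gauss_measure R n [set x | (l / 2)%:E < heat_major (u m) x] +
      @gauss_measure R n [set x | (l / 2)%:E < (u m x)%:E]))).
    by apply: lee_wpmul2l => //; rewrite lee_fin ltW.
  rewrite ge0_muleDr ?measure_ge0//.
  have -> : l = (2 * (l / 2))%R by field.
  rewrite [in (2 * (l / 2))%:E]EFinM -!muleA.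
  have -> : ((2 * K + 2) * e m)%:E = 2%:E * (K * e m)%:E + 2%:E * (e m)%:E.
    by rewrite -!EFinM -EFinD; congr EFin; ring.
  rewrite (_ : 2 * (l / 2) = l)%R; last by field.
  by apply: leeD; apply: lee_wpmul2l.
have [N [mN N0 hN]] := weak_type_ae_small mPhi weakPhi.
have aeN : {ae leb, forall x, ~ N x}.
  exists N; split => //; last by move=> x /= /contrapT.
  exact: (@density_measure_eq0 _ _ _ leb _ (@measurable_gauss_density R n) (@gauss_density_ge0 R n) N (@gauss_density_gt0 R n) mN N0).
have aeh : \forall x \ae leb, forall m, mehler t (h m) x @[t --> 0^'+] --> (h m x)%:E.
  by apply/ae_foralln => m; have [[_]] := hh m.
have aeH : \forall x \ae leb, forall m, HM (h m) x < +oo.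
  by apply/ae_foralln => m; have [[Lh _] _] := hh m; exact: weighted_L1_ae.
have : \forall x \ae leb, ~ N x /\ HM f x < +oo.
  by move: aeN (weighted_L1_ae Lf); apply: filterS2.
move: aeh aeH; apply: filterS3 => x cvgh fh [nNx ff].
apply: mehler_limit_approx => // z z0.
pose d := Num.max (D x) (g x)^-1%R.
have d0 : (0 < d)%R by rewrite lt_max D0.
have [m Pm] := hN x nNx (Num.truncn (d / z)).
have dz : (d * (Num.truncn (d / z)).+1%:R^-1 <= z)%R.
  rewrite ler_pdivrMr// mulrC -ler_pdivrMr//; exact/ltW/truncnS_gt.
have HM0 : 0 <= heat_major (u m) x by exact: heat_major_ge0.
have dPhi : d%:E * Phi m x <= z%:E.
  apply: (@le_trans _ _ (d * (Num.truncn (d / z)).+1%:R^-1)%:E); last by rewrite lee_fin.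
  by rewrite EFinM; apply: lee_wpmul2l => //; rewrite lee_fin ltW.
exists (h m); split => //.
- rewrite -lee_fin; apply: le_trans dPhi.
  apply: (@le_trans _ _ (d%:E * (u m x)%:E)); last first.
    by apply: lee_wpmul2l; [rewrite lee_fin ltW|rewrite /Phi leeDr].
  rewrite -EFinM lee_fin /u distrC mulrCA -[leLHS]mulr1 ler_wpM2l//.
  by rewrite -ler_pdivrMr// mul1r le_max lexx orbT.
- apply: le_trans dPhi; apply: lee_pmul => //; first by rewrite lee_fin ltW.
    by rewrite lee_fin le_max lexx.
  by rewrite /Phi leeDl// lee_fin.
Qed.

End mehler_limits.

(** * Kernel mass and boxes *)

Section mehler_mass.
Context (R : realType) (n : nat).
Local Notation E := (euclid R n).
Local Notation leb := (lebesgue R n).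

(** The Mehler kernel is a product of normal densities of variance [s / 2],
    [s = 1 - exp(-4t)]. *)
Lemma mehler_kernel_prod (t : R) (x y : E) : 0 < t ->
  @mehler_factor R n t * mehler_exp t x y =
  \prod_(i < n) normal_pdf (expR (- (2 * t)) * coord x i)
    (Num.sqrt ((1 - expR (- (4 * t))) / 2)) (coord y i).
Proof.
move=> t0; have s0 := mehler_var_gt0 t0; set s := (1 - expR (- (4 * t))) in s0 *.
have s2 : 0 < s / 2 by rewrite divr_gt0.
have sn : Num.sqrt (s / 2) != 0 by rewrite gt_eqF// sqrtr_gt0.
under eq_bigr do rewrite normal_pdfE//.
rewrite big_split/= prodr_const card_ord; congr (_ * _).
  rewrite /mehler_factor -/s /normal_peak sqr_sqrtr ?(ltW s2)//.
  have -> : (s / 2 * pi *+ 2 = pi * s) by rewrite -mulr_natr; field.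
  have ps : 0 < pi * s by rewrite mulr_gt0// pi_gt0.
  have -> : (pi * s) `^ (n%:R / 2) = Num.sqrt (pi * s) ^+ n.
    by rewrite -(powR12_sqrt (ltW ps)) -powR_mulrn ?powR_ge0// -powRrM (mulrC n%:R).
  by rewrite exprVn.
rewrite /mehler_exp -/s /normal_fun sqr_sqrtr ?(ltW s2)//.
rewrite mulr_suml -sumrN expR_sum; apply: eq_bigr => i _; congr expR.
by rewrite -(mulr_natr (s / 2)) divfK// mulNr.
Qed.

Lemma mehler_mass (t : R) (x : E) : 0 < t ->
  (\int[leb]_y (@mehler_factor R n t * mehler_exp t x y)%:E = 1)%E.
Proof.
move=> t0; under eq_integral do rewrite mehler_kernel_prod//.
rewrite (integral_prod_coord (phi := fun i => normal_pdf (expR (- (2 * t)) * coord x i)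
    (Num.sqrt ((1 - expR (- (4 * t))) / 2)))).
- by apply: big1 => i _; exact: integral_normal_pdf.
- by move=> i; exact: measurable_normal_pdf.
- by move=> i u; exact: normal_pdf_ge0.
Qed.

Lemma mehler_cst (t : R) (c : R) (x : E) : 0 < t -> mehler t (fun=> c) x = c%:E.
Proof.
move=> t0; have f0 := @mehler_factor_gt0 R n t t0.
have me := measurable_mehler_exp t x.
have mE : measurable_fun setT (fun y => (mehler_exp t x y)%:E) by exact/measurable_EFinP.
have e0 y : (0 <= (mehler_exp t x y)%:E)%E by rewrite lee_fin expR_ge0.
have mass : ((@mehler_factor R n t)%:E * \int[leb]_y (mehler_exp t x y)%:E = 1)%E.
  rewrite -ge0_integralZl_EFin; [|exact: measurableT|by move=> y _; exact: e0|exact: mE|exact: ltW].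
  by rewrite -[RHS](mehler_mass x t0); apply: eq_integral => y _; rewrite EFinM.
have fin : (\int[leb]_y (mehler_exp t x y)%:E < +oo)%E.
  rewrite ltey; apply/negP => /eqP h; move: mass; rewrite h gt0_muley ?lte_fin//.
have ci : leb.-integrable setT (fun y => (mehler_exp t x y)%:E).
  apply/integrableP; split; first exact: mE.
  by under eq_integral do rewrite gee0_abs//.
have c1 : mehler_cvg t (fun=> 1) x.
  by apply: eq_integrable ci => // y _; rewrite mulr1.
have -> : (fun=> c) = (fun y : E => c * 1) by apply/funext => y; rewrite mulr1.
rewrite mehlerZ// mehlerE//.
have -> : (\int[leb]_y (mehler_exp t x y * 1)%:E = \int[leb]_y (mehler_exp t x y)%:E)%E.
  by apply: eq_integral => y _; rewrite mulr1.
by rewrite mass mule1.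
Qed.

End mehler_mass.

Section boxes.
Context (R : realType) (n : nat) (b : R).
Hypothesis b0 : 0 < b.
Local Notation E := (euclid R n).
Local Notation leb := (lebesgue R n).
Local Notation g := (@gauss_weight R n b).

(** Away from the diagonal the kernel is [O(t)] uniformly against [g_b], so
    only the values of a bounded function near [x] matter. *)
Lemma mehler_limit_local (f : E -> R) (x : E) (r : R) : measurable_fun setT f -> 0 < r ->
  (forall y, `|f y - f x| <= 1) ->
  (forall y, (forall i, `|coord y i - coord x i| < r) -> f y = f x) ->
  mehler t f x @[t --> 0^'+] --> (f x)%:E.
Proof.
move=> mf r0 f1 floc.
have mh : measurable_fun setT (fun y => f y - f x) by apply: measurable_funB => //; exact: measurable_cst.
pose G := fine (\int[leb]_y (g y)%:E).
have Gfin := integral_gauss_weight_lty n b0.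
have G0 : (0 <= \int[leb]_y (g y)%:E)%E.
  by apply: integral_ge0 => y _; rewrite lee_fin ltW// gauss_weight_gt0.
have GE : (\int[leb]_y (g y)%:E = G%:E)%E by rewrite fineK// ge0_fin_numE.
have G0' : 0 <= G by rewrite -lee_fin -GE.
pose A : R := n.+1`!%:R * (4 / r ^+ 2) ^+ n.+1.
have A0 : 0 <= A by rewrite mulr_ge0// exprn_ge0// divr_ge0// sqr_ge0.
pose C := expR ((1 + 2 * b) * sqnorm x) * (A * 4).
have C0 : 0 <= C by rewrite mulr_ge0 ?expR_ge0// mulr_ge0.
have bound t : 0 < t -> 32 * b * t <= 1 ->
    (`|mehler t (fun y => f y - f x)%R x| <= (C * t * G)%:E)%E.
  move=> t0 bt; apply: (le_trans (mehler_abs_le_integral x t0 mh)).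
  have s0 := mehler_var_gt0 t0; have s1 := mehler_var_lt1 t; have s4 := mehler_var_le t.
  have ff0 := @mehler_factor_gt0 R n t t0.
  have Ct0 : 0 <= C * t by rewrite mulr_ge0// ltW.
  have mg : measurable_fun setT (fun y => (g y)%:E).
    by apply/measurable_EFinP; exact: measurable_gauss_weight.
  have g0 y : 0 <= g y by rewrite ltW// gauss_weight_gt0.
  rewrite EFinM -GE -ge0_integralZl_EFin; last 4 first.
  - exact: measurableT.
  - by move=> y _; rewrite lee_fin.
  - exact: mg.
  - exact: Ct0.
  apply: ge0_le_integral_any => y _.
    by rewrite lee_fin mulr_ge0// mulr_ge0 ?expR_ge0// ltW.
  rewrite -EFinM lee_fin.
  have [near|/existsNP[i /negP]] := pselect (forall i, `|coord y i - coord x i| < r).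
    by rewrite floc// subrr normr0 mulr0 mulr_ge0.
  rewrite -leNgt => far.
  have far' := gauss_far s0 s1 r0 far.
  apply: (@le_trans _ _ (expR ((1 + 2 * b) * sqnorm x) * g y * (A * (4 * t)))); last first.
    by rewrite le_eqVlt; apply/orP; left; apply/eqP; rewrite /C; ring.
  rewrite -[leRHS]mulr1; apply: ler_pM => //; first by rewrite mulr_ge0 ?expR_ge0// ltW.
  apply: (le_trans (mehler_kernel_le x y b0 t0 bt)).
  apply: ler_wpM2l; first by rewrite mulr_ge0 ?expR_ge0.
  by apply: (le_trans far'); rewrite ler_wpM2l.
have near_small : \forall t \near 0^'+, (0 < t)%R /\ (32 * b * t <= 1)%R.
  near=> t; split; first by near: t; exact: nbhs_right_gt.
  have : (t <= (32 * b)^-1)%R by near: t; apply: nbhs_right_le; rewrite invr_gt0 mulr_gt0.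
  by rewrite -ler_pdivlMl ?mulr_gt0// mulr1.
have split_ t : 0 < t -> 32 * b * t <= 1 ->
    mehler t f x = ((f x)%:E + mehler t (fun y => f y - f x)%R x)%E /\
    mehler t (fun y => f y - f x)%R x \is a fin_num.
  move=> t0 bt; have hfin : mehler t (fun y => f y - f x)%R x \is a fin_num.
    by rewrite fin_num_abs; apply: le_lt_trans (bound t t0 bt) (ltry _).
  split => //; rewrite -(mehler_cst (f x) x t0) -mehlerD.
  - by congr (mehler t _ x); apply/funext => y; rewrite addrC subrK.
  - by apply: mehler_cvg_of_lty; rewrite mehler_cst// ltry.
  - by apply: mehler_cvg_of_lty; rewrite ltey_eq hfin.
apply/fine_cvgP; split.
  near=> t; have [t0 bt] : (0 < t)%R /\ (32 * b * t <= 1)%R by near: t; exact: near_small.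
  by have [-> h] := split_ t t0 bt; rewrite fin_numD h.
apply/cvgrPdist_le => e e0.
have CG : 0 < C * G + 1 by rewrite ltr_wpDl// mulr_ge0.
near=> t; have [t0 bt] : (0 < t)%R /\ (32 * b * t <= 1)%R by near: t; exact: near_small.
have te : t <= e / (C * G + 1) by near: t; apply: nbhs_right_le; rewrite divr_gt0.
have [E1 h] := split_ t t0 bt; have := bound t t0 bt.
rewrite /= E1 fineD//= opprD addrA subrr add0r normrN.
rewrite -{1}(fineK h) lee_fin => le1; apply: (le_trans le1).
move: te; rewrite ler_pdivlMr// => te; apply: le_trans te.
by rewrite mulrAC mulrC ler_wpM2l ?(ltW t0)// lerDl.
Unshelve. all: by end_near. Qed.

(** A finite or infinite lower bound for each coordinate: these boxes generate
    the Borel sets and are stable under intersection. *)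
Definition lower_box (c : 'I_n -> \bar R) : set E :=
  [set y | forall i, (c i < (coord y i)%:E)%E].

Lemma measurable_lower_box c : measurable (lower_box c).
Proof.
rewrite (_ : lower_box c = \bigcap_(i in [set: 'I_n]) [set y | (c i < (coord y i)%:E)%E]).
  apply: fin_bigcap_measurable => // i _.
  rewrite -[X in measurable X]setTI; apply: emeasurable_fun_o_infty; first exact: measurableT.
  by apply/measurable_EFinP; exact: measurable_coord.
by apply/seteqP; split=> [x h i _|x h i]; [exact: h|exact: (h i I)].
Qed.

Lemma coord_ae_neq (i : 'I_n) (a : R) : {ae leb, forall x, coord x i != a}.
Proof.
exists [set x | forall j, (if j == i then [set a] else setT) (coord x j)].
have mB j : measurable (if j == i then [set a] else setT : set R).
  by case: ifP => _ //; exact: measurable_set1.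
split.
- rewrite (_ : mkset _ = (fun x => coord x i) @^-1` [set a]).
    by rewrite -[X in measurable X]setTI; exact: measurable_coord.
  apply/seteqP; split=> x /= h; first by have := h i; rewrite eqxx.
  by move=> j; case: eqP => // ->.
- rewrite (lebesgue_box mB) (bigD1 i)//= eqxx lebesgue_measure_set1.
  by rewrite mul0e.
move=> x /= /negP; rewrite negbK => /eqP xa j.
by case: eqP => // ->.
Qed.

Lemma lower_box_ae_limit c : ae_limit b (\1_(lower_box c) : E -> R).
Proof.
have mI : measurable_fun setT (\1_(lower_box c) : E -> R).
  by apply: measurable_indic; exact: measurable_lower_box.
split.
  split => //; apply: le_lt_trans (integral_gauss_weight_lty n b0).
  apply: ge0_le_integral_any => x _; first by rewrite lee_fin mulr_ge0// ltW// gauss_weight_gt0.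
  rewrite lee_fin -[leRHS]mul1r ler_wpM2r ?(ltW (gauss_weight_gt0 b x))//.
  by rewrite indicE; case: (_ \in _); rewrite ?normr1 ?normr0.
have neq (i : 'I_n) : {ae leb, forall x : E, c i != (coord x i)%:E}.
  case ci : (c i) => [a| |]; [|exact: nearW|exact: nearW].
  have := coord_ae_neq i a; apply: filterS => x h.
  by rewrite eqe eq_sym.
have : \forall x \ae leb, forall i : 'I_n, c i != (coord x i)%:E by exact: filter_forall.
apply: filterS => x hx.
(* off the boundary hyperplanes, membership in each ray is locally constant *)
have dist i : exists2 r : R, 0 < r & forall u : R, `|u - coord x i| < r ->
    ((c i < u%:E) = (c i < (coord x i)%:E))%E.
  have := hx i; case: (c i) => [a| |] /= h.
  - have ha : 0 < `|coord x i - a| by rewrite normr_gt0 subr_eq0 eq_sym; move: h; rewrite eqe.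
    exists `|coord x i - a| => // u; rewrite !lte_fin ltr_norml.
    have [xa|ax] := ltP a (coord x i).
      rewrite ger0_norm ?subr_ge0 ?(ltW xa)// => /andP[h1 h2].
      by apply/idP; move: h1; rewrite opprB ltrBrDr subrK.
    rewrite ler0_norm ?subr_le0// => /andP[h1 h2].
    apply/negbTE; rewrite -leNgt; move: h2; rewrite opprB ltrBlDr subrK.
    exact: ltW.
  - by exists 1 => // u _; rewrite !ltNge !leey.
  - by exists 1 => // u _; rewrite !ltNyr.
have /choice[r hr] : forall i, exists r : R, 0 < r /\ forall u : R, `|u - coord x i| < r ->
    ((c i < u%:E) = (c i < (coord x i)%:E))%E.
  by move=> i; have [r r0 h] := dist i; exists r.
pose r0 := \big[Num.min/1]_i r i.
have r0gt : 0 < r0 by rewrite /r0; elim/big_ind: _ => // [u w u0 w0|i _]; [rewrite lt_min u0|have [] := hr i].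
apply: (mehler_limit_local mI r0gt).
  by move=> y; rewrite !indicE; case: (_ \in _); case: (_ \in _); rewrite ?subrr ?subr0 ?sub0r ?normrN ?normr1 ?normr0.
move=> y near.
have e i : ((c i < (coord y i)%:E) = (c i < (coord x i)%:E))%E.
  have [_ h] := hr i; apply: h; apply: (lt_le_trans (near i)).
  by rewrite /r0 (bigD1 i)//= ge_min lexx.
rewrite !indicE; congr ((_ : bool)%:R).
by apply/idP/idP; rewrite !inE => h i; have := h i; rewrite e.
Qed.

End boxes.

(** * From boxes to all data *)

Section lebesgue_approximation.
Context (R : realType) (n : nat).
Local Notation E := (euclid R n).
Local Notation leb := (lebesgue R n).
Local Notation RT := (measurableTypeR R).

Let boxes : set (set (n.-tuple RT)) := range (@lower_box R n).

Lemma lower_box_generates : @measurable _ (n.-tuple RT) = <<s boxes >>.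
Proof.
apply/seteqP; split; last first.
  apply: smallest_sub; first by split; [exact: measurable0|move=> A; rewrite setTD; exact: measurableC|move=> F; exact: bigcupT_measurable].
  move=> _ [c _ <-]; rewrite (_ : lower_box c = \bigcap_(i in [set: 'I_n]) [set y : n.-tuple RT | (c i < (tnth y i)%:E)%E]).
    apply: fin_bigcap_measurable => // i _.
    rewrite -[X in measurable X]setTI; apply: emeasurable_fun_o_infty; first exact: measurableT.
    by apply/measurable_EFinP; exact: measurable_tnth.
  by apply/seteqP; split=> [x h i _|x h i]; [exact: h|exact: (h i I)].
move=> A mA.
have : measurable_fun setT (id : g_sigma_algebraType boxes -> n.-tuple RT).
  apply/measurable_fun_tnthP => i.
  have : @measurable_fun _ _ (g_sigma_algebraType boxes) RT setT (fun y => tnth y i); last by [].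
  apply: (measurability _ (RGenOInfty.measurableE R)).
  move=> _ [_ [a ->] <-]; rewrite setTI; apply: sub_sigma_algebra.
  exists (fun j => if j == i then a%:E else -oo%E) => //.
  apply/seteqP; split=> y /=.
    by move=> /(_ i); rewrite eqxx in_itv/= andbT lte_fin.
  rewrite in_itv/= andbT => h j; case: eqP => [->|_]; first by rewrite lte_fin.
  exact: ltNyr.
by move=> /(_ measurableT A mA); rewrite setTI.
Qed.

Lemma lower_box_setI : setI_closed boxes.
Proof.
move=> _ _ [c _ <-] [d _ <-]; exists (fun i => maxe (c i) (d i)) => //.
apply/seteqP; split=> y /=.
  by move=> h; split=> i; have := h i; rewrite gt_max => /andP[].
by move=> [h1 h2] i; rewrite gt_max h1 h2.
Qed.

(** Lebesgue measure is an infimum over countable Borel covers. *)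
Lemma lebesgue_borel_cover (A : set E) (e : R) : measurable A -> (leb A < +oo)%E -> 0 < e ->
  exists U : set (n.-tuple RT), [/\ measurable U, A `<=` U & (leb (U `\` A) <= e%:E)%E].
Proof.
move=> mA Afin e0.
have Anum : leb A \is a fin_num by rewrite ge0_fin_numE.
have [_ [F [mF AF] <-] lt] := lb_ereal_inf_adherent e0 Anum.
have mU : measurable (\bigcup_k F k : set (n.-tuple RT)) by exact: bigcupT_measurable.
have mUE := measurable_euclid mU.
exists (\bigcup_k F k); split => //.
have leU : (leb (\bigcup_k F k) <= \sum_(0 <= k <oo) borel_lebesgue R n (F k))%E.
  rewrite lebesgueE//; apply: measure_sigma_subadditive => //.
have UE : (leb (\bigcup_k F k) = leb (\bigcup_k F k `\` A) + leb A)%E.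
  rewrite -measureU//; [|exact: measurableD|by rewrite setDKI].
  by rewrite setUC setDUK.
have : (leb (\bigcup_k F k `\` A) + leb A <= e%:E + leb A)%E.
  by rewrite -UE; apply: (le_trans leU); rewrite addeC; exact: ltW.
by rewrite leeD2rE.
Qed.

End lebesgue_approximation.

Section almost_everywhere_limits.
Context (R : realType) (n : nat) (b : R).
Hypothesis b0 : 0 < b.
Local Notation E := (euclid R n).
Local Notation leb := (lebesgue R n).
Local Notation RT := (measurableTypeR R).
Local Notation g := (@gauss_weight R n b).
Local Open Scope ereal_scope.

Let g0 x : (0 <= g x)%R. Proof. exact/ltW/gauss_weight_gt0. Qed.

Lemma ae_limit_dominated (f F : E -> R) (h : nat -> E -> R) :
  measurable_fun setT f -> weighted_L1 b F -> (forall m, ae_limit b (h m)) ->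
  (forall m x, `|h m x| <= `|F x|)%R -> (forall x, `|f x| <= `|F x|)%R ->
  (forall x, h m x @[m --> \oo] --> f x) -> ae_limit b f.
Proof.
move=> mf [mF fF] ah hF fleF hf.
have mh m : measurable_fun setT (h m) by have [[]] := ah m.
pose k m x := (`|f x - h m x| * g x)%:E.
have mk m : measurable_fun setT (k m).
  by apply/measurable_EFinP; apply: measurable_abs_weight; exact: measurable_funB.
have iF : leb.-integrable setT (fun x => (2 * (`|F x| * g x))%:E).
  apply/integrableP; split.
    apply/measurable_EFinP; apply: measurable_funM; first exact: measurable_cst.
    exact: measurable_abs_weight.
  under eq_integral do rewrite gee0_abs ?lee_fin ?mulr_ge0// EFinM.
  rewrite ge0_integralZl_EFin; first by rewrite lte_mul_pinfty.
  - exact: measurableT.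
  - by move=> x _; rewrite lee_fin mulr_ge0.
  - by apply/measurable_EFinP; exact: measurable_abs_weight.
  - by [].
have cvgk : \int[leb]_x k m x @[m --> \oo] --> \int[leb]_x (cst 0 x).
  have [] // := @dominated_convergence _ _ _ leb setT measurableT k (cst 0) (fun x => (2 * (`|F x| * g x))%:E).
  - apply: aeW => x _; rewrite /k /=.
    rewrite -[0%E]/((0 : R)%:E) ; apply: cvg_EFin; first exact: nearW.
    rewrite -[X in _ --> X](mul0r (g x)); apply: cvgMl.
    rewrite -[X in _ --> X](@normr0 _ R) -(subrr (f x)); apply: cvg_norm.
    by apply: cvgB; [exact: cvg_cst|exact: hf].
  - apply: aeW => x m _; rewrite /k /= lee_fin ger0_norm ?mulr_ge0// mulrA.
    rewrite ler_wpM2r// mulr_natl mulr2n.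
    by apply: (le_trans (ler_normB _ _)); exact: lerD.
apply: (ae_limit_closed b0 mf) => e e0.
rewrite integral0 in cvgk.
have : \forall m \near \oo, \int[leb]_x k m x < e%:E.
  have /fine_cvgP[fink /cvgrPdist_lt/(_ _ e0) nearfin] := cvgk.
  near=> m; have mfin : \int[leb]_x k m x \is a fin_num by near: m.
  rewrite -(fineK mfin) lte_fin; apply: (le_lt_trans (ler_norm _)).
  by rewrite -[X in (X < _)%R]normrN -sub0r; near: m.
move=> [m _ /(_ m (leqnn m)) /= lt]; exists (h m) => //; exact: ltW.
Unshelve. all: by end_near. Qed.

Lemma weighted_L1_cst (c : R) : weighted_L1 b (cst c : E -> R).
Proof.
split; first exact: measurable_cst.
have := integral_scaled_gauss_weight_lty n b0 (normr_ge0 c).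
by congr (_ < _); apply: eq_integral => x _; rewrite EFinM.
Qed.

Lemma ae_limit0 : ae_limit b ((fun=> 0%R) : E -> R).
Proof.
split; first exact: weighted_L1_cst.
apply: aeW => x; apply: cvg_near_cst; near=> t.
by rewrite mehler_cst//; near: t; exact: nbhs_right_gt.
Unshelve. all: by end_near. Qed.

Lemma ae_limit_sum (I : Type) (s : seq I) (P : pred I) (f : I -> E -> R) :
  (forall i, ae_limit b (f i)) -> ae_limit b (fun x => \sum_(i <- s | P i) f i x)%R.
Proof.
move=> af; elim: s => [|i s IH].
  by under eq_fun do rewrite big_nil; exact: ae_limit0.
under eq_fun do rewrite big_cons.
by case: (P i); [exact: (ae_limitD b0 (af i) IH)|exact: IH].
Qed.

Let indic_norm_le1 (A : set E) x : (`|\1_A x| <= 1 :> R)%R.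
Proof. by rewrite indicE; case: (_ \in _); rewrite ?normr1 ?normr0. Qed.

(** Boxes are stable under intersection and generate the Borel sets; the other
    steps of Dynkin's induction are linearity and dominated convergence. *)
Lemma borel_ae_limit (A : set (n.-tuple RT)) : measurable A -> ae_limit b (\1_(A : set E) : E -> R).
Proof.
have genE := @lower_box_generates R n.
rewrite [in measurable _]genE.
move: A; apply: (@dynkin_induction _ (n.-tuple RT) _ (fun A => ae_limit b (\1_(A : set E) : E -> R)) genE (@lower_box_setI R n)).
- rewrite (_ : setT = lower_box (fun=> -oo)); first exact: lower_box_ae_limit.
  by apply/seteqP; split => // x _ i; exact: ltNyr.
- by move=> _ [c _ <-]; exact: lower_box_ae_limit.
- move=> S mS aS; rewrite (_ : \1_(~` S) = (fun x => 1 + (-1) * \1_(S : set E) x)%R).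
    have a1 : ae_limit b ((fun=> 1%R) : E -> R).
      rewrite (_ : (fun=> 1%R) = \1_(lower_box (fun=> -oo) : set E)); first exact: lower_box_ae_limit.
      by apply/funext => x; rewrite indicE mem_set// => i; exact: ltNyr.
    exact: (ae_limitD b0 a1 (ae_limitZ b0 (-1) aS)).
  apply/funext => x; rewrite !indicE in_setC.
  by case: (_ \in _) => /=; rewrite ?mulr1 ?mulr0 ?subrr ?addr0.
- move=> F mF tF aF.
  have mbig m : measurable (\big[setU/set0]_(i < m) F i) by exact: bigsetU_measurable.
  apply: (@ae_limit_dominated _ (cst 1%R) (fun m => \1_(\big[setU/set0]_(i < m) F i : set E))).
  + by apply: measurable_indic; apply: measurable_euclid; exact: bigcupT_measurable.
  + exact: weighted_L1_cst.
  + elim=> [|m IH].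
      rewrite big_ord0 indic0; exact: ae_limit0.
    rewrite big_ord_recr/= (_ : \1_(_ `|` _) = (fun x => \1_(\big[setU/set0]_(i < m) F i : set E) x + \1_(F m : set E) x)%R).
      exact: (ae_limitD b0 IH (aF m)).
    have tF' : trivIset (fun i => is_true (xpredT i)) F by apply: sub_trivIset tF.
    have disj := @trivIset_bigsetUI _ xpredT F tF' m m isT (leqnn m).
    apply/funext => x; rewrite !indicE in_setU.
    case: (boolP (x \in _)) => [/set_mem x1|_]; last by rewrite add0r.
    by rewrite memNset ?addr0// => x2; rewrite -[False]/(set0 x) -disj.
  + move=> m x; rewrite [leRHS]normr1; exact: indic_norm_le1.
  + move=> x; rewrite [leRHS]normr1; exact: indic_norm_le1.
  move=> x; have [[j _ Fjx]|nF] := pselect ((\bigcup_k F k) x).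
    apply: cvg_near_cst; exists j.+1 => // m /= jm.
    rewrite !indicE !mem_set//; first by exists j.
    by rewrite -bigcup_mkord; exists j.
  apply: cvg_near_cst; apply: nearW => m; rewrite !indicE !memNset//.
  by rewrite -bigcup_mkord => -[j _ Fjx]; apply: nF; exists j.
Qed.

Lemma measurable_sqnorm_le (m : R) : measurable [set x : E | (sqnorm x <= m)%R].
Proof.
have := measurable_fun_ler (@measurable_sqnorm R n) (measurable_cst m).
by move=> /(_ measurableT [set true] I); rewrite setTI.
Qed.

Lemma lebesgue_sqnorm_le_lty (m : R) : leb [set x : E | (sqnorm x <= m)%R] < +oo.
Proof.
apply: (@le_lt_trans _ _ (\int[leb]_x ((expR m)%:E * (gauss_weight 1 x)%:E))).
  rewrite -[X in leb X]setIT -integral_indic//; last exact: measurable_sqnorm_le.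
  apply: ge0_le_integral_any => x _; first by rewrite lee_fin.
  rewrite -EFinM lee_fin indicE; case: (boolP (_ \in _)) => [/[!inE]/= xm|_]; last first.
    by rewrite mulr_ge0 ?expR_ge0.
  by rewrite /gauss_weight -expRD mul1r -[leLHS]expR0 ler_expR subr_ge0.
by apply: integral_scaled_gauss_weight_lty => //; exact: expR_ge0.
Qed.

Lemma indic_ae_limit (A : set E) : measurable A -> ae_limit b (\1_A : E -> R).
Proof.
have finite (B : set E) : measurable B -> leb B < +oo -> ae_limit b (\1_B : E -> R).
  move=> mB Bfin; have mI : measurable_fun setT (\1_B : E -> R) by exact: measurable_indic.
  apply: (ae_limit_closed b0 mI) => e e0.
  have [U [mU BU le]] := lebesgue_borel_cover mB Bfin e0.
  exists (\1_(U : set E)); first exact: borel_ae_limit.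
  have mD : measurable (U `\` B : set E) by apply: measurableD => //; exact: measurable_euclid.
  apply: le_trans le; rewrite -[X in leb X]setIT -integral_indic//.
  apply: ge0_le_integral_any => x _; first by rewrite lee_fin mulr_ge0.
  rewrite lee_fin -[leRHS]mulr1; apply: ler_pM => //; last first.
    rewrite /gauss_weight -expR0 ler_expR oppr_le0 mulr_ge0 ?sqnorm_ge0//; exact: ltW.
  rewrite !indicE in_setD; case: (boolP (x \in B)) => [xB|_].
    by rewrite (_ : x \in U = true) ?subrr ?normr0//; exact: mem_set (BU _ (set_mem xB)).
  by rewrite sub0r normrN andbT; case: (x \in U); rewrite ?normr1 ?normr0.
move=> mA; pose K (m : nat) := [set x : E | (sqnorm x <= m%:R)%R].
apply: (@ae_limit_dominated _ (cst 1%R) (fun m => \1_(A `&` K m))).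
- exact: measurable_indic.
- exact: weighted_L1_cst.
- move=> m; apply: finite; first by apply: measurableI => //; exact: measurable_sqnorm_le.
  by apply: le_lt_trans (lebesgue_sqnorm_le_lty m%:R); apply: le_lebesgue; exact: subIsetr.
- move=> m x; rewrite [leRHS]normr1; exact: indic_norm_le1.
- move=> x; rewrite [leRHS]normr1; exact: indic_norm_le1.
move=> x; apply: cvg_near_cst; exists (Num.truncn (sqnorm x)).+1 => // m /= xm.
rewrite indicI/= [X in (_ * X)%R](_ : _ = 1%R) ?mulr1//.
rewrite indicE mem_set//= /K /=; apply: le_trans (_ : (Num.truncn (sqnorm x)).+1%:R <= _)%R.
  exact/ltW/truncnS_gt.
by rewrite ler_nat.
Qed.

Import HBNNSimple.

(** Simple functions approximate by dominated convergence, the indicators being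
    reached from boxes by Dynkin's theorem and outer regularity; the limit
    property survives each passage because it is closed. *)
Lemma weighted_L1_ae_limit (f : E -> R) : weighted_L1 b f -> ae_limit b f.
Proof.
have nonneg (h : E -> R) : (forall x, 0 <= h x)%R -> weighted_L1 b h -> ae_limit b h.
  move=> h0 Lh; have [mh _] := Lh.
  have mhE : measurable_fun setT (EFin \o h) by exact/measurable_EFinP.
  pose k := nnsfun_approx measurableT mhE.
  have kle m x : (k m x <= h x)%R.
    by rewrite -lee_fin nnsfun_approxE; apply: le_approx => // y _; rewrite lee_fin.
  apply: (@ae_limit_dominated h h (fun m => k m)) => //.
  - move=> m; rewrite (_ : (k m : E -> R) = (fun x => \sum_(y <- finmap.enum_fset (fset_set (range (k m))))
      (y * \1_(k m @^-1` [set y]) x))%R).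
      apply: ae_limit_sum => y; apply: ae_limitZ => //; apply: indic_ae_limit.
      exact: measurable_funPTI.
    by apply/funext => x; rewrite fimfunE fsbig_finite.
  - by move=> m x; rewrite !ger0_norm.
  - move=> x; have h1 := @cvg_nnsfun_approx _ _ _ _ measurableT _ mhE (fun y _ => h0 y) x I.
    by move: h1 => /fine_cvgP[].
move=> Lf; have [mf _] := Lf.
pose fp x := Num.max (f x) 0%R; pose fn x := Num.max (- f x)%R 0%R.
have fE : f = (fun x => fp x + (-1) * fn x)%R.
  apply/funext => x; rewrite /fp /fn.
  have [f0|f0] := leP 0%R (f x).
    by rewrite max_r ?oppr_le0// mulr0 addr0.
  by rewrite max_l ?oppr_ge0 ?(ltW f0)// mulN1r opprK add0r.
have mfp : measurable_fun setT fp by apply: measurable_maxr; [exact: mf|exact: measurable_cst].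
have mfn : measurable_fun setT fn.
  by apply: measurable_maxr; [exact: measurable_funN|exact: measurable_cst].
have afp : ae_limit b fp.
  apply: nonneg; first by move=> x; rewrite le_max lexx orbT.
  apply: (weighted_L1_le mfp _ Lf) => x; rewrite /fp.
  by have [f0|f0] := leP 0%R (f x); rewrite ?normr0.
have afn : ae_limit b fn.
  apply: nonneg; first by move=> x; rewrite le_max lexx orbT.
  apply: (weighted_L1_le mfn _ Lf) => x; rewrite /fn.
  have [f0|f0] := leP 0%R (f x); first by rewrite max_r ?oppr_le0// normr0.
  by rewrite max_l ?oppr_ge0 ?(ltW f0)// normrN.
by rewrite fE; exact: (ae_limitD b0 afp (ae_limitZ b0 (-1) afn)).
Qed.

End almost_everywhere_limits.

(** * The equivalences *)

Section equivalences.
Context (R : realType) (n : nat) (v : weight R n) (p : R).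
Hypothesis p1 : 1 <= p.
Local Notation E := (euclid R n).
Local Notation leb := (lebesgue R n).
Local Open Scope ereal_scope.

Let p0 : (0 < p)%R. Proof. exact: lt_le_trans p1. Qed.

Lemma DW_mehler_limits : DW p v -> exists2 r : R, (0 < r)%R &
  forall f : E -> R, f \in Lfun (weighted_gauss v) p%:E ->
    {ae leb, forall x, mehler_cvg r f x} /\
    {ae leb, forall x, exists l : R, mehler t f x @[t --> 0^'+] --> l%:E}.
Proof.
move=> /(DW_L1 p1)[b [K [b0 K0 hK]]].
have r0 : (0 < (32 * b)^-1)%R by rewrite invr_gt0 mulr_gt0.
have br : (32 * b * (32 * b)^-1 <= 1)%R by rewrite mulfV// gt_eqF// mulr_gt0.
exists (32 * b)^-1%R => // f /Lfun_weightedP[mf Nf].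
have fin : weighted_L1 b f.
  by split => //; apply: le_lt_trans (hK f mf) _; rewrite lte_mul_pinfty.
split.
  have := weighted_L1_ae fin; apply: filterS => x hx.
  by have [] := heat_major_fin_mehler b0 r0 br mf hx.
have [_] := weighted_L1_ae_limit b0 fin; apply: filterS => x hx.
by exists (f x).
Qed.

Lemma lebesgue_ae_exists (P : E -> Prop) : {ae leb, forall x, P x} -> exists x, P x.
Proof.
move=> [N [mN N0 sN]]; apply: contrapT => nP.
have := @lebesgue_setT_gt0 R n; rewrite ltNge => /negP; apply.
by rewrite -N0; apply: le_lebesgue => x _; apply: sN => /= Px; apply: nP; exists x.
Qed.

Lemma weighted_gauss_setT_gt0 (w : weight R n) : 0 < weighted_gauss w setT.
Proof.
rewrite lt_neqAle measure_ge0 andbT eq_sym; apply/negP => /eqP h.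
have g0 : @gauss_measure R n setT = 0.
  exact: (@density_measure_eq0 _ _ _ (@gauss_measure R n) _ (weight_measurable w)
    (weight_ge0 w) setT (weight_gt0 w) measurableT h).
have l0 : leb setT = 0.
  exact: (@density_measure_eq0 _ _ _ leb _ (@measurable_gauss_density R n)
    (@gauss_density_ge0 R n) setT (@gauss_density_gt0 R n) measurableT g0).
by have := @lebesgue_setT_gt0 R n; rewrite l0 ltxx.
Qed.

(** Were the maximal function infinite everywhere, its superlevel sets would all
    have the same positive measure, contradicting the decay in [l]. *)
Lemma weak_type_max_lty (r : R) (w : weight R n) (f : E -> R) : (0 < r)%R ->
  weak_type p (weighted_gauss v) (weighted_gauss w) (@mehler_max R n r) ->
  f \in Lfun (weighted_gauss v) p%:E -> exists x, mehler_max r f x < +oo.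
Proof.
move=> r0 [C hC] fL; apply: contrapT => nx.
have Moo x : mehler_max r f x = +oo.
  by apply/eqP; apply: contrapT => /negP h; apply: nx; exists x; rewrite ltey.
have [_ Nf] := (Lfun_weightedP v p f).1 fL.
have m0 := weighted_gauss_setT_gt0 w.
have [A NA] : exists A : R, 'N[weighted_gauss v]_p%:E[EFin \o f] `^ p = A%:E.
  exists (fine ('N[weighted_gauss v]_p%:E[EFin \o f] `^ p)).
  by rewrite fineK// ge0_fin_numE ?poweR_ge0// poweR_lty.
have weak (l : R) : (0 < l)%R -> (l `^ p)%:E * weighted_gauss w setT <= (C * A)%:E.
  move=> l0; have := hC f fL l l0; rewrite NA.
  rewrite (_ : mkset _ = setT); last first.
    by apply/seteqP; split => // x _ /=; rewrite Moo ltry.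
  by rewrite powRN muleAC lee_pdivlMr ?powR_gt0// muleC -EFinM.
have : weighted_gauss w setT \is a fin_num.
  rewrite ge0_fin_numE//; have := weak 1%R ltr01; rewrite powR1 mul1e => h.
  exact: le_lt_trans h (ltry _).
move: m0 weak; case: (weighted_gauss w setT) => [m| |]//; rewrite lte_fin => m0 weak _.
have CA : (0 <= C * A)%R.
  rewrite -lee_fin; apply: le_trans (weak 1%R ltr01).
  by rewrite powR1 mul1e ltW.
have l0 : (0 < ((C * A + 1) / m) `^ p^-1)%R.
  by rewrite powR_gt0// divr_gt0 ?ltr_wpDl.
have := weak _ l0; rewrite -powRrM mulVf ?gt_eqF// powRr1; last first.
  by apply: divr_ge0; [exact: addr_ge0|exact: ltW].
rewrite -EFinM lee_fin divfK; last by rewrite gt_eqF.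
by rewrite gerDl ler10.
Qed.

Lemma strong_type_max_lty (r : R) (w : weight R n) (f : E -> R) : (0 < r)%R ->
  strong_type p (weighted_gauss v) (weighted_gauss w) (@mehler_max R n r) ->
  f \in Lfun (weighted_gauss v) p%:E -> exists x, mehler_max r f x < +oo.
Proof.
move=> r0 [C hC] fL; apply: contrapT => nx.
have Moo x : mehler_max r f x = +oo.
  by apply/eqP; apply: contrapT => /negP h; apply: nx; exists x; rewrite ltey.
have [_ Nf] := (Lfun_weightedP v p f).1 fL.
have : 'N[weighted_gauss w]_p%:E[mehler_max r f] < +oo.
  apply: (le_lt_trans (hC f fL)).
  have [A ->] : exists A : R, 'N[weighted_gauss v]_p%:E[EFin \o f] = A%:E.
    by exists (fine 'N[weighted_gauss v]_p%:E[EFin \o f]); rewrite fineK// ge0_fin_numE// Lnorm_ge0.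
  exact: ltry.
have -> : 'N[weighted_gauss w]_p%:E[mehler_max r f] =
    (\int[weighted_gauss w]_x (cst +oo x)) `^ p^-1.
  rewrite unlock; congr (_ `^ _); apply: eq_integral => x _.
  by rewrite Moo gee0_abs// poweRyr// gt_eqF.
rewrite integral_cst// gt0_mulye ?weighted_gauss_setT_gt0//.
by rewrite poweRyr ?ltxx// invr_eq0 gt_eqF.
Qed.

(** At a point where the maximal function is finite, all the integrals with
    [t < r] converge absolutely. *)
Lemma max_lty_DW (r : R) : (0 < r)%R ->
  (forall f : E -> R, f \in Lfun (weighted_gauss v) p%:E -> exists x, mehler_max r f x < +oo) ->
  DW p v.
Proof.
move=> r0 fin; have r2 : (0 < r / 2)%R by rewrite divr_gt0.
apply: (mehler_cvg_DW p1 r2) => f fL; have [x hx] := fin f fL; exists x.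
by apply: mehler_max_lty_cvg hx; rewrite r2 ltr_pdivrMr// ltr_pMr// ltr1n.
Qed.

End equivalences.

Theorem theorem3p1 (R : realType) (n : nat) (n_gt0 : (0 < n)%N)
    (v : weight R n) (p : R) (p_ge1 : 1 <= p) :
  [<->
    (exists2 r : R, 0 < r & exists w : weight R n,
      if 1 < p then
        strong_type p (weighted_gauss v) (weighted_gauss w) (@mehler_max R n r)
      else
        weak_type p (weighted_gauss v) (weighted_gauss w) (@mehler_max R n r));
    (exists2 r : R, 0 < r & exists w : weight R n,
      weak_type p (weighted_gauss v) (weighted_gauss w) (@mehler_max R n r));
    (exists2 r : R, 0 < r &
      forall f : euclid R n -> R, f \in Lfun (weighted_gauss v) p%:E ->
        {ae lebesgue R n, forall x, mehler_cvg r f x} /\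
        {ae lebesgue R n, forall x,
          exists l : R, mehler t f x @[t --> 0^'+] --> l%:E});
    (exists2 r : R, 0 < r &
      forall f : euclid R n -> R, f \in Lfun (weighted_gauss v) p%:E ->
        {ae lebesgue R n, forall x, (mehler_max r f x < +oo)%E});
    DW p v].
Proof.
have weak_DW : (exists2 r : R, 0 < r & exists w : weight R n,
    weak_type p (weighted_gauss v) (weighted_gauss w) (@mehler_max R n r)) -> DW p v.
  move=> [r r0 [w hw]]; apply: (max_lty_DW p_ge1 r0) => f fL.
  exact: (weak_type_max_lty p_ge1 r0 hw fL).
tfae.
- have [p1|p1] := boolP (1 < p); move=> [r r0 [w hw]].
  + apply: (DW_weak_type p_ge1); apply: (max_lty_DW p_ge1 r0) => f fL.
    exact: (strong_type_max_lty p_ge1 r0 hw fL).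
  + by exists r => //; exists w.
- by move=> /weak_DW; exact: DW_mehler_limits.
- move=> [r r0 h]; apply: (DW_mehler_max_lty p_ge1); apply: (mehler_cvg_DW p_ge1 r0) => f fL.
  by have [cv _] := h f fL; exact: lebesgue_ae_exists.
- move=> [r r0 h]; apply: (max_lty_DW p_ge1 r0) => f fL.
  by apply: lebesgue_ae_exists; exact: h.
- move=> hv; have [p1|p1] := boolP (1 < p); first exact: DW_strong_type.
  exact: DW_weak_type.
Qed.
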